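(* There is a unique morphism of $2$-coloured dg operads $\mathrm{JB}:(\mathcal{HS}_\infty,\delta)\to(\mathcal{LP},0)$ such that $\mathrm{JB}(f_{1,0})=\phi$ and $\mathrm{JB}(\ell_2)=[\ ,\ ]_{\mathfrak g}$. It is given on the generators by $$\mathrm{JB}(\ell_m)=\begin{cases}[\ ,\ ]_{\mathfrak g}& m=2,\\ 0&\text{otherwise,}\end{cases}$$ $$\mathrm{JB}(f_{m,n})=\begin{cases}\dfrac{B_n}{n!}\displaystyle\sum_{\sigma\in\mathbb S_n}\big[\dots\big[\big[\phi(1),\sigma(1)+1\big]_{\mathfrak h},\sigma(2)+1\big]_{\mathfrak h}\dots,\sigma(n)+1\big]_{\mathfrak h}& m=1,\\ 0&\text{otherwise,}\end{cases}$$ where the straight input of $f_{1,n}$ is labelled $1$, its wavy inputs are labelled $2,\dots,n+1$, and $B_n$ are the Bernoulli numbers, $\sum_{n\ge0}\frac{B_n}{n!}z^n=\frac{z}{e^z-1}$ (so $B_0=1$, $B_1=-\frac12$, $B_2=\frac16$).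
   Context: Work over a field $\mathbb K$ of characteristic zero, with the Koszul sign rule. $2$-coloured operads have colours ''straight'' and ''wavy''. $(-1)^{\sigma(J_1\sqcup J_2)}$ is the sign of the permutation $[m]\to J_1\sqcup J_2$ for a splitting of $[m]=\{1,\dots,m\}$ into ordered subsets; $[p,q]=\{p,\dots,q\}$; $a(\dots,b(\dots),\dots)$ denotes $a\circ(1^{\otimes i}\otimes b\otimes1^{\otimes j})$ with the indicated relabelling of inputs. $\mathcal{HS}_\infty$ is the free $2$-coloured operad generated by $\ell_m$, $m\ge2$ (degree $2-m$, $m$ skewsymmetric straight inputs, straight output) and $f_{m,n}$, $m\ge1,n\ge0$ (degree $1-m$, $m$ skewsymmetric straight inputs, $n$ symmetric wavy inputs, wavy output), with differential $$\delta\ell_m=\sum_{[m]=J_1\sqcup J_2,\ |J_1|\ge2,|J_2|\ge1}(-1)^{|J_2|+1+\sigma(J_1\sqcup J_2)}\ell_{|J_2|+1}(\ell_{|J_1|}(J_1),J_2),$$ $$\delta f_{m,n}=\sum_{[m]=J_1\sqcup J_2,\ |J_1|\ge2}(-1)^{|J_2|+\sigma(J_1\sqcup J_2)}f_{|J_2|+1,n}(\ell_{|J_1|}(J_1),J_2;[m+1,m+n])$$ $$+\sum_{[m]=J_1\sqcup J_2,\ |J_1|,|J_2|\ge1;\ [m+1,m+n]=I_1\sqcup I_2}(-1)^{|J_1|(|J_2|+1)+\sigma(J_1\sqcup J_2)}f_{|J_1|,|I_1|+1}(J_1;f_{|J_2|,|I_2|}(J_2;I_2),I_1).$$ The operad of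 Lie pairs $\mathcal{LP}$ is the $2$-coloured operad (in degree $0$) generated by a skewsymmetric operation $[\ ,\ ]_{\mathfrak g}$ (two straight inputs, straight output), a skewsymmetric operation $[\ ,\ ]_{\mathfrak h}$ (two wavy inputs, wavy output) and an operation $\phi$ (one straight input, wavy output), modulo the Jacobi identities for both brackets and $\phi([1,2]_{\mathfrak g})=[\phi(1),\phi(2)]_{\mathfrak h}$. Its representations in a pair $(\mathfrak g,\mathfrak h)$ are pairs of Lie algebra structures with a Lie algebra morphism $\phi:\mathfrak g\to\mathfrak h$. *)

(* Defs.v *)
From HB Require Import structures.
From mathcomp Require Import all_boot all_order all_fingroup all_algebra.
From mathcomp Require Import boolp generic_quotient.
Set Implicit Arguments.
Unset Strict Implicit.
Unset Printing Implicit Defensive.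
From mathcomp Require Import zify.
Import GRing.Theory.
Local Open Scope ring_scope.
Local Open Scope quotient_scope.

Inductive colour := straight | wavy.

(* The input profile (c_1, ..., c_n) of a coloured operation. *)
Record arity := Arity { width : nat; tint :> 'I_width -> colour }.

Definition join m n T (f : 'I_m -> T) (g : 'I_n -> T) (k : 'I_(m + n)) : T :=
  match split k with inl i => f i | inr j => g j end.

Lemma joinL m n T (f : 'I_m -> T) (g : 'I_n -> T) i :
  join f g (lshift n i) = f i.
Proof. by rewrite /join -[lshift n i]/(unsplit (inl i)) unsplitK. Qed.

Lemma joinR m n T (f : 'I_m -> T) (g : 'I_n -> T) j :
  join f g (rshift m j) = g j.
Proof. by rewrite /join -[rshift m j]/(unsplit (inr j)) unsplitK. Qed.

Lemma join_ind m n (P : 'I_(m + n) -> Prop) :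
  (forall i, P (lshift n i)) -> (forall j, P (rshift m j)) -> forall k, P k.
Proof. by move=> hl hr k; case: (split_ordP k) => i ->. Qed.

Definition cat_arity (A B : arity) : arity :=
  @Arity (width A + width B) (join A B).
Notation "A |+| B" := (cat_arity A B) (at level 45, right associativity).

Definition mono (c : colour) (n : nat) : arity := @Arity n (fun=> c).

(* Straight inputs 1, ..., m followed by wavy inputs m+1, ..., m+n. *)
Definition mixed (m n : nat) : arity := mono straight m |+| mono wavy n.

(* A relabelling: input [i] of the source becomes input [f i] of the target. *)
Record iso (A B : arity) := Iso {
  relab :> 'I_(width A) -> 'I_(width B);
  relab_bij : bijective relab;
  relab_tint : forall i, B (relab i) = A i }.

Definition iid A : iso A A.
Proof. by exists id; first exists id. Defined.

Definition icomp A B C (g : iso B C) (f : iso A B) : iso A C.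
Proof.
exists (fun i => g (f i)); first exact: bij_comp (relab_bij g) (relab_bij f).
by move=> i; rewrite !relab_tint.
Defined.
Notation "g \oi f" := (icomp g f) (at level 50, left associativity).

Definition isum A A' B B' (f : iso A A') (g : iso B B') :
  iso (A |+| B) (A' |+| B').
Proof.
exists (join (fun i => lshift (width B') (f i))
             (fun j => rshift (width A') (g j))).
- have [f' fK f'K] := relab_bij f; have [g' gK g'K] := relab_bij g.
  exists (join (fun i => lshift (width B) (f' i))
               (fun j => rshift (width A) (g' j)));
  by elim/join_ind => i; rewrite !(joinL, joinR) ?(fK, gK, f'K, g'K).
- by elim/join_ind => i; rewrite /= !(joinL, joinR) relab_tint.
Defined.

Definition iassoc A B C : iso ((A |+| B) |+| C) (A |+| (B |+| C)).
Proof.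
exists (join (join (fun i => lshift (width B + width C) i)
                   (fun j => rshift (width A) (lshift (width C) j)))
             (fun k => rshift (width A) (rshift (width B) k))).
- exists (join (fun i => lshift (width C) (lshift (width B) i))
               (join (fun j => lshift (width C) (rshift (width A) j))
                     (fun k => rshift (width A + width B) k)));
  [ by elim/join_ind => [|k]; [elim/join_ind => i|]; rewrite /= !(joinL, joinR)
     | by elim/join_ind => [i|]; [|elim/join_ind => i]; rewrite /= !(joinL, joinR)].
- by elim/join_ind => [|k]; [elim/join_ind => i|]; rewrite /= !(joinL, joinR).
Defined.

Definition iassocV A B C : iso (A |+| (B |+| C)) ((A |+| B) |+| C).
Proof.
exists (join (fun i => lshift (width C) (lshift (width B) i))
             (join (fun j => lshift (width C) (rshift (width A) j))
                   (fun k => rshift (width A + width B) k))).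
- exists (join (join (fun i => lshift (width B + width C) i)
                     (fun j => rshift (width A) (lshift (width C) j)))
               (fun k => rshift (width A) (rshift (width B) k)));
  [ by elim/join_ind => [i|]; [|elim/join_ind => i]; rewrite /= !(joinL, joinR)
     | by elim/join_ind => [|k]; [elim/join_ind => i|]; rewrite /= !(joinL, joinR)].
- by elim/join_ind => [i|]; [|elim/join_ind => i]; rewrite /= !(joinL, joinR).
Defined.

Definition iswap A B : iso (A |+| B) (B |+| A).
Proof.
exists (join (fun i => rshift (width B) i) (fun j => lshift (width A) j)).
- exists (join (fun i => rshift (width A) i) (fun j => lshift (width B) j));
  by elim/join_ind => i; rewrite !(joinL, joinR).
- by elim/join_ind => i; rewrite /= !(joinL, joinR).
Defined.

Definition ilcomm A B C : iso (A |+| (B |+| C)) (B |+| (A |+| C)) :=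
  iassoc B A C \oi isum (iswap A B) (iid C) \oi iassocV A B C.

Definition iacac A B C D :
    iso ((A |+| B) |+| (C |+| D)) ((A |+| C) |+| (B |+| D)) :=
  iassocV A C (B |+| D) \oi isum (iid A) (ilcomm B C D)
    \oi iassoc A B (C |+| D).

Definition icat0 A : iso A (A |+| mono straight 0).
Proof.
exists (lshift 0); last by move=> i; rewrite /= joinL.
by exists (join id (fun j => cast_ord (addn0 _) (rshift _ j)));
  [move=> i; rewrite joinL | elim/join_ind => [i|[]//]; rewrite joinL].
Defined.

Definition imono c m n (f : 'I_m -> 'I_n) (fbij : bijective f) :
  iso (mono c m) (mono c n) := @Iso (mono c m) (mono c n) f fbij (fun=> erefl).

Definition iperm c n (s : 'S_n) : iso (mono c n) (mono c n) :=
  imono c (injF_bij (@perm_inj _ s)).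

Lemma cast_ord_bij m n (e : m = n) : bijective (cast_ord e).
Proof. by exists (cast_ord (esym e)); [exact: cast_ordK | exact: cast_ordKV]. Qed.

Definition icast c m n (e : m = n) : iso (mono c m) (mono c n) :=
  imono c (cast_ord_bij e).

Definition imerge c m n : iso (mono c m |+| mono c n) (mono c (m + n)).
Proof.
exists (fun i : 'I_(m + n) => i); first by exists id.
by elim/join_ind => i; rewrite /= !(joinL, joinR).
Defined.

Definition isplit c m n : iso (mono c (m + n)) (mono c m |+| mono c n).
Proof.
exists (fun i : 'I_(m + n) => i); first by exists id.
by elim/join_ind => i; rewrite /= !(joinL, joinR).
Defined.

(* Lists J increasingly, then its complement increasingly. *)
Definition unshuffle_fun n (J : {set 'I_n}) : 'I_(#|J| + #|~: J|) -> 'I_n :=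
  join (fun i => enum_val i) (fun j => enum_val j).

Lemma unshuffle_inj n (J : {set 'I_n}) : injective (@unshuffle_fun n J).
Proof.
rewrite /unshuffle_fun; elim/join_ind => i; elim/join_ind => j;
  rewrite ?(joinL, joinR) => e.
- by rewrite (enum_val_inj e).
- by have := enum_valP j; rewrite -e inE enum_valP.
- by have := enum_valP i; rewrite e inE enum_valP.
- by rewrite (enum_val_inj e).
Qed.

Lemma card_setU_C n (J : {set 'I_n}) : (#|J| + #|~: J|)%N = n.
Proof. by rewrite cardsC card_ord. Qed.

Lemma unshuffle_bij n (J : {set 'I_n}) : bijective (@unshuffle_fun n J).
Proof.
by apply: inj_card_bij (@unshuffle_inj n J) _; rewrite !card_ord card_setU_C.
Qed.

Definition iunshuffle c n (J : {set 'I_n}) :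
  iso (mono c #|J| |+| mono c #|~: J|) (mono c n) :=
  imono c (unshuffle_bij J) \oi imerge c #|J| #|~: J|.

Lemma split_perm_inj n (J : {set 'I_n}) :
  injective (fun i => @unshuffle_fun n J (cast_ord (esym (card_setU_C J)) i)).
Proof. by move=> i j /unshuffle_inj/cast_ord_inj. Qed.

(* The permutation [n] -> J \sqcup ~J whose sign is $(-1)^{\sigma(J_1\sqcup J_2)}$. *)
Definition split_perm n (J : {set 'I_n}) : 'S_n := perm (@split_perm_inj n J).

(* A 2-coloured operad in graded vector spaces, presented by partial
   compositions.  [oper A o n] is the space of degree-[n] operations with input
   profile [A] and output colour [o].  [comp a b] plugs [b] into the first input
   of [a] and lists the inputs of [b] before the remaining inputs of [a]; with
   relabellings this yields composition at an arbitrary input. *)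
Record operad (K : fieldType) := Operad {
  oper : arity -> colour -> int -> lmodType K;
  act : forall A B o n, iso A B -> oper A o n -> oper B o n;
  unit : forall c, oper (mono c 1) c 0;
  comp : forall c A B o m n k, m + n = k ->
    oper (mono c 1 |+| A) o m -> oper B c n -> oper (B |+| A) o k;
  actP : forall A B o n (f : iso A B) t (x y : oper A o n),
    act f (t *: x + y) = t *: act f x + act f y;
  act_id : forall A o n (f : iso A A) (x : oper A o n),
    f =1 id -> act f x = x;
  act_comp : forall A B C o n (f : iso A B) (g : iso B C) (h : iso A C)
    (x : oper A o n), h =1 g \o f -> act h x = act g (act f x);
  compPl : forall c A B o m n k (e : m + n = k) t
    (x y : oper (mono c 1 |+| A) o m) (b : oper B c n),
    comp e (t *: x + y) b = t *: comp e x b + comp e y b;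
  compPr : forall c A B o m n k (e : m + n = k) t
    (a : oper (mono c 1 |+| A) o m) (x y : oper B c n),
    comp e a (t *: x + y) = t *: comp e a x + comp e a y;
  comp_act : forall c A A' B B' o m n k (e : m + n = k)
    (f : iso A A') (g : iso B B')
    (a : oper (mono c 1 |+| A) o m) (b : oper B c n),
    comp e (act (isum (iid (mono c 1)) f) a) (act g b)
      = act (isum g f) (comp e a b);
  comp_unitl : forall B c n (e : 0 + n = n) (b : oper B c n),
    comp e (act (icat0 (mono c 1)) (unit c)) b = act (icat0 B) b;
  comp_unitr : forall c A o n (e : n + 0 = n)
    (a : oper (mono c 1 |+| A) o n),
    comp e a (unit c) = a;
  (* (a o_1 b) o_1 z = a o_1 (b o_1 z) *)
  comp_seq : forall c c' A B C o m n p mn np mnp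
    (e1 : m + n = mn) (e2 : mn + p = mnp) (e3 : n + p = np) (e4 : m + np = mnp)
    (a : oper (mono c 1 |+| A) o m) (b : oper (mono c' 1 |+| B) c n)
    (z : oper C c' p),
    comp e2 (act (iassoc (mono c' 1) B A) (comp e1 a b)) z
      = act (iassoc C B A) (comp e4 a (comp e3 b z));
  (* (a o_1 b) o_2 z = (-1)^(|b||z|) (a o_2 z) o_1 b *)
  comp_par : forall c c' A B C o m n p mn mp mnp
    (e1 : m + n = mn) (e2 : mn + p = mnp) (e3 : m + p = mp) (e4 : mp + n = mnp)
    (a : oper (mono c 1 |+| (mono c' 1 |+| A)) o m) (b : oper B c n)
    (z : oper C c' p),
    comp e2 (act (ilcomm B (mono c' 1) A) (comp e1 a b)) z
      = (-1) ^ (n * p) *: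
        act (ilcomm B C A)
          (comp e4
            (act (ilcomm C (mono c 1) A)
              (comp e3 (act (ilcomm (mono c 1) (mono c' 1) A) a) z)) b) }.

Record operad_morphism (K : fieldType) (P Q : operad K) := OperadMorphism {
  morph : forall A o n, oper P A o n -> oper Q A o n;
  morphP : forall A o n t (x y : oper P A o n),
    morph (t *: x + y) = t *: morph x + morph y;
  morph_act : forall A B o n (f : iso A B) (x : oper P A o n),
    morph (act f x) = act f (morph x);
  morph_unit : forall c, morph (unit P c) = unit Q c;
  morph_comp : forall c A B o m n k (e : m + n = k)
    (a : oper P (mono c 1 |+| A) o m) (b : oper P B c n),
    morph (comp e a b) = comp e (morph a) (morph b) }.

(* Cohomological convention: the differential raises the degree by 1. *)
Record differential (K : fieldType) (P : operad K) := Differential {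
  diff : forall A o n, oper P A o n -> oper P A o (n + 1);
  diffP : forall A o n t (x y : oper P A o n),
    diff (t *: x + y) = t *: diff x + diff y;
  diff_act : forall A B o n (f : iso A B) (x : oper P A o n),
    diff (act f x) = act f (diff x);
  diff_unit : forall c, diff (unit P c) = 0;
  diff_comp : forall c A B o m n k (e : m + n = k)
    (el : (m + 1) + n = k + 1) (er : m + (n + 1) = k + 1)
    (a : oper P (mono c 1 |+| A) o m) (b : oper P B c n),
    diff (comp e a b) = comp el (diff a) b + (-1) ^ m *: comp er a (diff b);
  diff_diff : forall A o n (x : oper P A o n), diff (diff x) = 0 }.

Record dg_operad (K : fieldType) := DgOperad {
  underlying :> operad K;
  dg_diff : differential underlying }.

Record dg_morphism (K : fieldType) (P Q : dg_operad K) := DgMorphism {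
  dg_morph :> operad_morphism P Q;
  dg_morph_diff : forall A o n (x : oper P A o n),
    morph dg_morph (diff (dg_diff P) x) = diff (dg_diff Q) (morph dg_morph x) }.

Lemma lin0 (K : fieldType) (V W : lmodType K) (f : V -> W) :
  (forall t x y, f (t *: x + y) = t *: f x + f y) -> f 0 = 0.
Proof. by move=> lf; have := lf (-1) 0 0; rewrite scaler0 addr0 scaleN1r addNr. Qed.

Definition zero_diff (K : fieldType) (P : operad K) : differential P.
Proof.
exists (fun A o n _ => 0) => //.
- by move=> A o n t x y; rewrite scaler0 addr0.
- by move=> A B o n f x; rewrite (lin0 (actP f)).
- move=> c A B o m n k e el er a b.
  rewrite (lin0 (f := fun x => comp el x b)); last by move=> *; exact: compPl.
  by rewrite (lin0 (f := comp er a)) ?scaler0 ?addr0 // => *; exact: compPr.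
Defined.

Record signature := Signature {
  gen : Set;
  gen_in : gen -> arity;
  gen_out : gen -> colour;
  gen_deg : gen -> int }.

(* Formal operadic expressions in the generators. *)
Inductive term (K : fieldType) (S : signature) : arity -> colour -> int -> Type :=
| TGen (g : gen S) : term K S (gen_in g) (gen_out g) (gen_deg g)
| TUnit c : term K S (mono c 1) c 0
| TAct A B o n (f : iso A B) (x : term K S A o n) : term K S B o n
| TComp c A B o m n k (e : m + n = k)
    (a : term K S (mono c 1 |+| A) o m) (b : term K S B c n) :
    term K S (B |+| A) o k
| TZero A o n : term K S A o n
| TAdd A o n (x y : term K S A o n) : term K S A o n
| TScale A o n (t : K) (x : term K S A o n) : term K S A o n.

Definition valuation K (S : signature) (Q : operad K) :=
  forall g : gen S, oper Q (gen_in g) (gen_out g) (gen_deg g).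

Fixpoint interp K S (Q : operad K) (v : valuation S Q) A o n
    (x : term K S A o n) : oper Q A o n :=
  match x with
  | TGen g => v g
  | TUnit c => unit Q c
  | TAct _ _ _ _ f x => act f (interp v x)
  | TComp _ _ _ _ _ _ _ e a b => comp e (interp v a) (interp v b)
  | TZero _ _ _ => 0
  | TAdd _ _ _ x y => interp v x + interp v y
  | TScale _ _ _ t x => t *: interp v x
  end.

Definition relations K S := forall A o n, term K S A o n -> term K S A o n -> Prop.

Definition model K S (R : relations K S) (Q : operad K) (v : valuation S Q) :=
  forall A o n (x y : term K S A o n), R A o n x y -> interp v x = interp v y.

Section Presented.
Variables (K : fieldType) (S : signature) (R : relations K S).

(* Equality forced by the operad axioms and [R]: the two expressions agree in
   every operad whose chosen elements satisfy [R]; since the quotient is itself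
   such an operad, this is the congruence generated by [R]. *)
Definition term_eq A o n : rel (term K S A o n) := fun x y =>
  `[< forall (Q : operad K) (v : valuation S Q),
        model R v -> interp v x = interp v y >].

Lemma term_eq_equiv A o n : equiv_class_of (@term_eq A o n).
Proof.
split=> [x|x y|y x z].
- by apply/asboolP.
- by apply/asboolP/asboolP => h Q v hv; rewrite h.
- by move=> /asboolP hxy /asboolP hyz; apply/asboolP => Q v hv; rewrite hxy ?hyz.
Qed.

Canonical term_equiv A o n := EquivRelPack (@term_eq_equiv A o n).

HB.instance Definition _ A o n := gen_eqMixin (term K S A o n).
HB.instance Definition _ A o n := gen_choiceMixin (term K S A o n).

Definition pres A o n : Type := {eq_quot @term_equiv A o n}.
HB.instance Definition _ A o n := Choice.on (pres A o n).

Definition cls A o n (x : term K S A o n) : pres A o n :=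
  \pi_{eq_quot @term_equiv A o n} x.

(* The value of an element of the quotient in a model. *)
Definition ev Q (v : valuation S Q) A o n (x : pres A o n) : oper Q A o n :=
  interp v (repr (x : {eq_quot @term_equiv A o n})).

Lemma ev_cls Q (v : valuation S Q) A o n (x : term K S A o n) :
  model R v -> ev v (cls x) = interp v x.
Proof.
move=> hv; rewrite /ev /cls; case: piP => y /eqquotP/asboolP h.
by rewrite (h Q v hv).
Qed.

Lemma ev_inj A o n (x y : pres A o n) :
  (forall Q (v : valuation S Q), model R v -> ev v x = ev v y) -> x = y.
Proof.
move=> h; rewrite -[x]reprK -[y]reprK; apply/eqquotP/asboolP => Q v hv.
exact: h.
Qed.

Definition padd A o n (x y : pres A o n) : pres A o n :=
  cls (TAdd (repr x) (repr y)).
Definition pzero A o n : pres A o n := cls (TZero K S A o n).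
Definition pscale A o n (t : K) (x : pres A o n) : pres A o n :=
  cls (TScale t (repr x)).
Definition popp A o n (x : pres A o n) : pres A o n := pscale (-1) x.

Lemma ev_add Q (v : valuation S Q) A o n (x y : pres A o n) :
  model R v -> ev v (padd x y) = ev v x + ev v y.
Proof. by move=> hv; rewrite ev_cls. Qed.

Lemma ev_zero Q (v : valuation S Q) A o n : model R v -> ev v (pzero A o n) = 0.
Proof. by move=> hv; rewrite ev_cls. Qed.

Lemma ev_scale Q (v : valuation S Q) A o n t (x : pres A o n) :
  model R v -> ev v (pscale t x) = t *: ev v x.
Proof. by move=> hv; rewrite ev_cls. Qed.

Let evE := (ev_add, ev_zero, ev_scale).

Lemma paddA A o n : associative (@padd A o n).
Proof. by move=> x y z; apply: ev_inj => Q v hv; rewrite !evE // addrA. Qed.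
Lemma paddC A o n : commutative (@padd A o n).
Proof. by move=> x y; apply: ev_inj => Q v hv; rewrite !evE // addrC. Qed.
Lemma padd0 A o n : left_id (pzero A o n) (@padd A o n).
Proof. by move=> x; apply: ev_inj => Q v hv; rewrite !evE // add0r. Qed.
Lemma paddN A o n : left_inverse (pzero A o n) (@popp A o n) (@padd A o n).
Proof.
by move=> x; apply: ev_inj => Q v hv; rewrite !evE // scaleN1r addNr.
Qed.

HB.instance Definition _ A o n :=
  GRing.isZmodule.Build (pres A o n)
    (@paddA A o n) (@paddC A o n) (@padd0 A o n) (@paddN A o n).

Lemma pscaleA A o n t u (x : pres A o n) :
  pscale t (pscale u x) = pscale (t * u) x.
Proof. by apply: ev_inj => Q v hv; rewrite !evE // scalerA. Qed.
Lemma pscale1 A o n : left_id 1 (@pscale A o n).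
Proof. by move=> x; apply: ev_inj => Q v hv; rewrite !evE // scale1r. Qed.
Lemma pscaleDr A o n : right_distributive (@pscale A o n) +%R.
Proof. by move=> t x y; apply: ev_inj => Q v hv; rewrite !evE // scalerDr. Qed.
Lemma pscaleDl A o n (x : pres A o n) : {morph (@pscale A o n)^~ x : t u / t + u}.
Proof. by move=> t u; apply: ev_inj => Q v hv; rewrite !evE // scalerDl. Qed.

HB.instance Definition _ A o n :=
  GRing.Zmodule_isLmodule.Build K (pres A o n)
    (@pscaleA A o n) (@pscale1 A o n) (@pscaleDr A o n) (@pscaleDl A o n).

Definition pact A B o n (f : iso A B) (x : pres A o n) : pres B o n :=
  cls (TAct f (repr x)).
Definition punit c : pres (mono c 1) c 0 := cls (TUnit K S c).
Definition pcomp c A B o m n k (e : m + n = k)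
    (a : pres (mono c 1 |+| A) o m) (b : pres B c n) : pres (B |+| A) o k :=
  cls (TComp e (repr a) (repr b)).

Lemma ev_act Q (v : valuation S Q) A B o n (f : iso A B) (x : pres A o n) :
  model R v -> ev v (pact f x) = act f (ev v x).
Proof. by move=> hv; rewrite ev_cls. Qed.

Lemma ev_unit Q (v : valuation S Q) c : model R v -> ev v (punit c) = unit Q c.
Proof. by move=> hv; rewrite ev_cls. Qed.

Lemma ev_comp Q (v : valuation S Q) c A B o m n k (e : m + n = k)
    (a : pres (mono c 1 |+| A) o m) (b : pres B c n) :
  model R v -> ev v (pcomp e a b) = comp e (ev v a) (ev v b).
Proof. by move=> hv; rewrite ev_cls. Qed.

Lemma ev_lin Q (v : valuation S Q) A o n t (x y : pres A o n) :
  model R v -> ev v (t *: x + y) = t *: ev v x + ev v y.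
Proof. by move=> hv; rewrite !evE. Qed.

Lemma ev_Z Q (v : valuation S Q) A o n t (x : pres A o n) :
  model R v -> ev v (t *: x) = t *: ev v x.
Proof. by move=> hv; rewrite evE. Qed.

Let evE' := (ev_lin, ev_Z, ev_act, ev_unit, ev_comp).

(* The operad generated by [S] subject to the relations [R]. *)
Definition presented : operad K.
Proof.
exists pres pact punit pcomp.
- by move=> *; apply: ev_inj => Q v hv; rewrite !evE' // actP.
- by move=> *; apply: ev_inj => Q v hv; rewrite !evE' // act_id.
- by move=> *; apply: ev_inj => Q v hv; rewrite !evE' //; apply: act_comp.
- by move=> *; apply: ev_inj => Q v hv; rewrite !evE' // compPl.
- by move=> *; apply: ev_inj => Q v hv; rewrite !evE' // compPr.
- by move=> *; apply: ev_inj => Q v hv; rewrite !evE' // comp_act.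
- by move=> *; apply: ev_inj => Q v hv; rewrite !evE' // comp_unitl.
- by move=> *; apply: ev_inj => Q v hv; rewrite !evE' // comp_unitr.
- by move=> *; apply: ev_inj => Q v hv; rewrite !evE' //; apply: comp_seq.
- by move=> *; apply: ev_inj => Q v hv; rewrite !evE' //; apply: comp_par.
Defined.

Definition pgen : valuation S presented := fun g => cls (TGen K g).

Lemma interp_pgen A o n (x : term K S A o n) : interp pgen x = cls x.
Proof.
apply: (@ev_inj A o n) => Q v hv; rewrite ev_cls //.
elim: x => //= [g|c|A' B o' n' f x <-|c A' B o' m n' k e a <- b <-|A' o' n'|A' o' n' x <- y <-|A' o' n' t x <-].
- exact: ev_cls.
- exact: ev_unit.
- exact: ev_act.
- exact: ev_comp.
- exact: ev_zero.
- exact: ev_add.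
- exact: ev_scale.
Qed.

Lemma pgen_model : model R pgen.
Proof.
move=> A o n x y hxy; rewrite !interp_pgen; apply: ev_inj => Q v hv.
by rewrite !ev_cls //; apply: hv.
Qed.

Lemma interp_morph (P Q : operad K) (F : operad_morphism P Q)
    (u : valuation S P) (v : valuation S Q) :
  (forall g, morph F (u g) = v g) ->
  forall A o n (x : term K S A o n), morph F (interp u x) = interp v x.
Proof.
move=> huv A o n; elim=> /= {A o n}
  [g|c|A B o n f x <-|c A B o m n k e a <- b <-|A o n|A o n x <- y <-|A o n t x <-].
- exact: huv.
- exact: morph_unit.
- exact: morph_act.
- exact: morph_comp.
- exact: lin0 (@morphP _ _ _ F A o n).
- by have := morphP F 1 (interp u x) (interp u y); rewrite !scale1r.
- have := morphP F t (interp u x) 0.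
  by rewrite (lin0 (@morphP _ _ _ F A o n)) !addr0.
Qed.

(* The universal property of [presented]. *)
Definition lift (Q : operad K) (v : valuation S Q) (hv : model R v) :
  operad_morphism presented Q.
Proof.
exists (fun A o n (x : pres A o n) => ev v x).
- by move=> *; exact: ev_lin.
- by move=> *; exact: ev_act.
- by move=> *; exact: ev_unit.
- by move=> *; exact: ev_comp.
Defined.

Lemma lift_gen (Q : operad K) (v : valuation S Q) (hv : model R v) g :
  morph (lift hv) (pgen g) = v g.
Proof. exact: ev_cls. Qed.

Lemma lift_unique (Q : operad K) (v : valuation S Q) (hv : model R v)
    (F : operad_morphism presented Q) :
  (forall g, morph F (pgen g) = v g) ->
  forall A o n (x : oper presented A o n), morph F x = morph (lift hv) x.
Proof.
move=> hF A o n x; rewrite -[x](@reprK _ {eq_quot @term_equiv A o n}).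
by rewrite -[\pi _]/(cls _) -interp_pgen (interp_morph hF) interp_pgen /= ev_cls.
Qed.

End Presented.

(* [Ell k] stands for $\ell_{k+2}$ and [Eff k n] for $f_{k+1,n}$. *)
Inductive hs_gen : Set := Ell of nat | Eff of nat & nat.

Definition HS_signature : signature := {|
  gen := hs_gen;
  gen_in g := match g with
    | Ell k => mono straight k.+2 | Eff k n => mixed k.+1 n end;
  gen_out g := match g with Ell _ => straight | Eff _ _ => wavy end;
  gen_deg g := match g with
    | Ell k => 2 - k.+2%:Z | Eff k _ => 1 - k.+1%:Z end |}.

Section Operads.
Variable K : fieldType.

Inductive HS_relations : relations K HS_signature :=
| ell_skew k (s : 'S_k.+2) :
    HS_relations
      (TAct (iperm straight s) (TGen K (Ell k : gen HS_signature)))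
      (TScale ((-1) ^+ odd_perm s) (TGen K (Ell k : gen HS_signature)))
| eff_sym k n (s : 'S_k.+1) (t : 'S_n) :
    HS_relations
      (TAct (isum (iperm straight s) (iperm wavy t))
        (TGen K (Eff k n : gen HS_signature)))
      (TScale ((-1) ^+ odd_perm s) (TGen K (Eff k n : gen HS_signature))).

(* The graded operad underlying $\mathcal{HS}_\infty$. *)
Definition HS : operad K := presented HS_relations.

(* Junk value 0 outside the ranges $m \ge 2$, resp. $m \ge 1$. *)
Definition ell (m : nat) : oper HS (mono straight m) straight (2 - m%:Z) :=
  match m with
  | k.+2 => pgen HS_relations (Ell k)
  | _ => 0
  end.

Definition eff (m n : nat) : oper HS (mixed m n) wavy (1 - m%:Z) :=
  match m with
  | k.+1 => pgen HS_relations (Eff k n)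
  | _ => 0
  end.

Section Differential.
Variables (m : nat) (J : {set 'I_m}).

Lemma deg_ell_ell :
  (2 - #|~: J|.+1%:Z) + (2 - #|J|%:Z) = (2 - m%:Z) + 1.
Proof. have := card_setU_C J; lia. Qed.

Lemma deg_eff_ell :
  (1 - #|~: J|.+1%:Z) + (2 - #|J|%:Z) = (1 - m%:Z) + 1.
Proof. have := card_setU_C J; lia. Qed.

Lemma deg_eff_eff : (1 - #|J|%:Z) + (1 - #|~: J|%:Z) = (1 - m%:Z) + 1.
Proof. have := card_setU_C J; lia. Qed.

(* $\ell_{|J_2|+1}(\ell_{|J_1|}(J_1), J_2)$ for $J_1 = J$, $J_2$ its complement. *)
Definition ell_ell : oper HS (mono straight m) straight (2 - m%:Z + 1) :=
  act (iunshuffle straight J)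
    (comp deg_ell_ell
      (act (isplit straight 1 #|~: J|) (ell #|~: J|.+1))
      (ell #|J|)).

(* $f_{|J_2|+1,n}(\ell_{|J_1|}(J_1), J_2; [m+1,m+n])$. *)
Definition eff_ell n : oper HS (mixed m n) wavy (1 - m%:Z + 1) :=
  act (isum (iunshuffle straight J) (iid (mono wavy n)) \oi iassocV _ _ _)
    (comp deg_eff_ell
      (act (iassoc _ _ _ \oi isum (isplit straight 1 #|~: J|) (iid (mono wavy n)))
        (eff #|~: J|.+1 n))
      (ell #|J|)).

(* $f_{|J_1|,|I_1|+1}(J_1; f_{|J_2|,|I_2|}(J_2; I_2), I_1)$ for $I_1 = I$. *)
Definition eff_eff n (I : {set 'I_n}) : oper HS (mixed m n) wavy (1 - m%:Z + 1) :=
  act (isum (iunshuffle straight J \oi iswap _ _) (iunshuffle wavy I \oi iswap _ _)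
       \oi iacac _ _ _ _)
    (comp deg_eff_eff
      (act (ilcomm _ _ _ \oi isum (iid (mono straight #|J|)) (isplit wavy 1 #|I|))
        (eff #|J| #|I|.+1))
      (eff #|~: J| #|~: I|)).

End Differential.

Definition HS_differential (d : differential HS) : Prop :=
  (forall m, (2 <= m)%N ->
    diff d (ell m) =
      \sum_(J : {set 'I_m} | (2 <= #|J|)%N && (1 <= #|~: J|)%N)
        (-1) ^+ (#|~: J| + 1 + odd_perm (split_perm J)) *: ell_ell J)
  /\
  (forall m n, (1 <= m)%N ->
    diff d (eff m n) =
      \sum_(J : {set 'I_m} | (2 <= #|J|)%N)
        (-1) ^+ (#|~: J| + odd_perm (split_perm J)) *: eff_ell J n
    + \sum_(J : {set 'I_m} | (1 <= #|J|)%N && (1 <= #|~: J|)%N)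
        \sum_(I : {set 'I_n})
          (-1) ^+ (#|J| * (#|~: J| + 1) + odd_perm (split_perm J))
            *: eff_eff J I).

(* [Br straight] and [Br wavy] are the brackets of g and h. *)
Inductive lp_gen : Set := Br of colour | Phi.

Definition LP_signature : signature := {|
  gen := lp_gen;
  gen_in g := match g with Br c => mono c 2 | Phi => mixed 1 0 end;
  gen_out g := match g with Br c => c | Phi => wavy end;
  gen_deg _ := 0 |}.

Notation TBr c := (TGen K (Br c : gen LP_signature)).
Notation TPhi := (TGen K (Phi : gen LP_signature)).

(* [[1, 2], 3] *)
Definition br_br c : term K LP_signature (mono c 3) c 0 :=
  TAct (imerge c 2 1)
    (TComp (addr0 0) (TAct (isplit c 1 1) (TBr c)) (TBr c)).

Definition cycle3 : 'S_3 := perm (@ordS_inj 3).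

(* phi([1, 2]) *)
Definition phi_br : term K LP_signature (mixed 2 0) wavy 0 :=
  TComp (addr0 0) TPhi (TBr straight).

(* [phi(1), phi(2)]; the composition lists the input of the second [phi] first. *)
Definition br_phi_phi : term K LP_signature (mixed 2 0) wavy 0 :=
  TAct (isum (imerge straight 1 1) (imerge wavy 0 0) \oi iacac _ _ _ _ \oi iswap _ _)
    (TComp (addr0 0)
      (TAct (iswap _ _)
        (TComp (addr0 0) (TAct (isplit wavy 1 1) (TBr wavy)) TPhi))
      TPhi).

Inductive LP_relations : relations K LP_signature :=
| br_skew c (s : 'S_2) :
    LP_relations (TAct (iperm c s) (TBr c)) (TScale ((-1) ^+ odd_perm s) (TBr c))
| br_jacobi c :
    LP_relations
      (TAdd (br_br c)
        (TAdd (TAct (iperm c cycle3) (br_br c))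
              (TAct (iperm c (cycle3 * cycle3)%g) (br_br c))))
      (TZero _ _ _ _ _)
| phi_morph : LP_relations phi_br br_phi_phi.

Definition LP : operad K := presented LP_relations.

Definition bracket c : oper LP (mono c 2) c 0 := pgen LP_relations (Br c).
Definition phi : oper LP (mixed 1 0) wavy 0 := pgen LP_relations Phi.

(* [...[[phi(1), 2], 3]..., n+1] *)
Fixpoint phi_nest (n : nat) : oper LP (mixed 1 n) wavy 0 :=
  match n with
  | 0 => phi
  | n.+1 =>
      act (isum (iid (mono straight 1)) (icast wavy (addn1 n) \oi imerge wavy n 1)
           \oi iassoc _ _ _)
        (comp (addr0 0) (act (isplit wavy 1 1) (bracket wavy)) (phi_nest n))
  end.

(* [...[[phi(1), s(1)+1], s(2)+1]..., s(n)+1] *)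
Definition phi_nest_perm n (s : 'S_n) : oper LP (mixed 1 n) wavy 0 :=
  act (isum (iid (mono straight 1)) (iperm wavy s)) (phi_nest n).

(* $\big(\sum_n \frac{B_n}{n!} z^n\big)(e^z - 1) = z$ in $K[[z]]$, coefficientwise. *)
Definition bernoulli (B : nat -> K) : Prop :=
  forall n, \sum_(k < n.+1)
    B k / k`!%:R * (if (n - k)%N == 0%N then 0 else (n - k)`!%:R^-1)
      = (n == 1%N)%:R.

End Operads.

(* Main.v *)
From HB Require Import structures.
From mathcomp Require Import all_boot all_order all_fingroup all_algebra.
From mathcomp Require Import boolp generic_quotient.
From mathcomp Require Import zify ring.
Require Import Defs.
Set Implicit Arguments.
Unset Strict Implicit.
Unset Printing Implicit Defensive.
Import GRing.Theory.
Local Open Scope ring_scope.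

(** [LP] lives in degree 0, while $\ell_m$ and $f_{m,n}$ have degrees $2-m$ and
    $1-m$.  Hence a morphism to [LP] kills every generator except $\ell_2$ and
    the $f_{1,n}$, and it commutes with the differentials as soon as it kills
    $\delta\ell_3$, which is the Jacobi identity ([eval_diff_ell3]), and
    $\delta f_{2,n}$ for all $n$.  Everything is about the latter condition.

    Identities in [LP] are tested on Lie pairs: an operation whose values vanish
    in every Lie pair is zero ([LP_complete]).  Write $f_n(x;h_1,\dots,h_n)$ for
    the value of $f_{1,n}$.  These values are symmetric in the $h_i$, so in
    characteristic zero one may take all wavy arguments equal to one $H$
    ([polarisation_sym]), and then $\delta f_{2,n}=0$ reads ([eval_diff_eff2])
    $$f_n([x,y];H^n)+\sum_k\binom nk\big(f_{k+1}(x;f_{n-k}(y;H^{n-k}),H^k)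
      -f_{k+1}(y;f_{n-k}(x;H^{n-k}),H^k)\big)=0.$$

    Existence.  Put $T=[-,H]$, $b_n=B_n/n!$ and $b(z)=\sum_n b_nz^n$.  For the
    asserted values of $f_{1,n}$ one has $f_n(x;H^n)=n!\,b_n\,T^n\phi(x)$ and
    $f_{k+1}(x;z,H^k)=k!\,b_{k+1}\sum_{j\le k}T^{k-j}[T^j\phi(x),z]$.  Since $T$
    is a derivation, reading $u^jv^i$ as $[T^j\phi(x),T^i\phi(y)]$ makes $T$ the
    multiplication by $w=u+v$, and the equation becomes an identity between
    polynomials in commuting $u,v$ ([bernoulli_identity], [lie_bernoulli]).  That
    identity collects, divided by $uv$, the terms of degree $n+2$ in
    $$u\,b(v)(b(w)-b(u))+v\,b(u)(b(w)-b(v))+uv\,b(w)=0,$$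
    which after multiplication by $(e^u-1)(e^v-1)$ follows from $b(z)(e^z-1)=z$
    and $e^w-1=(e^u-1)+(e^v-1)+(e^u-1)(e^v-1)$.

    Uniqueness.  If two morphisms agree on $f_{1,k}$ for $k\le n$, the equation
    shows that their difference $D$ on $f_{1,n+1}$ satisfies
    $D(x;\phi(y),H^n)=D(y;\phi(x),H^n)$ ([eff_agree]).  An operation with wavy
    output only sees its straight arguments through $\phi$, so it is determined by
    its values in the Lie pairs of the form $(L,L,\mathrm{id})$
    ([eval_double]), where this says that $D(x;y,H^n)$ is symmetric in $x,y$.
    Together with the symmetry in the wavy arguments this makes all
    $D(H;\dots,x,\dots)$ equal to $D(x;H^{n+1})$.  But a Lie operation of at least
    two arguments vanishes when they all coincide, so polarisation gives
    $(n+2)!\,D(x;H^{n+1})=0$, and then $D=0$. *)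

(** * Relabellings, and linearity of the operad structure *)

Lemma iso_inv_ex A B (f : iso A B) : {g : iso B A | cancel f g /\ cancel g f}.
Proof.
apply: cid; have [g fK gK] := relab_bij f.
have gt i : A (g i) = B i by rewrite -(relab_tint f) gK.
by exists (@Iso B A g (Bijective gK fK) gt).
Qed.

Definition iinv A B (f : iso A B) : iso B A := sval (iso_inv_ex f).

Lemma iinvK A B (f : iso A B) : cancel f (iinv f).
Proof. by have [] := svalP (iso_inv_ex f). Qed.
Lemma iinvKV A B (f : iso A B) : cancel (iinv f) f.
Proof. by have [] := svalP (iso_inv_ex f). Qed.

Section Operad.
Variables (K : fieldType) (Q : operad K).

Lemma act_ext A B o n (f g : iso A B) (x : oper Q A o n) :
  f =1 g -> act f x = act g x.
Proof.
move=> fg; rewrite -[act g x](act_id (f := iid B)) //.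
exact: act_comp.
Qed.

Lemma act_icomp A B C o n (f : iso A B) (g : iso B C) (x : oper Q A o n) :
  act g (act f x) = act (g \oi f) x.
Proof. by apply/esym/act_comp. Qed.

Lemma act_factor A B C o n (f : iso A B) (g : iso A C) (h : iso C B)
  (x : oper Q A o n) : f =1 h \o g -> act f x = act h (act g x).
Proof. exact: act_comp. Qed.

Lemma actK A B o n (f : iso A B) (x : oper Q A o n) :
  act (iinv f) (act f x) = x.
Proof. by rewrite act_icomp act_id // => i; exact: iinvK. Qed.

Lemma act0 A B o n (f : iso A B) : act f (0 : oper Q A o n) = 0.
Proof. exact: lin0 (actP f). Qed.

Lemma actD A B o n (f : iso A B) (x y : oper Q A o n) :
  act f (x + y) = act f x + act f y.
Proof. by have := actP f 1 x y; rewrite !scale1r. Qed.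

Lemma actZ A B o n (f : iso A B) t (x : oper Q A o n) :
  act f (t *: x) = t *: act f x.
Proof. by have := actP f t x 0; rewrite act0 !addr0. Qed.

Lemma actN A B o n (f : iso A B) (x : oper Q A o n) :
  act f (- x) = - act f x.
Proof. by rewrite -!scaleN1r actZ. Qed.

Lemma act_sum A B o n (f : iso A B) I (r : seq I) (P : pred I)
    (F : I -> oper Q A o n) :
  act f (\sum_(i <- r | P i) F i) = \sum_(i <- r | P i) act f (F i).
Proof.
elim/big_rec2: _ => [|i x y _ <-]; [exact: act0 | exact: actD].
Qed.

Lemma comp0l c A B o m n k (e : m + n = k) (b : oper Q B c n) :
  comp e (0 : oper Q (mono c 1 |+| A) o m) b = 0.
Proof. by apply: (lin0 (f := fun x => comp e x b)) => *; exact: compPl. Qed.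

Lemma comp0r c A B o m n k (e : m + n = k) (a : oper Q (mono c 1 |+| A) o m) :
  comp e a (0 : oper Q B c n) = 0.
Proof. by apply: (lin0 (f := comp e a)) => *; exact: compPr. Qed.

Lemma compDl c A B o m n k (e : m + n = k) (x y : oper Q (mono c 1 |+| A) o m)
   (b : oper Q B c n) : comp e (x + y) b = comp e x b + comp e y b.
Proof. by have := compPl e 1 x y b; rewrite !scale1r. Qed.

Lemma compZl c A B o m n k (e : m + n = k) t (x : oper Q (mono c 1 |+| A) o m)
   (b : oper Q B c n) : comp e (t *: x) b = t *: comp e x b.
Proof. by have := compPl e t x 0 b; rewrite comp0l !addr0. Qed.

Lemma compDr c A B o m n k (e : m + n = k) (x : oper Q (mono c 1 |+| A) o m)
   (y z : oper Q B c n) : comp e x (y + z) = comp e x y + comp e x z.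
Proof. by have := compPr e 1 x y z; rewrite !scale1r. Qed.

Lemma compZr c A B o m n k (e : m + n = k) t (x : oper Q (mono c 1 |+| A) o m)
   (b : oper Q B c n) : comp e x (t *: b) = t *: comp e x b.
Proof. by have := compPr e t x b 0; rewrite comp0r !addr0. Qed.

End Operad.

Section Morphism.
Variables (K : fieldType) (P Q : operad K) (F : operad_morphism P Q).

Lemma morphD A o n (x y : oper P A o n) :
  morph F (x + y) = morph F x + morph F y.
Proof. by have := morphP F 1 x y; rewrite !scale1r. Qed.

Lemma morph0 A o n : morph F (0 : oper P A o n) = 0.
Proof. exact: lin0 (@morphP _ _ _ F A o n). Qed.

Lemma morphZ A o n t (x : oper P A o n) : morph F (t *: x) = t *: morph F x.
Proof. by have := morphP F t x 0; rewrite morph0 !addr0. Qed.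

Lemma morph_sum A o n J (r : seq J) (p : pred J) (G : J -> oper P A o n) :
  morph F (\sum_(i <- r | p i) G i) = \sum_(i <- r | p i) morph F (G i).
Proof. by elim/big_rec2: _ => [|i x y _ <-]; rewrite ?morph0 ?morphD. Qed.

End Morphism.

(** * Filling several inputs at once, in degree zero *)

Notation "a \o1 b" := (comp (addr0 0) a b) (at level 40, left associativity).
Notation one c := (mono c 1).

Lemma empty_ord n (n0 : n = 0%N) : 'I_n -> False.
Proof. by rewrite n0 => -[]. Qed.

Definition icat_empty A Z (Z0 : width Z = 0%N) : iso (A |+| Z) A.
Proof.
exists (join id (fun j => match empty_ord Z0 j with end)).
- by exists (lshift (width Z));
  [elim/join_ind => [i|j]; [rewrite joinL | case: (empty_ord Z0 j)]
    | move=> i; rewrite joinL].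
- by elim/join_ind => [i|j]; [rewrite /= !joinL | case: (empty_ord Z0 j)].
Defined.

Lemma icat_emptyL A Z (Z0 : width Z = 0%N) i :
  icat_empty A Z0 (lshift (width Z) i) = i.
Proof. exact: joinL. Qed.

Definition iso_empty A B (A0 : width A = 0%N) (B0 : width B = 0%N) : iso A B.
Proof.
exists (fun j => match empty_ord A0 j with end); last by move=> j; case: (empty_ord A0 j).
by exists (fun j => match empty_ord B0 j with end) => j;
  [case: (empty_ord A0 j) | case: (empty_ord B0 j)].
Defined.

(** Pointwise equality of composites of structural relabellings, checked block by
    block; blocks without inputs are discarded. *)
Ltac iso_eq := repeat elim/join_ind; move=> *;
  rewrite /= ?(joinL, joinR, icat_emptyL) //=;
  try match goal with j : _ |- _ => solve [case: (@empty_ord 0 erefl j)] end.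

Section Degree0.
Variables (K : fieldType) (Q : operad K).
Implicit Types (A B C X Y Z : arity) (c : colour).

Lemma comp_act_both c A A' B B' o (F : iso (one c |+| A) (one c |+| A'))
  (f : iso A A') (g : iso B B') (a : oper Q (one c |+| A) o 0)
  (b : oper Q B c 0) : F =1 isum (iid _) f ->
  act F a \o1 act g b = act (isum g f) (a \o1 b).
Proof. by move=> h; rewrite (act_ext _ h) comp_act. Qed.

Lemma comp_act_left c A A' B o (F : iso (one c |+| A) (one c |+| A'))
  (f : iso A A') (a : oper Q (one c |+| A) o 0)
  (b : oper Q B c 0) : F =1 isum (iid _) f ->
  act F a \o1 b = act (isum (iid _) f) (a \o1 b).
Proof. by move=> h; rewrite -(comp_act_both (iid B) _ _ h) (act_id b). Qed.

Lemma comp_act_right c A B B' o (g : iso B B') (a : oper Q (one c |+| A) o 0)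
  (b : oper Q B c 0) : a \o1 act g b = act (isum g (iid _)) (a \o1 b).
Proof.
by rewrite -(comp_act_both (F := iid _) g a b) ?(act_id a) //; iso_eq.
Qed.

Lemma comp_comp c c' A B C o
    (a : oper Q (one c |+| A) o 0) (b : oper Q (one c' |+| B) c 0)
    (z : oper Q C c' 0) :
  a \o1 (b \o1 z) = act (iassocV C B A) (act (iassoc (one c') B A) (a \o1 b) \o1 z).
Proof.
rewrite (comp_seq _ _ (addr0 0) (addr0 0)) act_icomp act_id //. iso_eq.
Qed.

(** Fills the first two inputs of [t]: [comp] only reaches the first input, so
    each slot is brought to the front in turn. *)
Definition plug2 c c' A B C o (t : oper Q (one c |+| (one c' |+| A)) o 0)
   (x : oper Q B c 0) (y : oper Q C c' 0) : oper Q (B |+| (C |+| A)) o 0 :=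
  act (ilcomm C (one c) A) (act (ilcomm (one c) (one c') A) t \o1 y) \o1 x.

(** The parallel composition axiom; its Koszul sign is trivial in degree 0. *)
Lemma plug2C c c' A B C o (t : oper Q (one c |+| (one c' |+| A)) o 0)
   (x : oper Q B c 0) (y : oper Q C c' 0) :
  plug2 t x y =
  act (ilcomm C B A) (plug2 (act (ilcomm (one c) (one c') A) t) y x).
Proof.
rewrite {1}/plug2 (comp_par _ _ (addr0 0) (addr0 0)).
by rewrite mul0r expr0z scale1r.
Qed.

Lemma plug2N c c' A B C o (t : oper Q (one c |+| (one c' |+| A)) o 0)
   (x : oper Q B c 0) (y : oper Q C c' 0) : plug2 (- t) x y = - plug2 t x y.
Proof.
by rewrite /plug2 -!scaleN1r actZ compZl actZ compZl.
Qed.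

Lemma plug2D c c' A B C o (t u : oper Q (one c |+| (one c' |+| A)) o 0)
   (x : oper Q B c 0) (y : oper Q C c' 0) :
  plug2 (t + u) x y = plug2 t x y + plug2 u x y.
Proof. by rewrite /plug2 actD compDl actD compDl. Qed.

Lemma plug2_act c c' A B B' C C' o (t : oper Q (one c |+| (one c' |+| A)) o 0)
   (f : iso B B') (g : iso C C') (x : oper Q B c 0) (y : oper Q C c' 0) :
  plug2 t (act f x) (act g y) = act (isum f (isum g (iid A))) (plug2 t x y).
Proof.
rewrite /plug2 (comp_act_right g) act_icomp
  -(comp_act_both (F := isum (iid _) (isum g (iid A)))) //.
by congr (_ \o1 _); rewrite act_icomp; apply: act_ext; iso_eq.
Qed.

Lemma plug2_tail c c' A A' B C o (f : iso A A')
   (t : oper Q (one c |+| (one c' |+| A)) o 0)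
   (x : oper Q B c 0) (y : oper Q C c' 0) :
  plug2 (act (isum (iid _) (isum (iid _) f)) t) x y =
  act (isum (iid B) (isum (iid C) f)) (plug2 t x y).
Proof.
rewrite /plug2 act_icomp.
rewrite (act_factor (g := ilcomm _ _ _) (h := isum (iid _) (isum (iid _) f)));
  last by iso_eq.
rewrite (comp_act_left (f := isum (iid _) f)) // act_icomp.
rewrite (act_factor (g := ilcomm _ _ _) (h := isum (iid _) (isum (iid C) f)));
  last by iso_eq.
by rewrite (comp_act_left (f := isum (iid C) f)).
Qed.

Definition irot X Y Z A :
  iso (X |+| (Y |+| (Z |+| A))) (Z |+| (X |+| (Y |+| A)))
  := ilcomm _ _ _ \oi isum (iid X) (ilcomm _ _ _).

Definition plug3 c c' c'' A X Y Z o
    (t : oper Q (one c |+| (one c' |+| (one c'' |+| A))) o 0)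
   (x : oper Q X c 0) (y : oper Q Y c' 0) (z : oper Q Z c'' 0) :
   oper Q (X |+| (Y |+| (Z |+| A))) o 0 :=
  plug2 (act (isum (iid (one c)) (ilcomm Z (one c') A) \oi ilcomm Z (one c) (one c' |+| A))
     (act (irot (one c) (one c') (one c'') A) t \o1 z)) x y.

Lemma plug3D c c' c'' A X Y Z o
    (t u : oper Q (one c |+| (one c' |+| (one c'' |+| A))) o 0)
   (x : oper Q X c 0) (y : oper Q Y c' 0) (z : oper Q Z c'' 0) :
  plug3 (t + u) x y z = plug3 t x y z + plug3 u x y z.
Proof. by rewrite /plug3 actD compDl actD plug2D. Qed.

Lemma plug3_0 c c' c'' A X Y Z o
   (x : oper Q X c 0) (y : oper Q Y c' 0) (z : oper Q Z c'' 0) :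
  plug3 (0 : oper Q (one c |+| (one c' |+| (one c'' |+| A))) o 0) x y z = 0.
Proof. by rewrite /plug3 /plug2 ?(act0, comp0l). Qed.

Lemma plug3C12 c c' c'' A X Y Z o
    (t : oper Q (one c |+| (one c' |+| (one c'' |+| A))) o 0)
   (x : oper Q X c 0) (y : oper Q Y c' 0) (z : oper Q Z c'' 0) :
  plug3 t x y z = act (ilcomm Y X _) (plug3 (act (ilcomm _ _ _) t) y x z).
Proof.
rewrite /plug3 plug2C; congr (act _ (plug2 _ _ _)).
rewrite !act_icomp.
rewrite (act_factor (f := irot (one c') (one c) (one c'') A \oi _)
  (g := irot (one c) (one c') (one c'') A)
  (h := isum (iid _) (ilcomm _ _ _))); last by rewrite /irot; iso_eq.
rewrite (comp_act_left (f := ilcomm _ _ _)) // act_icomp.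
by apply: act_ext; iso_eq.
Qed.

Lemma plug3C23 c c' c'' A X Y Z o
    (t : oper Q (one c |+| (one c' |+| (one c'' |+| A))) o 0)
   (x : oper Q X c 0) (y : oper Q Y c' 0) (z : oper Q Z c'' 0) :
  plug3 t x y z = act (isum (iid X) (ilcomm Z Y A))
    (plug3 (act (isum (iid _) (ilcomm _ _ _)) t) x z y).
Proof.
rewrite /plug3 {1}/plug2 act_icomp.
set t' := act (isum (iid _) (ilcomm _ _ _) \oi irot (one c) (one c') (one c'') A) t.
have -> : act (irot (one c) (one c') (one c'') A) t =
  act (isum (iid _) (ilcomm (one c') (one c) A)) t'.
  by rewrite /t' act_icomp; apply: act_ext; rewrite /irot; iso_eq.
rewrite (comp_act_left (f := ilcomm (one c') (one c) A)) // act_icomp.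
rewrite act_icomp.
rewrite (act_factor (f := ilcomm (one c) (one c') (Z |+| A) \oi _)
  (g := ilcomm Z (one c') (one c |+| A))
  (h := isum (iid _) (ilcomm Z (one c) A))); last by iso_eq.
rewrite (comp_act_left (f := ilcomm Z (one c) A)) //.
rewrite (comp_par _ _ (addr0 0) (addr0 0)) mul0r expr0z scale1r.
rewrite /plug2 !act_icomp -(comp_act_left (F := isum (iid _) (ilcomm Z Y A))) // act_icomp.
congr (_ \o1 _).
rewrite (act_factor (f := irot (one c) (one c'') (one c') A \oi _)
  (g := ilcomm _ _ _ \oi (isum (iid _) (ilcomm (one c) (one c') A) \oi irot (one c)
  (one c') (one c'') A)) (h := isum (iid _) (ilcomm _ _ _)));
  last by rewrite /irot; iso_eq.
rewrite (comp_act_left (f := ilcomm _ _ _)) // act_icomp.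
rewrite (act_factor (f := _ \oi isum (iid _) (ilcomm (one c'') (one c) A))
  (g := ilcomm Y (one c'') (one c |+| A))
  (h := isum (iid _) (ilcomm Y (one c) A))); last by iso_eq.
rewrite (comp_act_left (f := ilcomm _ _ _)) // act_icomp.
by apply: act_ext; iso_eq.
Qed.

Lemma plug3_rot c A X Y Z o
    (t : oper Q (one c |+| (one c |+| (one c |+| A))) o 0)
   (x : oper Q X c 0) (y : oper Q Y c 0) (z : oper Q Z c 0) :
  plug3 (act (irot _ _ _ _) t) x y z = act (irot _ _ _ _) (plug3 t y z x).
Proof.
rewrite plug3C12 plug3C23 !act_icomp act_id; last by iso_eq.
by apply: act_ext; iso_eq.
Qed.

(** Sequential composition: filling the first slot of [s] with [plug2 t x y]
    amounts to composing [s] with [t] and filling the three open slots.  The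
    relabellings are arbitrary up to pointwise equality, so that the lemma applies
    whatever their syntactic form. *)
Lemma plug2_plug2 c c1 c2 c' A B X Y Z o
    (s : oper Q (one c |+| (one c' |+| A)) o 0)
    (t : oper Q (one c1 |+| (one c2 |+| B)) c 0)
    (f : iso ((one c1 |+| (one c2 |+| B)) |+| (one c' |+| A))
             (one c1 |+| (one c2 |+| (one c' |+| (B |+| A)))))
    (g : iso ((X |+| (Y |+| B)) |+| (Z |+| A))
             (X |+| (Y |+| (Z |+| (B |+| A)))))
   (x : oper Q X c1 0) (y : oper Q Y c2 0) (z : oper Q Z c' 0) :
  f =1 isum (iid (one c1)) (isum (iid (one c2)) (ilcomm _ _ _) \oi iassoc _ _ _)
         \oi iassoc _ _ _ ->
  g =1 isum (iid X) (isum (iid Y) (ilcomm _ _ _) \oi iassoc _ _ _)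
         \oi iassoc _ _ _ ->
  plug3 (act f (s \o1 t)) x y z = act g (plug2 s (plug2 t x y) z).
Proof.
move=> /act_ext-> /act_ext->; rewrite /plug3 /plug2.
rewrite [in RHS]comp_comp comp_act_right !act_icomp [in RHS]comp_comp comp_act_right
  !act_icomp.
have par : act (ilcomm Z (one c) A) (act (ilcomm (one c) (one c') A) s \o1 z) \o1 t
  = act (ilcomm Z _ A) (act (ilcomm _ (one c') A) (s \o1 t) \o1 z).
  rewrite (comp_par _ _ (addr0 0) (addr0 0)) mul0r expr0z scale1r act_icomp act_id //.
  by iso_eq.
rewrite par !act_icomp.
set W := act (ilcomm _ (one c') A) (s \o1 t).
rewrite (act_factor (f := irot _ _ _ _ \oi _) (g := ilcomm _ (one c') A)
  (h := isum (iid _) (isum (iid (one c1)) (iassoc (one c2) B A) \oi iassoc _ _ _)));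
  last by rewrite /irot; iso_eq.
rewrite -/W (comp_act_left (f := isum (iid (one c1)) (iassoc (one c2) B A) \oi iassoc _ _
  _)) // act_icomp.
set H' := iassoc (one c2) (one c1 |+| B) (Z |+| A) \oi _ \oi _.
rewrite (act_factor (g := H') (h := isum (iid _)
   (isum (iid (one c1)) (ilcomm B Z A) \oi iassoc _ _ _)));
  last by rewrite /H'; iso_eq.
rewrite (comp_act_left (f := isum (iid (one c1)) (ilcomm B Z A) \oi iassoc _ _ _)) //
  act_icomp.
set K' := iassoc (one c1) _ _ \oi _ \oi _.
rewrite (act_factor (g := K') (h := isum (iid _)
   (isum (iid Y) (ilcomm B Z A) \oi iassoc _ _ _)));
  last by rewrite /K'; iso_eq.
rewrite (comp_act_left (f := isum (iid Y) (ilcomm B Z A) \oi iassoc _ _ _)) //.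
by apply: act_ext; iso_eq.
Qed.

Lemma plug3_tail c c' c'' A A' X Y Z o (f : iso A A')
    (t : oper Q (one c |+| (one c' |+| (one c'' |+| A))) o 0)
    (x : oper Q X c 0) (y : oper Q Y c' 0) (z : oper Q Z c'' 0) :
  plug3 (act (isum (iid _) (isum (iid _) (isum (iid _) f))) t) x y z =
  act (isum (iid X) (isum (iid Y) (isum (iid Z) f))) (plug3 t x y z).
Proof.
rewrite /plug3 -plug2_tail !act_icomp; congr plug2.
rewrite (act_factor (g := irot _ _ _ _)
  (h := isum (iid _) (isum (iid _) (isum (iid _) f))));
  last by rewrite /irot; iso_eq.
rewrite (comp_act_left (f := isum (iid (one c)) (isum (iid (one c')) f))) // act_icomp.
by apply: act_ext; iso_eq.
Qed.

Lemma plug2_actl c c' A B B' C o (t : oper Q (one c |+| (one c' |+| A)) o 0)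
   (f : iso B B') (x : oper Q B c 0) (y : oper Q C c' 0) :
  plug2 t (act f x) y = act (isum f (iid _)) (plug2 t x y).
Proof.
rewrite -{1}[y](act_id (f := iid C)) // plug2_act.
by apply: act_ext; iso_eq.
Qed.

Lemma comp_plug2 c c1 c2 A B X Y o
    (s : oper Q (one c |+| A) o 0) (t : oper Q (one c1 |+| (one c2 |+| B)) c 0)
    (x : oper Q X c1 0) (y : oper Q Y c2 0) :
  s \o1 plug2 t x y =
  act (iassocV X (Y |+| B) A \oi isum (iid X) (iassocV _ _ _))
    (plug2 (act (isum (iid (one c1)) (iassoc (one c2) B A) \oi iassoc _ _ _)
       (s \o1 t)) x y).
Proof.
rewrite /plug2 comp_comp comp_act_right !act_icomp comp_comp comp_act_right !act_icomp.
rewrite (act_factor (f := ilcomm _ _ _ \oi _)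
  (g := iassoc (one c2) (one c1 |+| B) A \oi isum (ilcomm _ _ _) (iid A))
  (h := isum (iid _) (iassoc _ _ _))); last by iso_eq.
rewrite (comp_act_left (f := iassoc _ _ _)) // act_icomp.
rewrite (act_factor (f := ilcomm _ _ _ \oi _)
  (g := iassoc (one c1) (Y |+| B) A \oi isum (ilcomm Y (one c1) B) (iid A) \oi
      iassocV Y (one c1 |+| B) A)
  (h := isum (iid _) (iassoc _ _ _))); last by iso_eq.
rewrite (comp_act_left (f := iassoc _ _ _)) // act_icomp.
by apply: act_ext; iso_eq.
Qed.

(** When the two plugged operations are themselves compositions, their own first
    inputs can be filled afterwards.  This turns an identity between operations on
    generators, such as the one expressing that $\phi$ is a morphism, into one for
    all arguments. *)
Lemma plug2_comp c c' c1 c2 A B D X Y o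
    (t : oper Q (one c |+| (one c' |+| D)) o 0)
    (a : oper Q (one c1 |+| A) c 0) (b : oper Q (one c2 |+| B) c' 0)
    (x : oper Q X c1 0) (y : oper Q Y c2 0) :
  plug2 t (a \o1 x) (b \o1 y) =
  act (iassocV X A ((Y |+| B) |+| D) \oi isum (iid X)
      (isum (iid A) (iassocV Y B D) \oi ilcomm Y A (B |+| D)))
    (plug2 (act (isum (iid (one c1)) (ilcomm A (one c2) (B |+| D) \oi
        isum (iid A) (iassoc _ _ _)) \oi iassoc _ _ _) (plug2 t a b)) x y).
Proof.
rewrite {1}/plug2 !comp_comp !act_icomp.
set t' := act (ilcomm _ _ _) t.
set S := _ \o1 b.
have S1E : act (iassoc (one c2) B (one c |+| D)) S =
    act (isum (iid _) (ilcomm _ _ _)) (act (ilcomm (one c) (one c2) (B |+| D))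
      (act (isum (iid _) (iassoc (one c2) B D) \oi ilcomm (one c2 |+| B) (one c) D) S)).
  by rewrite !act_icomp; apply: act_ext; iso_eq.
set S3 := act (isum (iid _) (iassoc (one c2) B D) \oi _) S in S1E.
rewrite S1E (comp_act_left (f := ilcomm (one c) B D)) // act_icomp.
rewrite (act_factor (f := _ \oi iassocV Y B _ \oi _)
  (g := ilcomm Y (one c) (B |+| D)) (h := isum (iid _) (iassocV Y B D)));
  last by iso_eq.
rewrite (comp_act_left (f := iassocV Y B D)) // act_icomp.
rewrite -[_ \o1 a]/(plug2 S3 a y) plug2C /plug2 !act_icomp.
rewrite (act_factor (B := one c |+| _) (g := ilcomm (one c2 |+| B) (one c) D)
   (h := isum (iid _) (iassoc (one c2) B D))); last by iso_eq.
rewrite (comp_act_left (f := iassoc _ _ _)) // act_icomp -/t' -/S.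
rewrite [in RHS](act_factor
   (g := ilcomm (one c1 |+| A) (one c2) (B |+| D) \oi
         isum (iid (one c1 |+| A)) (iassoc (one c2) B D))
   (h := isum (iid (one c2)) (iassoc (one c1) A _)));
   last by iso_eq.
rewrite (comp_act_left (f := iassoc (one c1) A _)) // !act_icomp.
rewrite [in RHS](act_factor
   (g := iassoc (one c1) A ((Y |+| B) |+| D) \oi
        isum (iid (one c1 |+| A)) (iassocV Y B D) \oi
        ilcomm Y (one c1 |+| A) (B |+| D))
   (h := isum (iid (one c1))
      (ilcomm A Y (B |+| D) \oi isum (iid A) (iassoc Y B D))));
   last by iso_eq.
rewrite (comp_act_left (f := (ilcomm A Y (B |+| D) \oi isum (iid A) (iassoc Y B D)))) //
  act_icomp.
by apply: act_ext; iso_eq.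
Qed.

End Degree0.

(** * Brackets and the morphism in the operad of Lie pairs *)

Section LP.
Variable K : fieldType.
Notation Q := (LP K).
Implicit Types (A B C X Y Z : arity) (c : colour).

Definition no_input := mono straight 0.
Definition islots2 c : iso (mono c 2) (one c |+| (one c |+| no_input)) :=
  isum (iid _) (icat0 (one c)) \oi isplit c 1 1.

(** The bracket, with its two inputs displayed as open slots for [plug2]. *)
Definition bracket_slots c : oper Q (one c |+| (one c |+| no_input)) c 0 :=
  act (islots2 c) (bracket K c).

Definition bracket_of c A B (x : oper Q A c 0) (y : oper Q B c 0) :
    oper Q (A |+| B) c 0 :=
  act (isum (iid A) (icat_empty B (erefl : width no_input = 0%N)))
    (plug2 (bracket_slots c) x y).

Definition phi_of A (x : oper Q A straight 0) : oper Q A wavy 0 :=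
  act (icat_empty A (erefl : width (mono wavy 0) = 0%N))
    ((phi K : oper Q (one straight |+| mono wavy 0) wavy 0) \o1 x).

Lemma bracket_skew c : act (iperm c (tperm 0 1)) (bracket K c) = - bracket K c.
Proof.
have := pgen_model (@br_skew K c (tperm 0 1)).
by rewrite /= odd_tperm /= expr1 scaleN1r.
Qed.

Lemma bracket_slots_skew c : act (ilcomm _ _ _) (bracket_slots c) = - bracket_slots c.
Proof.
rewrite /bracket_slots -actN -bracket_skew !act_icomp; apply: act_ext.
elim/(@join_ind 1 1) => i; rewrite /= ?(joinL, joinR) (ord1 i).
  have -> : lshift 1 (0 : 'I_1) = 0 :> 'I_2 by apply: val_inj.
  rewrite tpermL.
  have -> : 1 = rshift 1 (0 : 'I_1) :> 'I_2 by apply: val_inj.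
  by rewrite !joinR ?(joinL, joinR).
have -> : rshift 1 (0 : 'I_1) = 1 :> 'I_2 by apply: val_inj.
rewrite tpermR.
have -> : 0 = lshift 1 (0 : 'I_1) :> 'I_2 by apply: val_inj.
by rewrite !joinL ?(joinL, joinR).
Qed.

Lemma bracket_of_act c A A' B B' (f : iso A A') (g : iso B B')
   (x : oper Q A c 0) (y : oper Q B c 0) :
  bracket_of (act f x) (act g y) = act (isum f g) (bracket_of x y).
Proof.
rewrite /bracket_of plug2_act !act_icomp; apply: act_ext.
iso_eq.
Qed.

Lemma phi_of_act A A' (f : iso A A') (x : oper Q A straight 0) :
  phi_of (act f x) = act f (phi_of x).
Proof.
by rewrite /phi_of comp_act_right !act_icomp; apply: act_ext; iso_eq.
Qed.

Lemma bracket_ofC c A B (x : oper Q A c 0) (y : oper Q B c 0) :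
  bracket_of x y = - act (iswap _ _) (bracket_of y x).
Proof.
rewrite /bracket_of plug2C bracket_slots_skew plug2N -!actN !act_icomp; apply: act_ext;
  iso_eq.
Qed.

Lemma bracket_ofDl c A B (x x' : oper Q A c 0) (y : oper Q B c 0) :
  bracket_of (x + x') y = bracket_of x y + bracket_of x' y.
Proof. by rewrite /bracket_of /plug2 compDr actD. Qed.

Lemma bracket_ofZl c A B t (x : oper Q A c 0) (y : oper Q B c 0) :
  bracket_of (t *: x) y = t *: bracket_of x y.
Proof. by rewrite /bracket_of /plug2 compZr actZ. Qed.

Lemma bracket_ofZr c A B t (x : oper Q A c 0) (y : oper Q B c 0) :
  bracket_of x (t *: y) = t *: bracket_of x y.
Proof. by rewrite 2!(bracket_ofC x) bracket_ofZl actZ scalerN. Qed.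

Lemma phi_ofD A (x y : oper Q A straight 0) : phi_of (x + y) = phi_of x + phi_of y.
Proof. by rewrite /phi_of compDr actD. Qed.

Lemma phi_ofZ A t (x : oper Q A straight 0) : phi_of (t *: x) = t *: phi_of x.
Proof. by rewrite /phi_of compZr actZ. Qed.

(** With [phi_of_slot], the reason why iterated brackets are closed under
    composition: an input of [x] is filled inside the bracket. *)
Lemma bracket_of_slot c c' A B C (x : oper Q (one c' |+| A) c 0) (y : oper Q B c 0)
  (z : oper Q C c' 0) :
  act (iassoc (one c') A B) (bracket_of x y) \o1 z
  = act (iassoc C A B) (bracket_of (x \o1 z) y).
Proof.
rewrite /bracket_of /plug2 comp_comp !act_icomp.
set S := act _ (_ \o1 y).
rewrite (act_factor (g := iassoc (one c') A (B |+| no_input))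
  (h := isum (iid _) (isum (iid A) (icat_empty B (erefl : width no_input = 0%N))))).
  rewrite (comp_act_left (f := isum (iid A) (icat_empty B (erefl : width no_input = 0%N))))
    //.
  by apply: act_ext; iso_eq.
by iso_eq.
Qed.

Lemma phi_of_slot c' A C (x : oper Q (one c' |+| A) straight 0)
  (z : oper Q C c' 0) :
  phi_of x \o1 z = phi_of (x \o1 z).
Proof.
rewrite /phi_of comp_comp !act_icomp.
rewrite (act_factor (g := iassoc (one c') A (mono wavy 0))
  (h := isum (iid _) (icat_empty A (erefl : width (mono wavy 0) = 0%N)))).
  rewrite (comp_act_left (f := icat_empty A (erefl : width (mono wavy 0) = 0%N))) //.
  by apply: act_ext; iso_eq.
by iso_eq.
Qed.

(** $[[1,2],3]$ *)
Definition nested_bracket c : oper Q (mono c 3) c 0 :=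
  act (imerge c 2 1) (act (isplit c 1 1) (bracket K c) \o1 bracket K c).

Lemma nested_bracket_jacobi c :
  nested_bracket c + (act (iperm c cycle3) (nested_bracket c)
          + act (iperm c (cycle3 * cycle3)%g) (nested_bracket c)) = 0.
Proof. exact: (pgen_model (@br_jacobi K c)). Qed.

Definition islots3 c : iso (mono c 3) (one c |+| (one c |+| (one c |+| no_input))) :=
  isum (iid _) (islots2 c) \oi isplit c 1 2.

Definition nested_bracket_slots c := act (islots3 c) (nested_bracket c).

Lemma islots3_cycle c :
  islots3 c \oi iperm c cycle3 =1 irot _ _ _ _ \oi islots3 c.
Proof.
elim/(@join_ind 1 2) => i.
  have e : cycle3 (lshift 2 i) = rshift 1 (lshift 1 (0 : 'I_1)).
    by rewrite permE; apply: val_inj; rewrite /= (ord1 i).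
  by rewrite /= e ?(joinL, joinR) ?(ord1 i).
elim/(@join_ind 1 1): i => i.
  have e : cycle3 (rshift 1 (lshift 1 i)) = rshift 1 (rshift 1 (0 : 'I_1)).
    by rewrite permE; apply: val_inj; rewrite /= (ord1 i).
  by rewrite /= e ?(joinL, joinR) ?(ord1 i).
have e : cycle3 (rshift 1 (rshift 1 i)) = lshift 2 (0 : 'I_1).
  by rewrite permE; apply: val_inj; rewrite /= (ord1 i).
by rewrite /= e ?(joinL, joinR) ?(ord1 i).
Qed.

Lemma nested_bracket_slots_jacobi c :
  nested_bracket_slots c + (act (irot _ _ _ _) (nested_bracket_slots c)
     + act (irot _ _ _ _) (act (irot _ _ _ _) (nested_bracket_slots c))) = 0.
Proof.
have /(congr1 (act (islots3 c))) := nested_bracket_jacobi c.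
rewrite act0 !actD => <-; congr (_ + (_ + _)).
  by rewrite /nested_bracket_slots !act_icomp; apply: act_ext => k; rewrite -islots3_cycle.
rewrite /nested_bracket_slots !act_icomp; apply: act_ext => k.
transitivity (irot (one c) (one c) (one c) no_input ((islots3 c \oi iperm c cycle3) k)).
  by rewrite islots3_cycle.
rewrite -[LHS]/((irot _ _ _ _ \oi islots3 c) (cycle3 k)) -islots3_cycle /=.
by rewrite permM.
Qed.

Lemma nested_bracket_slotsE c :
  act (isum (iid (one c)) (isum (iid (one c)) (ilcomm no_input (one c) no_input) \oi
    iassoc _ _ _)
         \oi iassoc _ _ _) (bracket_slots c \o1 bracket_slots c) =
  act (isum (iid _) (isum (iid _) (isum (iid _)
    (iso_empty (erefl : width no_input = 0%N) (erefl : width (no_input |+| no_input) =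
      0%N)))))
    (nested_bracket_slots c).
Proof.
rewrite /nested_bracket_slots /nested_bracket {1}/bracket_slots.
rewrite (act_factor (g := isplit c 1 1) (h := isum (iid _) (icat0 (one c)))) //.
rewrite (comp_act_left (f := icat0 (one c))) // /bracket_slots comp_act_right !act_icomp;
  apply: act_ext.
elim/(@join_ind 2 1) => i.
  have e0 (j : 'I_1) : lshift 1 (lshift 1 j) = lshift 2 j :> 'I_3 by exact: val_inj.
  have e1 (j : 'I_1) : lshift 1 (rshift 1 j) = rshift 1 (lshift 1 j) :> 'I_3 by exact:
    val_inj.
  elim/(@join_ind 1 1): i => i; rewrite /= !(joinL, joinR) /= ?e0 ?e1.
    by rewrite ?(joinL, joinR).
  by rewrite ?(joinL, joinR).
have e2 (j : 'I_1) : rshift 2 j = rshift 1 (rshift 1 j) :> 'I_3 by exact: val_inj.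
by rewrite /= [in X in _ = X]e2 ?(joinL, joinR).
Qed.

(** All three terms of the Jacobi identity become values of one operation
    [nested_bracket_slots] with its slots filled in cyclic orders, which reduces
    [bracket_of_jacobi] to the relation imposed on the generator. *)
Lemma bracket_of_plug3 c X Y Z (x : oper Q X c 0) (y : oper Q Y c 0) (z : oper Q Z c 0) :
  bracket_of (bracket_of x y) z =
  act (iassocV X Y Z \oi isum (iid X)
    (isum (iid Y) (icat_empty Z (erefl : width no_input = 0%N))))
    (plug3 (nested_bracket_slots c) x y z).
Proof.
rewrite /bracket_of plug2_actl.
have := plug2_plug2 (bracket_slots c) (bracket_slots c) x y z (fun _ => erefl)
  (fun _ => erefl).
set g := isum (iid X) _ \oi _; rewrite nested_bracket_slotsE plug3_tail.
move=> /(congr1 (act (iassocV X Y Z \oi isum (iid X) (isum (iid Y)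
  (icat_empty Z (erefl : width (no_input |+| no_input) = 0%N)))))).
rewrite !act_icomp => e.
transitivity (act (iassocV X Y Z \oi isum (iid X) (isum (iid Y)
  (icat_empty Z (erefl : width (no_input |+| no_input) = 0%N))) \oi g)
    (plug2 (bracket_slots c) (plug2 (bracket_slots c) x y) z)).
  by apply: act_ext; rewrite /g; iso_eq.
by rewrite -e; apply: act_ext; iso_eq.
Qed.

Lemma bracket_of_jacobi c X Y Z (x : oper Q X c 0) (y : oper Q Y c 0) (z : oper Q Z c 0) :
  bracket_of (bracket_of x y) z
  + (act (iassocV X Y Z \oi iswap _ _) (bracket_of (bracket_of y z) x)
    + act (iswap _ _ \oi iassoc Z X Y) (bracket_of (bracket_of z x) y)) = 0.
Proof.
rewrite !bracket_of_plug3 !act_icomp.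
have /(congr1 (fun t => plug3 t x y z)) := nested_bracket_slots_jacobi c.
rewrite plug3_0 !plug3D !plug3_rot !act_icomp.
set g := iassocV X Y Z \oi _.
move=> /(congr1 (act g)); rewrite act0 !actD !act_icomp => <-.
by congr (_ + (_ + _)); apply: act_ext; rewrite /g /irot; iso_eq.
Qed.

Notation w0 := (mono wavy 0).
Notation ph := (phi K : oper Q (one straight |+| w0) wavy 0).

(** $[\phi(1),\phi(2)]$, in the form in which the defining relation states it. *)
Definition bracket_phi_phi : oper Q ((one straight |+| w0) |+| (one straight |+| w0))
  wavy 0 :=
  act (iswap _ _) (act (isplit wavy 1 1) (bracket K wavy) \o1 ph) \o1 ph.

Lemma phi_bracket :
  ph \o1 (bracket K straight) =
  act (isum (imerge straight 1 1) (imerge wavy 0 0) \oi iacac _ _ _ _ \oi iswap _ _)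
    bracket_phi_phi.
Proof. exact: (pgen_model (@phi_morph K)). Qed.

Definition islots_phi_phi : iso ((one straight |+| w0) |+| (one straight |+| w0))
   (one straight |+| (one straight |+| no_input)) :=
  isum (iid _) (icat0 _) \oi isum (icat_empty _ (erefl : width w0 = 0%N))
     (icat_empty _ (erefl : width w0 = 0%N)) \oi iswap _ _.

Lemma phi_bracket_slots :
  act (isum (iid _) (iassoc _ _ _) \oi iassoc _ _ _) (ph \o1 bracket_slots straight) =
  act (isum (iid _) (isum (iid _) (iso_empty (erefl : width no_input = 0%N)
     (erefl : width (no_input |+| w0) = 0%N)))) (act islots_phi_phi bracket_phi_phi).
Proof.
rewrite /bracket_slots comp_act_right phi_bracket !act_icomp; apply: act_ext.
by iso_eq.
Qed.

Lemma bracket_slots_phi :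
  act (isum (iid _) (ilcomm w0 _ (w0 |+| no_input) \oi
        isum (iid _) (iassoc _ _ _)) \oi iassoc _ _ _) (plug2 (bracket_slots wavy) ph ph) =
  act (isum (iid _) (isum (iid _) (iso_empty (erefl : width no_input = 0%N)
     (erefl : width (w0 |+| (w0 |+| no_input)) = 0%N))))
       (act islots_phi_phi bracket_phi_phi).
Proof.
rewrite plug2C /plug2 !act_icomp.
have swapK : ilcomm (one wavy) (one wavy) no_input \oi ilcomm _ _ _ =1 id by iso_eq.
rewrite (act_factor (f := _ \oi islots2 wavy) (g := isplit wavy 1 1)
  (h := isum (iid _) (icat0 (one wavy)))); last by move=> k; exact: swapK.
rewrite (comp_act_left (f := icat0 (one wavy))) // act_icomp.
rewrite (act_factor (g := iswap _ _) (h := isum (iid _) (icat0 _))); last by iso_eq.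
rewrite (comp_act_left (f := icat0 _)) // !act_icomp -/bracket_phi_phi; apply: act_ext.
by iso_eq.
Qed.

(** Both sides are fillings of the same two-slot operation, by the relation
    imposed on the generators ([phi_bracket_slots], [bracket_slots_phi]). *)
Lemma phi_of_bracket_of X Y (x : oper Q X straight 0) (y : oper Q Y straight 0) :
  phi_of (bracket_of x y) = bracket_of (phi_of x) (phi_of y).
Proof.
rewrite /phi_of bracket_of_act /bracket_of comp_act_right comp_plug2 plug2_comp !act_icomp.
rewrite phi_bracket_slots bracket_slots_phi !plug2_tail !act_icomp; apply: act_ext; iso_eq.
Qed.

End LP.

(** * Lie pair operations are iterated brackets of inputs *)

(** Brings a chosen input to the front. *)
Lemma iso_extract A (i : 'I_(width A)) :
  exists A' (e : iso A (one (A i) |+| A')), e i = lshift _ ord0.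
Proof.
case: A i => -[|n] t /= i; first by case: i.
pose u (k : 'I_n.+1) : 'I_(1 + n) :=
  if unlift i k is Some j then rshift 1 j else lshift n ord0.
exists (@Arity n (fun j => t (fintype.lift i j))).
have ub : bijective u.
  exists (join (fun=> i) (fintype.lift i)).
    by move=> k; rewrite /u; case: unliftP => [j ->|->]; rewrite ?(joinL, joinR).
  elim/join_ind => j; rewrite ?(joinL, joinR) /u.
    by rewrite unlift_none (ord1 j).
  by rewrite liftK.
have ut k : (one (t i) |+| @Arity n (fun j => t (fintype.lift i j))) (u k) = t k.
  by rewrite /u; case: unliftP => [j ->|->]; rewrite /= ?(joinL, joinR).
by exists (@Iso (@Arity n.+1 t) (one (t i) |+| @Arity n (fun j => t (fintype.lift i j))) u
  ub ut);
  rewrite /= /u unlift_none.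
Qed.

Lemma iso_tail c A B (h : iso (one c |+| A) (one c |+| B)) :
  h (lshift _ ord0) = lshift _ ord0 ->
  exists g : iso A B, h =1 isum (iid (one c)) g.
Proof.
have tl A' B' (k : iso (one c |+| A') (one c |+| B')) :
    k (lshift _ ord0) = lshift _ ord0 ->
    {g : 'I_(width A') -> 'I_(width B') & forall j, k (rshift 1 j) = rshift 1 (g j)}.
  move=> k0.
  apply: (choice (P := fun (j : 'I_(width A')) (l : 'I_(width B')) => k (rshift 1 j) =
    rshift 1 l)).
  move=> j; have: k (rshift 1 j) != lshift _ ord0.
    by rewrite -k0 (inj_eq (bij_inj (relab_bij k))) eq_rlshift.
  elim/join_ind: (k _) => l; first by rewrite (ord1 l) eqxx.
  by exists l.
move=> h0; have [g gP] := tl _ _ _ h0.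
have h0' : iinv h (lshift _ ord0) = lshift _ ord0 by rewrite -{1}h0 iinvK.
have [g' gP'] := tl _ _ _ h0'.
have gb : bijective g.
  by exists g' => j; apply: (@rshift_inj 1); rewrite -?gP' -?gP -?gP' ?iinvK ?iinvKV.
have gt j : B (g j) = A j.
  by have := relab_tint h (rshift 1 j); rewrite gP /= !joinR.
exists (Iso gb gt); elim/join_ind => j /=; rewrite ?(joinL, joinR) //.
by rewrite (ord1 j).
Qed.

Section LP.
Variable K : fieldType.
Notation Q := (LP K).
Notation pg := (pgen (LP_relations (K:=K))).

(** The generators have degree 0 and degrees add under composition; a composite
    of total degree $n\ne0$ has a factor of nonzero degree. *)
Lemma interp_LP_deg A o n (t : term K LP_signature A o n) :
  n != 0 -> interp pg t = 0.
Proof.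
elim: t => {A o n} [g //|c //|A B o n f x IH n0|c A B o m n k e a IHa b IHb k0
  |//|A o n x IHx y IHy n0|A o n t x IHx n0].
- by rewrite -[LHS]/(act f (interp pg x)) IH ?act0.
- rewrite -[LHS]/(comp e (interp pg a) (interp pg b)).
  case: (eqVneq m 0) => [m0|/IHa ->]; last by rewrite comp0l.
  by rewrite IHb ?comp0r //; apply: contra_neq k0 => n0; rewrite -e m0 n0.
- by rewrite -[LHS]/(interp pg x + interp pg y) IHx // IHy // addr0.
- by rewrite -[LHS]/(t *: interp pg x) IHx // scaler0.
Qed.

Lemma LP_termE A o n (x : oper Q A o n) : exists t, x = interp pg t.
Proof.
exists (repr x); rewrite interp_pgen.
by rewrite -{1}[x]reprK.
Qed.

Lemma LP_deg A o n (x : oper Q A o n) : n != 0 -> x = 0.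
Proof. by have [t ->] := LP_termE x; exact: interp_LP_deg. Qed.

(** This predicate is closed under composition ([expressible_comp]), hence holds
    everywhere ([expressibleP]); it serves as an induction principle for [LP] in
    which brackets and $\phi$ are only ever applied at the root. *)
Inductive Expressible : forall A o, oper Q A o 0 -> Prop :=
| expressible_unit c : Expressible (unit Q c)
| expressible_act A B o (f : iso A B) (x : oper Q A o 0) : Expressible x -> Expressible
  (act f x)
| expressible_0 A o : Expressible (0 : oper Q A o 0)
| expressible_lin A o t (x y : oper Q A o 0) : Expressible x -> Expressible y
  -> Expressible (t *: x + y)
| expressible_br c A B (x : oper Q A c 0) (y : oper Q B c 0) :
    Expressible x -> Expressible y -> Expressible (bracket_of x y)
| expressible_phi A (x : oper Q A straight 0) : Expressible x -> Expressible (phi_of x).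

Lemma expressible_Z A o t (x : oper Q A o 0) : Expressible x -> Expressible (t *: x).
Proof. by move=> mx; rewrite -[_ *: _]addr0; apply: expressible_lin => //;
  exact: expressible_0. Qed.

Lemma expressible_N A o (x : oper Q A o 0) : Expressible x -> Expressible (- x).
Proof. by rewrite -scaleN1r; exact: expressible_Z. Qed.

(** The unit has a single input, so nothing remains beside the slot. *)
Lemma one_slot c c' A (f : iso (one c') (one c |+| A)) :
  c' = c /\ width A = 0%N.
Proof.
have A0 : width A = 0%N.
  have := bij_eq_card (relab_bij f); rewrite !card_ord /= add1n.
  by case.
split=> //.
by have := relab_tint f ord0; elim/join_ind: (f ord0) => [i|j];
  [rewrite /= joinL | case: (empty_ord A0 j)].
Qed.

Lemma comp_unit_left c A C (f : iso (one c) (one c |+| A)) (b : oper Q C c 0) :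
  exists g : iso C (C |+| A), act f (unit Q c) \o1 b = act g b.
Proof.
have [_ A0] := one_slot f.
pose k := iso_empty (erefl : width no_input = 0%N) A0.
exists (isum (iid C) k \oi icat0 C).
rewrite (act_factor (g := icat0 (one c)) (h := isum (iid _) k)).
  rewrite (comp_act_left (f := k)) // comp_unitl act_icomp.
  by apply: act_ext.
move=> i; rewrite /= ?(joinL, joinR); elim/join_ind: (f i) => j.
  by rewrite !ord1.
by case: (empty_ord A0 j).
Qed.

(** Once the input to be filled is located in [x], [iso_extract] makes it the
    first input of [x] and [bracket_of_slot] applies; what is left is a relabelling
    that fixes the first input. *)
Lemma bracket_of_slot_first c c' A B C D (x : oper Q A c 0) (y : oper Q B c 0)
  (z : oper Q C c' 0)
   (f : iso (A |+| B) (one c' |+| D)) i :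
  f (lshift _ i) = lshift _ ord0 ->
  exists A' (e : iso A (one c' |+| A')) (g : iso ((C |+| A') |+| B) (C |+| D)),
    act f (bracket_of x y) \o1 z = act g (bracket_of (act e x \o1 z) y).
Proof.
move=> fi.
have Ai : A i = c'.
  by have := relab_tint f (lshift _ i); rewrite fi /= !joinL.
have [A' []] := iso_extract i; rewrite {}Ai => e ei.
exists A', e.
have [|g gP] := @iso_tail _ (A' |+| B) D (f \oi isum (iinv e) (iid B) \oi iassocV _ _ _).
  by rewrite /= !(joinL, joinR) -ei iinvK.
exists (isum (iid C) g \oi iassoc C A' B).
rewrite -{1}(actK e x) -{1}[y](act_id (f := iid B)) // bracket_of_act act_icomp.
rewrite (act_factor (g := iassoc (one c') A' B) (h := isum (iid _) g)).
  by rewrite (comp_act_left (f := g)) // bracket_of_slot act_icomp.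
have assocK : iassocV (one c') A' B \oi iassoc _ _ _ =1 id by iso_eq.
by move=> k; rewrite -[RHS]gP; congr (f _); congr (isum _ _ _); rewrite -[LHS]assocK.
Qed.

(** The slot that is filled belongs to one of the two arguments of the outermost
    bracket; skew symmetry reduces to the case of the first argument. *)
Lemma expressible_comp A' o (x : oper Q A' o 0) : Expressible x ->
  forall c A C (f : iso A' (one c |+| A)) (b : oper Q C c 0),
  Expressible b -> Expressible (act f x \o1 b).
Proof.
elim=> {A' o x}.
- move=> c' c A C f b mb; have [ec _] := one_slot f; subst c'.
  have [g ->] := comp_unit_left f b.
  exact: expressible_act.
- by move=> A B o g x mx IH c D C f b mb; rewrite act_icomp; exact: IH.
- by move=> A o c D C f b mb; rewrite act0 comp0l; exact: expressible_0.
- move=> A o t x y mx IHx my IHy c D C f b mb.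
  by rewrite actP compPl; apply: expressible_lin; [exact: IHx | exact: IHy].
- move=> c A B x y mx IHx my IHy c' D C f b mb.
  have [k] : exists k, f k = lshift _ ord0 by exists (iinv f (lshift _ ord0));
    rewrite iinvKV.
  elim/join_ind: k => i fi.
    have [E [e [g ->]]] := bracket_of_slot_first x y b fi.
    by apply: expressible_act; apply: expressible_br => //; exact: IHx.
  rewrite bracket_ofC actN -scaleN1r compZl scaleN1r; apply: expressible_N;
    rewrite act_icomp.
  have fi' : (f \oi iswap B A) (lshift _ i) = lshift _ ord0 by rewrite /= joinL.
  have [E [e [g ->]]] := bracket_of_slot_first y x b fi'.
  by apply: expressible_act; apply: expressible_br => //; exact: IHy.
- move=> A x mx IH c D C f b mb.
  by rewrite -phi_of_act phi_of_slot; apply: expressible_phi; exact: IH.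
Qed.

Lemma expressible_bracket c : Expressible (bracket K c).
Proof.
suff -> : bracket K c = act (imerge c 1 1) (bracket_of (unit Q c) (unit Q c)).
  by apply/expressible_act/expressible_br; exact: expressible_unit.
rewrite /bracket_of /plug2 !comp_unitr /bracket_slots !act_icomp act_id //.
move=> k; have -> : k = (imerge c 1 1) k by [].
move: (k : 'I_(1 + 1)); iso_eq.
Qed.

Lemma expressible_phi_gen : Expressible (phi K).
Proof.
suff -> : phi K = act (iinv (icat_empty _ (erefl : width (mono wavy 0) = 0%N)))
  (phi_of (unit Q straight)).
  by apply/expressible_act/expressible_phi; exact: expressible_unit.
by rewrite /phi_of comp_unitr actK.
Qed.

Lemma expressibleP A o (x : oper Q A o 0) : Expressible x.
Proof.
have [t ->] := LP_termE x.
suff H n (s : term K LP_signature A o n) (e : n = 0) :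
   Expressible (eq_rect n (fun n => oper Q A o n) (interp pg s) 0 e).
  exact: (H _ t erefl).
elim: s e => {A o n x t}.
- case=> [c|] /= e; rewrite (eq_irrelevance e erefl) /=.
    exact: expressible_bracket.
  exact: expressible_phi_gen.
- by move=> c e; rewrite (eq_irrelevance e erefl) /=; exact: expressible_unit.
- by move=> A B o n f x IH e; subst n; apply: expressible_act; exact: (IH erefl).
- move=> c A B o m n k e a IHa b IHb e'; move: e; subst k => e.
  rewrite -[eq_rect _ _ _ _ _]/(comp e (interp pg a) (interp pg b)).
  case: (eqVneq m 0) => m0; last by rewrite (interp_LP_deg a m0) comp0l;
    exact: expressible_0.
  case: (eqVneq n 0) => n0; last by rewrite (interp_LP_deg b n0) comp0r;
    exact: expressible_0.
  subst m n; rewrite (eq_irrelevance e (addr0 0)).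
  rewrite -[interp pg a](act_id (f := iid _)) //; apply: expressible_comp.
    exact: (IHa erefl).
  exact: (IHb erefl).
- by move=> A o n e; subst n; exact: expressible_0.
- move=> A o n x IHx y IHy e; subst n.
  rewrite -[eq_rect _ _ _ _ _]/(interp pg x + interp pg y).
  by rewrite -[interp pg x]scale1r; apply: expressible_lin;
    [exact: (IHx erefl)|exact: (IHy erefl)].
- by move=> A o n t x IHx e; subst n; apply: expressible_Z; exact: (IHx erefl).
Qed.

End LP.

(** * Lie pairs and their endomorphism operads *)

(** A Lie pair $(\mathfrak g,\mathfrak h,\phi)$ packed in one module, so that
    arguments of both colours have the same type: [pr c] projects onto the part of
    colour [c], and [ph] is $\phi$ composed with the projection to $\mathfrak g$.
    The two parts may overlap, which [double_pair] exploits. *)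
Record lie_pair (K : fieldType) := LiePair {
  carrier :> lmodType K;
  pr : colour -> carrier -> carrier;
  br : carrier -> carrier -> carrier;
  ph : carrier -> carrier;
  prP : forall c t x y, pr c (t *: x + y) = t *: pr c x + pr c y;
  brPl : forall t x y z, br (t *: x + y) z = t *: br x z + br y z;
  phP : forall t x y, ph (t *: x + y) = t *: ph x + ph y;
  pr_pr : forall c x, pr c (pr c x) = pr c x;
  brC : forall x y, br x y = - br y x;
  jacobi : forall x y z, br (br x y) z + (br (br y z) x + br (br z x) y) = 0;
  pr_br : forall c x y, pr c (br (pr c x) (pr c y)) = br (pr c x) (pr c y);
  ph_pr : forall x, ph (pr straight x) = ph x;
  pr_ph : forall x, pr wavy (ph x) = ph x;
  ph_br : forall x y, ph (br (pr straight x) (pr straight y)) = br (ph x) (ph y) }.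

Section LiePairTheory.
Variables (K : fieldType) (L : lie_pair K).
Implicit Types x y z : L.

Lemma pr0 c : pr c (0 : L) = 0. Proof. exact: lin0 (@prP _ L c). Qed.
Lemma br0l x : br (0 : L) x = 0.
Proof. by apply: (lin0 (f := fun y => br y x)) => *; exact: brPl. Qed.
Lemma br0r x : br x (0 : L) = 0. Proof. by rewrite brC br0l oppr0. Qed.
Lemma brPr t x y z : br x (t *: y + z) = t *: br x y + br x z.
Proof. by rewrite 3!(brC x) brPl opprD scalerN. Qed.
Lemma brZl t x y : br (t *: x) y = t *: br x y.
Proof. by rewrite -[t *: x]addr0 brPl br0l addr0. Qed.
Lemma brZr t x y : br x (t *: y) = t *: br x y.
Proof. by rewrite -[t *: y]addr0 brPr br0r addr0. Qed.
Lemma brDl x y z : br (x + y) z = br x z + br y z.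
Proof. by have := brPl 1 x y z; rewrite !scale1r. Qed.
Lemma brNl x y : br (- x) y = - br x y.
Proof. by rewrite -!scaleN1r brZl. Qed.
Lemma ph0 : ph (0 : L) = 0. Proof. exact: lin0 (@phP _ L). Qed.

Definition upd n (v : 'I_n -> L) i x := fun j => if j == i then x else v j.

Definition multilinear n (F : ('I_n -> L) -> L) :=
  forall v i t x y, F (upd v i (t *: x + y)) = t *: F (upd v i x) + F (upd v i y).

(** Operations see their arguments only through the projections of the right
    colours, and their values have the right colour; the endomorphism operad of an
    ungraded space is concentrated in degree 0. *)
Definition endoP (A : arity) (o : colour) (n : int)
   (F : ('I_(width A) -> L) -> L) :=
  [/\ multilinear F, (forall v, pr o (F v) = F v),
      (forall v, F (fun i => pr (A i) (v i)) = F v)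
    & n != 0 -> forall v, F v = 0].

Record endo A o n := Endo { fn :> ('I_(width A) -> L) -> L; fnP : @endoP A o n fn }.

Lemma endo_ext A o n (F G : endo A o n) : (forall v, F v = G v) -> F = G.
Proof.
case: F G => F FP [G GP] /= e; have {}e : F = G by exact: funext.
by subst G; rewrite (Prop_irrelevance FP GP).
Qed.

Lemma endo0_subproof A o n : @endoP A o n (fun=> 0).
Proof. by split=> // [v i t x y|v]; rewrite ?scaler0 ?addr0 ?pr0. Qed.

Lemma endo_lin_subproof A o n t (F G : endo A o n) :
  @endoP A o n (fun v => t *: F v + G v).
Proof.
case: F G => F [Fm Fo FA Fn] [G [Gm Go GA Gn]] /=; split=> /=.
- move=> v i u x y; rewrite Fm Gm !scalerDr !scalerA [t * u]mulrC addrACA.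
  by rewrite -!addrA.
- by move=> v; rewrite prP Fo Go.
- by move=> v; rewrite FA GA.
- by move=> n0 v; rewrite Fn // Gn // scaler0 addr0.
Qed.

Definition endo0 A o n := Endo (endo0_subproof A o n).
Definition endo_lin A o n t (F G : endo A o n) := Endo (endo_lin_subproof t F G).
Definition endo_add A o n := @endo_lin A o n 1.
Definition endo_scale A o n t (F : endo A o n) := endo_lin t F (endo0 _ _ _).
Definition endo_opp A o n := @endo_scale A o n (-1).

HB.instance Definition _ A o n := gen_eqMixin (endo A o n).
HB.instance Definition _ A o n := gen_choiceMixin (endo A o n).

Lemma endo_addA A o n : associative (@endo_add A o n).
Proof. by move=> *; apply: endo_ext => v /=; rewrite !scale1r addrA. Qed.
Lemma endo_addC A o n : commutative (@endo_add A o n).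
Proof. by move=> *; apply: endo_ext => v /=; rewrite !scale1r addrC. Qed.
Lemma endo_add0 A o n : left_id (endo0 A o n) (@endo_add A o n).
Proof. by move=> *; apply: endo_ext => v /=; rewrite scale1r add0r. Qed.
Lemma endo_addN A o n : left_inverse (endo0 A o n) (@endo_opp A o n) (@endo_add A o n).
Proof. by move=> *; apply: endo_ext => v /=; rewrite scale1r addr0 scaleN1r addNr. Qed.
HB.instance Definition _ A o n := GRing.isZmodule.Build (endo A o n)
  (@endo_addA A o n) (@endo_addC A o n) (@endo_add0 A o n) (@endo_addN A o n).

Lemma endo_scaleA A o n t u (F : endo A o n) :
  endo_scale t (endo_scale u F) = endo_scale (t * u) F.
Proof. by apply: endo_ext => v /=; rewrite !addr0 scalerA. Qed.
Lemma endo_scale1 A o n : left_id 1 (@endo_scale A o n).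
Proof. by move=> F; apply: endo_ext => v /=; rewrite !addr0 scale1r. Qed.
Lemma endo_scaleDr A o n : right_distributive (@endo_scale A o n) +%R.
Proof. by move=> *; apply: endo_ext => v /=; rewrite !addr0 !scale1r scalerDr. Qed.
Lemma endo_scaleDl A o n (F : endo A o n) :
  {morph (@endo_scale A o n)^~ F : t u / t + u}.
Proof. by move=> *; apply: endo_ext => v /=; rewrite !addr0 !scale1r scalerDl. Qed.
HB.instance Definition _ A o n := GRing.Zmodule_isLmodule.Build K (endo A o n)
  (@endo_scaleA A o n) (@endo_scale1 A o n) (@endo_scaleDr A o n) (@endo_scaleDl A o n).

Lemma endoD A o n (F G : endo A o n) v : (F + G) v = F v + G v.
Proof. by rewrite /= scale1r. Qed.
Lemma endoZ A o n t (F : endo A o n) v : (t *: F) v = t *: F v.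
Proof. by rewrite /= addr0. Qed.

Lemma endo_act_subproof A B o n (f : iso A B) (F : endo A o n) :
  @endoP B o n (fun v => F (v \o f)).
Proof.
case: F => F [Fm Fo FA Fn] /=; split=> //.
- move=> v i t x y; have e z : upd v i z \o f = upd (v \o f) (iinv f i) z.
    apply: funext => j; rewrite /upd /=; congr (if _ then _ else _).
    by apply/eqP/eqP => [<-|->]; rewrite ?iinvK ?iinvKV.
  by rewrite !e Fm.
- move=> v; rewrite -[RHS]FA; congr F; apply: funext => i /=.
  by rewrite relab_tint.
- by move=> n0 v; exact: Fn.
Qed.
Definition endo_act A B o n (f : iso A B) (F : endo A o n) : endo B o n :=
  Endo (endo_act_subproof f F).

Lemma endo_unit_subproof c : @endoP (mono c 1) c 0 (fun v => pr c (v ord0)).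
Proof.
split=> //= [v i t x y|v|v]; rewrite ?pr_pr //.
by rewrite /upd (ord1 i) eqxx prP.
Qed.
Definition endo_unit c : endo (mono c 1) c 0 := Endo (endo_unit_subproof c).

Lemma join_upd n z (w : 'I_n -> L) :
  join (fun=> z) w = upd (join (fun=> 0) w) (lshift n (ord0 : 'I_1)) z.
Proof.
apply: funext; elim/join_ind => j; rewrite /upd ?(joinL, joinR).
  by rewrite (ord1 j) eqxx.
by rewrite eq_rlshift.
Qed.

Definition endo_plug c A B o m n (F : endo (one c |+| A) o m) (G : endo B c n)
   (v : 'I_(width (B |+| A)) -> L) : L :=
  F (join (fun=> G (v \o lshift (width A))) (v \o @rshift (width B) (width A))).

Lemma endo_comp_subproof c A B o m n k (e : m + n = k)
   (F : endo (one c |+| A) o m) (G : endo B c n) :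
  @endoP (B |+| A) o k (endo_plug F G).
Proof.
case: F G => F [Fm Fo FA Fn] [G [Gm Go GA Gn]]; rewrite /endo_plug /=; split.
- move=> v i t x y; elim/join_ind: i => i.
    have e1 z : upd v (lshift _ i) z \o lshift (width A) = upd (v \o lshift _) i z.
      by apply: funext => j; rewrite /upd /= eq_lshift.
    have e2 z : upd v (lshift _ i) z \o @rshift (width B) _ = v \o @rshift _ _.
      by apply: funext => j; rewrite /upd /= eq_rlshift.
    rewrite !e1 !e2 Gm; set w := v \o @rshift (width B) (width A).
    by rewrite join_upd Fm -!join_upd.
  have e1 z : upd v (rshift _ i) z \o lshift (width A) = v \o lshift _.
    by apply: funext => j; rewrite /upd /= eq_lrshift.
  rewrite !e1; set g := G _.
  have e2 z : join (fun=> g : L) (upd v (rshift _ i) z \o @rshift (width B) _) =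
     upd (join (fun=> g) (v \o @rshift _ _)) (rshift 1 i) z.
    apply: funext; elim/join_ind => j; rewrite /upd ?(joinL, joinR) /=.
      by rewrite eq_lrshift.
    by rewrite !eq_rshift.
  by rewrite !e2 Fm.
- by move=> v; rewrite Fo.
- move=> v; rewrite -[RHS]FA; congr F; apply: funext.
  elim/join_ind => j; rewrite ?(joinL, joinR) /=.
    rewrite joinL Go -[RHS]GA; congr G; apply: funext => i /=.
    by rewrite joinL.
  by rewrite !joinR.
- move=> k0 v; case: (eqVneq m 0) => m0; last by rewrite Fn.
  have n0 : n != 0 by apply: contra_neq k0 => n0; rewrite -e m0 n0.
  rewrite Gn //; set w := v \o @rshift (width B) (width A).
  have := Fm (join (fun=> 0) w) (lshift _ (ord0 : 'I_1)) (-1) 0 0.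
  by rewrite scaler0 addr0 scaleN1r addNr -join_upd.
Qed.
Definition endo_comp c A B o m n k (e : m + n = k)
   (F : endo (one c |+| A) o m) (G : endo B c n) : endo (B |+| A) o k :=
  Endo (endo_comp_subproof e F G).

Lemma endo_deg A o n (F : endo A o n) v : n != 0 -> F v = 0.
Proof. by case: F => F [] /= _ _ _ Fn n0; exact: Fn. Qed.

Lemma endo_pr A o n (F : endo A o n) v : pr o (F v) = F v.
Proof. by case: F => F []. Qed.

Lemma endo_prA A o n (F : endo A o n) v : F (fun i => pr (A i) (v i)) = F v.
Proof. by case: F => F []. Qed.

Lemma endo_multi A o n (F : endo A o n) : multilinear F.
Proof. by case: F => F []. Qed.

Lemma endo_first c A o n (F : endo (one c |+| A) o n) t x y w :
  F (join (fun=> t *: x + y) w) = t *: F (join (fun=> x) w) + F (join (fun=> y) w).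
Proof.
by rewrite join_upd endo_multi -!join_upd.
Qed.

Lemma endo_first0 c A o n (F : endo (one c |+| A) o n) w :
  F (join (fun=> 0) w) = 0.
Proof. exact: (lin0 (f := fun z => F (join (fun=> z) w)) (fun t x y => endo_first F t x y
  w)). Qed.

Definition End : operad K.
Proof.
exists (fun A o n => endo A o n : lmodType K) endo_act endo_unit endo_comp.
- by move=> A B o n f t x y; apply: endo_ext => v; rewrite /= !addr0 !scale1r.
- move=> A o n f x fid; apply: endo_ext => v /=; congr (x _).
  by apply: funext => i /=; rewrite fid.
- move=> A B C o n f g h x hfg; apply: endo_ext => v /=; congr (x _).
  by apply: funext => i /=; rewrite hfg.
- move=> c A B o m n k e t x y b; apply: endo_ext => v.
  by rewrite /= /endo_plug /= !addr0 !scale1r.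
- move=> c A B o m n k e t a x y; apply: endo_ext => v.
  by rewrite /= /endo_plug /= !addr0 !scale1r endo_first.
- move=> c A A' B B' o m n k e f g a b; apply: endo_ext => v.
  rewrite /= /endo_plug /=; congr (a _); apply: funext.
  elim/join_ind => i; rewrite /= !(joinL, joinR) /=; last by rewrite joinR.
  by congr (b _); apply: funext => j; rewrite /= joinL.
- move=> B c n e b; apply: endo_ext => v.
  by rewrite /= /endo_plug /= joinL endo_pr.
- move=> c A o n e a; apply: endo_ext => v.
  rewrite /= /endo_plug /= -[LHS]endo_prA -[RHS]endo_prA; congr (a _); apply: funext.
  elim/join_ind => i; rewrite /= !(joinL, joinR) /=; last by [].
  by rewrite pr_pr (ord1 i); congr (pr _ (v _)); apply: val_inj.
- move=> c c' A B C o m n p mn np mnp e1 e2 e3 e4 a b z; apply: endo_ext => v.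
  rewrite /= /endo_plug /=; congr (a _); apply: funext.
  elim/join_ind => i; rewrite /= !(joinL, joinR) /=; last by rewrite !joinR.
  congr (b _); apply: funext; elim/join_ind => j; rewrite /= !(joinL, joinR) /=.
    by congr (z _); apply: funext => k; rewrite /= !joinL.
  by rewrite joinL joinR.
- move=> c c' A B C o m n p mn mp mnp e1 e2 e3 e4 a b z; apply: endo_ext => v.
  pose bv := b (v \o (@rshift (width C) (width B + width A) \o lshift (width A))).
  pose w := join (fun=> z (v \o lshift (width B + width A)))
     (v \o (@rshift (width C) (width B + width A) \o @rshift (width B) (width A)))
     : 'I_(width (one c' |+| A)) -> L.
  have -> : endo_comp e2 (endo_act (ilcomm B (one c') A) (endo_comp e1 a b)) z v
      = a (join (fun=> bv) w).
    rewrite /= /endo_plug /=; congr (a _); apply: funext.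
    elim/join_ind => i; rewrite ?(joinL, joinR) /=.
      congr (b _); apply: funext => j /=.
      by rewrite !(joinL, joinR) /=.
    elim/join_ind: i => i; rewrite /w /= !(joinL, joinR) /= ?(joinL, joinR) //=.
  rewrite endoZ.
  have -> : endo_act (ilcomm B C A) (endo_comp e4 (endo_act (ilcomm C (one c) A)
      (endo_comp e3 (endo_act (ilcomm (one c) (one c') A) a) z)) b) v
      = a (join (fun=> bv) w).
    rewrite /= /endo_plug /=; congr (a _); apply: funext.
    elim/join_ind => i; rewrite /= ?(joinL, joinR) /= ?(joinL, joinR) /=.
      congr (b _); apply: funext => j /=.
      by rewrite !(joinL, joinR) /=.
    elim/join_ind: i => i; rewrite /w /= ?(joinL, joinR) /= ?(joinL, joinR) /=
      ?(joinL, joinR).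
      congr (z _); apply: funext => j.
      by do 4!rewrite /= ?(joinL, joinR).
    by do 4!rewrite /= ?(joinL, joinR).
  (* The Koszul sign is trivial unless both degrees are nonzero, and then both
     sides vanish. *)
  case: (eqVneq n 0) => n0; first by rewrite n0 mul0r expr0z scale1r.
  by rewrite /bv (endo_deg b _ n0) endo_first0 scaler0.
Defined.

End LiePairTheory.

(** * Evaluation in a Lie pair *)

Section Eval.
Variables (K : fieldType) (L : lie_pair K).

Definition ord2_0 : 'I_2 := lshift 1 (ord0 : 'I_1).
Definition ord2_1 : 'I_2 := rshift 1 (ord0 : 'I_1).

Lemma ord2P (P : 'I_2 -> Prop) : P ord2_0 -> P ord2_1 -> forall i, P i.
Proof. by move=> p0 p1; elim/(@join_ind 1 1) => i; rewrite (ord1 i). Qed.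

Lemma end_br_subproof c :
  @endoP _ L (mono c 2) c 0 (fun v => br (pr c (v ord2_0)) (pr c (v ord2_1))).
Proof.
split=> //= [v i t x y|v|v]; rewrite ?pr_br ?pr_pr //.
by elim/ord2P: i; rewrite /upd /ord2_0 /ord2_1 ?eq_lrshift ?eq_rlshift !eqxx prP
  ?brPl ?brPr.
Qed.

Lemma end_ph_subproof : @endoP _ L (mixed 1 0) wavy 0 (fun v => ph (v ord0)).
Proof.
have e0 : ord0 = lshift 0 (ord0 : 'I_1) by exact: val_inj.
split=> //= [v i t x y|v|v]; last 1 first.
- by rewrite e0 joinL ph_pr.
- have -> : i = ord0 by apply: val_inj; case: i => -[].
  by rewrite /upd eqxx phP.
- by rewrite pr_ph.
Qed.

Definition lie_pair_valuation : valuation LP_signature (End L) := fun g =>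
  match g with
  | Br c => Endo (end_br_subproof c)
  | Phi => Endo end_ph_subproof
  end.

Lemma lie_pair_valuation_model : model (LP_relations (K:=K)) lie_pair_valuation.
Proof.
move=> A o n x y [c s|c|]; apply: endo_ext => v.
- rewrite /= addr0.
  have s2 : s = 1%g \/ s = tperm ord2_0 ord2_1.
    have h i : i <> ord2_0 -> i = ord2_1 by elim/ord2P: i.
    have h' i : i <> ord2_1 -> i = ord2_0 by elim/ord2P: i.
    case: (eqVneq (s ord2_0) ord2_0) => [s0|/eqP/h s0]; [left|right]; apply/permP.
      elim/ord2P; rewrite perm1 //; apply: h => /eqP.
      by rewrite -s0 (inj_eq perm_inj).
    elim/ord2P; rewrite ?tpermL ?tpermR //; apply: h' => /eqP.
    by rewrite -[X in _ == X]s0 (inj_eq perm_inj).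
  case: s2 => ->; first by rewrite !perm1 odd_perm1 scale1r.
  by rewrite tpermL tpermR odd_tperm /= scaleN1r brC.
- rewrite /= !scale1r /endo_plug /=.
  pose a : 'I_3 := lshift 1 ord2_0; pose b : 'I_3 := lshift 1 ord2_1.
  pose d : 'I_3 := rshift 2 (ord0 : 'I_1).
  have ca : cycle3 a = b by rewrite permE; exact: val_inj.
  have cb : cycle3 b = d by rewrite permE; exact: val_inj.
  have cd : cycle3 d = a by rewrite permE; exact: val_inj.
  have k0 (T : Type) (u : 'I_1 -> T) (w : 'I_1 -> T) :
    join u w ord2_0 = u ord0 by exact: joinL.
  have k1 (T : Type) (u : 'I_1 -> T) (w : 'I_1 -> T) :
    join u w ord2_1 = w ord0 by exact: joinR.
  rewrite !k0 !k1 !pr_br /= -/a -/b -/d !permM ca cb cd ca.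
  exact: jacobi.
- rewrite /= /endo_plug /=.
  have k0 (T : Type) (u : 'I_1 -> T) (w : 'I_1 -> T) :
    join u w ord2_0 = u ord0 by exact: joinL.
  have k1 (T : Type) (u : 'I_1 -> T) (w : 'I_1 -> T) :
    join u w ord2_1 = w ord0 by exact: joinR.
  rewrite k0 k1 /=.
  have e0 : (ord0 : 'I_(1 + 0)) = lshift 0 (ord0 : 'I_1) by exact: val_inj.
  rewrite [in RHS]e0.
  do 4 rewrite /= ?(joinL, joinR).
  by rewrite [in LHS]e0 joinL ph_br !pr_ph.
Qed.

Definition eval_morphism : operad_morphism (LP K) (End L) := lift lie_pair_valuation_model.

Definition eval A o n (x : oper (LP K) A o n) : endo L A o n := morph eval_morphism x.

Lemma evalD A o n (x y : oper (LP K) A o n) v : eval (x + y) v = eval x v + eval y v.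
Proof. by rewrite /eval morphD endoD. Qed.

Lemma eval0 A o n v : eval (0 : oper (LP K) A o n) v = 0.
Proof. by rewrite /eval morph0. Qed.

Lemma evalZ A o n t (x : oper (LP K) A o n) v : eval (t *: x) v = t *: eval x v.
Proof. by rewrite /eval morphZ endoZ. Qed.

Lemma evalN A o n (x : oper (LP K) A o n) v : eval (- x) v = - eval x v.
Proof. by rewrite -scaleN1r evalZ scaleN1r. Qed.

Lemma eval_sum A o n I (r : seq I) (P : pred I) (F : I -> oper (LP K) A o n) v :
  eval (\sum_(i <- r | P i) F i) v = \sum_(i <- r | P i) eval (F i) v.
Proof. by elim/big_rec2: _ => [|i x y _ <-]; rewrite ?eval0 ?evalD. Qed.

Lemma eval_act A B o n (f : iso A B) (x : oper (LP K) A o n) v :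
  eval (act f x) v = eval x (v \o f).
Proof. by rewrite /eval morph_act. Qed.

Lemma eval_unit c v : eval (unit (LP K) c) v = pr c (v ord0).
Proof. by rewrite /eval morph_unit. Qed.

Lemma eval_comp c A B o m n k (e : m + n = k)
    (a : oper (LP K) (one c |+| A) o m) (b : oper (LP K) B c n) v :
  eval (comp e a b) v =
  eval a (join (fun=> eval b (v \o lshift (width A))) (v \o @rshift (width B) (width A))).
Proof. by rewrite /eval morph_comp. Qed.

Lemma eval_bracket c v :
  eval (bracket K c) v = br (pr c (v ord2_0)) (pr c (v ord2_1)).
Proof. by have -> : eval (bracket K c) = lie_pair_valuation (Br c) :=
  lift_gen lie_pair_valuation_model (Br c). Qed.

Lemma eval_phi v : eval (phi K) v = ph (v ord0).
Proof. by have -> : eval (phi K) = lie_pair_valuation Phi :=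
  lift_gen lie_pair_valuation_model Phi. Qed.

Lemma eval_opbr c A B (x : oper (LP K) A c 0) (y : oper (LP K) B c 0) v :
  eval (bracket_of x y) v =
  br (eval x (v \o lshift (width B))) (eval y (v \o @rshift (width A) (width B))).
Proof.
rewrite /bracket_of eval_act /plug2 eval_comp eval_act eval_comp eval_act /bracket_slots
  eval_act eval_bracket.
set u := _ \o islots2 c.
have -> : u ord2_0 = eval x (v \o lshift (width B)).
  rewrite /u /islots2 /ord2_0 /=; do 8 rewrite /= ?(joinL, joinR).
  by congr (eval x _); apply: funext => i /=; rewrite joinL.
have -> : u ord2_1 = eval y (v \o @rshift (width A) (width B)).
  rewrite /u /islots2 /ord2_1 /=; do 8 rewrite /= ?(joinL, joinR).
  by congr (eval y _); apply: funext => i; do 8 rewrite /= ?(joinL, joinR).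
by rewrite !endo_pr.
Qed.

Lemma eval_opphi A (x : oper (LP K) A straight 0) v : eval (phi_of x) v = ph (eval x v).
Proof.
rewrite /phi_of eval_act eval_comp eval_phi.
have e0 : (ord0 : 'I_(1 + 0)) = lshift 0 (ord0 : 'I_1) by exact: val_inj.
rewrite e0 joinL; congr (ph (eval x _)); apply: funext => i /=.
by rewrite joinL.
Qed.

Lemma eval_pr A o n (x : oper (LP K) A o n) v : pr o (eval x v) = eval x v.
Proof. exact: endo_pr. Qed.

Lemma eval_prA A o n (x : oper (LP K) A o n) v :
  eval x (fun i => pr (A i) (v i)) = eval x v.
Proof. exact: endo_prA. Qed.

End Eval.

(** * A Lie pair that separates operations *)

Section Labelled.
Variables (K : fieldType) (I : finType) (tau : I -> colour).
Notation Q := (LP K).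

Definition set_arity (S : {set I}) : arity := @Arity #|S| (fun i => tau (enum_val i)).
Notation element S := (fun i : 'I_(width (set_arity S)) => enum_val i : I).

(** At most one [f] fits, as [enum_val] is injective, and none does if a label is
    repeated. *)
Definition fits A (l : 'I_(width A) -> I) S (f : iso A (set_arity S)) :=
  forall i, enum_val (f i) = l i.

(** The operation [x], with its inputs named by the labels [l], written on the
    ordered label set [S]; zero if [S] is not the set of labels used or if a label
    is used twice. *)
Definition at_set A (l : 'I_(width A) -> I) c (x : oper Q A c 0) S :
    oper Q (set_arity S) c 0 :=
  if pselect (exists f : iso A (set_arity S), fits l f) is left h
  then act (sval (cid h)) x else 0.

Lemma at_setE A (l : 'I_(width A) -> I) c (x : oper Q A c 0) S
  (f : iso A (set_arity S)) : fits l f -> at_set l x S = act f x.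
Proof.
move=> fl; rewrite /at_set; case: pselect => [h|[]]; last by exists f.
apply: act_ext => i; apply: enum_val_inj.
by rewrite fl (svalP (cid h)).
Qed.

Lemma at_set0 A (l : 'I_(width A) -> I) c (x : oper Q A c 0) S :
  ~ (exists f : iso A (set_arity S), fits l f) -> at_set l x S = 0.
Proof. by rewrite /at_set; case: pselect. Qed.

Lemma at_set_lin A (l : 'I_(width A) -> I) c t (x y : oper Q A c 0) S :
  at_set l (t *: x + y) S = t *: at_set l x S + at_set l y S.
Proof.
by rewrite /at_set; case: pselect => [h|_]; rewrite ?actP ?scaler0 ?addr0.
Qed.

Lemma at_set_zero A (l : 'I_(width A) -> I) c S :
  at_set l (0 : oper Q A c 0) S = 0.
Proof. by apply: (lin0 (f := fun x => at_set l x S)) => *; exact: at_set_lin. Qed.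

Lemma at_setN A (l : 'I_(width A) -> I) c (x : oper Q A c 0) S :
  at_set l (- x) S = - at_set l x S.
Proof. by rewrite -scaleN1r -[_ *: x]addr0 at_set_lin at_set_zero addr0 scaleN1r. Qed.

Lemma at_set_act A B (l : 'I_(width B) -> I) (f : iso A B) c (x : oper Q A c 0) S :
  at_set l (act f x) S = at_set (l \o f) x S.
Proof.
have [[g gl]|no] := pselect (exists g : iso B (set_arity S), fits l g).
  by rewrite (at_setE _ gl) (@at_setE _ _ _ _ _ (g \oi f)) ?act_icomp // => i; exact: gl.
rewrite !at_set0 // => -[h hl]; apply: no; exists (h \oi iinv f) => i /=.
by rewrite hl /= iinvKV.
Qed.

Lemma fits_inj A (l : 'I_(width A) -> I) S (f : iso A (set_arity S)) :
  fits l f -> injective l.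
Proof.
by move=> fl i j; rewrite -!fl => /enum_val_inj/(bij_inj (relab_bij f)).
Qed.

Lemma fits_tint A (l : 'I_(width A) -> I) S (f : iso A (set_arity S)) :
  fits l f -> forall i, tau (l i) = A i.
Proof. by move=> fl i; rewrite -fl -[A i](relab_tint f). Qed.

Lemma fits_set A (l : 'I_(width A) -> I) S (f : iso A (set_arity S)) :
  fits l f -> S = [set l i | i : 'I_(width A)].
Proof.
move=> fl; apply/setP => j; apply/idP/imsetP => [jS|[i _ ->]].
  exists (iinv f (enum_rank_in jS j)) => //.
  by rewrite -fl iinvKV enum_rankK_in.
by rewrite -fl; exact: enum_valP.
Qed.

Lemma fits_ex A (l : 'I_(width A) -> I) : injective l ->
  (forall i, tau (l i) = A i) ->
  exists f : iso A (set_arity [set l i | i : 'I_(width A)]), fits l f.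
Proof.
move=> li lt; set S := [set _ | _ in _].
have lS i : l i \in S by exact: imset_f.
pose f i : 'I_(#|S|) := enum_rank_in (lS i) (l i).
have fv i : enum_val (f i) = l i by rewrite enum_rankK_in.
have fb : bijective f.
  apply: inj_card_bij => [i j e|]; first by apply: li; rewrite -!fv e.
  by rewrite !card_ord card_imset // card_ord.
have ft i : set_arity S (f i) = A i by rewrite /= fv lt.
by exists (@Iso A (set_arity S) f fb ft).
Qed.

(** The multilinear part of the free Lie pair on generators labelled by [I]: the
    component at [S] consists of the operations whose inputs are named by the
    elements of [S]. *)
Definition fam c : Type := forall S : {set I}, oper Q (set_arity S) c 0.

Section Module.
Variable c : colour.
Implicit Types u v w : fam c.
HB.instance Definition _ := gen_eqMixin (fam c).
HB.instance Definition _ := gen_choiceMixin (fam c).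
Definition fam_add u v : fam c := fun S => u S + v S.
Definition fam_zero : fam c := fun S => 0.
Definition fam_opp u : fam c := fun S => - u S.
Definition fam_scale t u : fam c := fun S => t *: u S.
Lemma fam_ext u v : (forall S, u S = v S) -> u = v.
Proof. exact: functional_extensionality_dep. Qed.
Lemma fam_addA : associative fam_add.
Proof. by move=> u v w; apply: fam_ext => S; exact: addrA. Qed.
Lemma fam_addC : commutative fam_add.
Proof. by move=> u v; apply: fam_ext => S; exact: addrC. Qed.
Lemma fam_add0 : left_id fam_zero fam_add.
Proof. by move=> u; apply: fam_ext => S; exact: add0r. Qed.
Lemma fam_addN : left_inverse fam_zero fam_opp fam_add.
Proof. by move=> u; apply: fam_ext => S; exact: addNr. Qed.
HB.instance Definition _ := GRing.isZmodule.Build (fam c) fam_addA fam_addC fam_add0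
  fam_addN.
Lemma fam_scaleA s t u : fam_scale s (fam_scale t u) = fam_scale (s * t) u.
Proof. by apply: fam_ext => S; exact: scalerA. Qed.
Lemma fam_scale1 : left_id 1 fam_scale.
Proof. by move=> u; apply: fam_ext => S; exact: scale1r. Qed.
Lemma fam_scaleDr : right_distributive fam_scale +%R.
Proof. by move=> t u v; apply: fam_ext => S; exact: scalerDr. Qed.
Lemma fam_scaleDl u : {morph fam_scale^~ u : s t / s + t}.
Proof. by move=> s t; apply: fam_ext => S; exact: scalerDl. Qed.
HB.instance Definition _ := GRing.Zmodule_isLmodule.Build K (fam c)
  fam_scaleA fam_scale1 fam_scaleDr fam_scaleDl.

Lemma fam_sumE J (r : seq J) (P : pred J) (F : J -> fam c) S :
  (\sum_(i <- r | P i) F i) S = \sum_(i <- r | P i) F i S.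
Proof. by elim/big_rec2: _ => // i y x _ <-. Qed.
End Module.

Definition labelled A (l : 'I_(width A) -> I) c (x : oper Q A c 0) : fam c :=
  fun S => at_set l x S.

Lemma labelled_act A B (l : 'I_(width B) -> I) (f : iso A B) c (x : oper Q A c 0) :
  labelled l (act f x) = labelled (l \o f) x.
Proof. by apply: fam_ext => S; exact: at_set_act. Qed.

Lemma labelled_ext A (l m : 'I_(width A) -> I) c (x : oper Q A c 0) :
  l =1 m -> labelled l x = labelled m x.
Proof. by move=> /funext ->. Qed.

Lemma labelled_lin A (l : 'I_(width A) -> I) c t (x y : oper Q A c 0) :
  labelled l (t *: x + y) = t *: labelled l x + labelled l y.
Proof. by apply: fam_ext => S; exact: at_set_lin. Qed.
Lemma labelled0 A (l : 'I_(width A) -> I) c : labelled l (0 : oper Q A c 0) = 0.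
Proof. by apply: fam_ext => S; exact: at_set_zero. Qed.
Lemma labelledD A (l : 'I_(width A) -> I) c (x y : oper Q A c 0) :
  labelled l (x + y) = labelled l x + labelled l y.
Proof. by have := labelled_lin l 1 x y; rewrite !scale1r. Qed.
(** Families are sums of labelled operations, so that multilinear identities
    between families follow from those between operations ([fam_ind]). *)
Lemma fam_expand c (u : fam c) : u = \sum_S labelled (element S) (u S).
Proof.
apply: fam_ext => T; rewrite fam_sumE (bigD1 T) //= big1 ?addr0.
  by rewrite /labelled (@at_setE _ _ _ _ _ (iid _)) ?act_id.
move=> S ST; apply: at_set0 => -[f fl]; case/eqP: ST.
by rewrite (fits_set fl); apply/setP => j; apply/idP/imsetP => [jS|[i _ ->]];
  [exists (enum_rank_in jS j); rewrite ?enum_rankK_in | exact: enum_valP].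
Qed.

Lemma fam_ind c (P : fam c -> Prop) : P 0 -> (forall u v, P u -> P v -> P (u + v)) ->
  (forall A l (x : oper Q A c 0), P (@labelled A l c x)) -> forall u, P u.
Proof. by move=> P0 PD Pi u; rewrite (fam_expand u); apply: big_ind. Qed.

(** Pairs of intersecting label sets contribute zero, by the convention on
    repeated labels in [at_set]. *)
Definition fam_br c (u v : fam c) : fam c := fun S =>
  \sum_S1 \sum_S2 at_set (join (element S1) (element S2) :
    'I_(width (set_arity S1 |+| set_arity S2)) -> I)
     (bracket_of (u S1) (v S2)) S.

Lemma fam_brPl c t (u u' v : fam c) :
  fam_br (t *: u + u') v = t *: fam_br u v + fam_br u' v.
Proof.
apply: fam_ext => S; rewrite -[RHS]/(t *: fam_br u v S + fam_br u' v S) scaler_sumr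
  -big_split /=.
apply: eq_bigr => S1 _; rewrite scaler_sumr -big_split /=; apply: eq_bigr => S2 _.
by rewrite -at_set_lin -bracket_ofZl -bracket_ofDl.
Qed.

Lemma fam_brC c (u v : fam c) : fam_br u v = - fam_br v u.
Proof.
apply: fam_ext => S; rewrite -[RHS]/(- fam_br v u S) /fam_br exchange_big -sumrN /=.
apply: eq_bigr => S2 _; rewrite -sumrN; apply: eq_bigr => S1 _.
rewrite bracket_ofC at_setN at_set_act; congr (- at_set _ _ _).
by apply: funext; iso_eq.
Qed.

Lemma fam_br_labelled c A B (l : 'I_(width A) -> I) (m : 'I_(width B) -> I)
  (x : oper Q A c 0) (y : oper Q B c 0) :
  fam_br (labelled l x) (labelled m y) = labelled (join l m : 'I_(width (A |+| B)) -> I)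
    (bracket_of x y).
Proof.
apply: fam_ext => S; rewrite /fam_br /labelled.
have [/asboolP h|/asboolP no] := boolP `[< exists S1 (f : iso A (set_arity S1)), fits l f
  >]; last first.
  rewrite big1 => [|S1 _]; last first.
    rewrite big1 // => S2 _; rewrite (at_set0 (l := l)); last by move=> h; apply: no;
      exists S1.
    by rewrite -(scale0r (0 : oper Q (set_arity S1) c 0)) bracket_ofZl scale0r at_set_zero.
  rewrite at_set0 // => -[f fl]; apply: no.
  have li : injective l.
    move=> i j e; apply: (@lshift_inj _ (width B)); apply: (fits_inj fl).
    by rewrite !joinL.
  have lt i : tau (l i) = A i.
    by have := fits_tint fl (lshift _ i); rewrite /= !joinL.
  by have [g gl] := fits_ex li lt; exists [set l i | i : 'I_(width A)], g.
have [/asboolP h'|/asboolP no] := boolP `[< exists S1 (f : iso B (set_arity S1)), fits m f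
  >]; last first.
  rewrite big1 => [|S1 _]; last first.
    rewrite big1 // => S2 _; rewrite (at_set0 (l := m)); last by move=> k; apply: no;
      exists S2.
    by rewrite -(scale0r (0 : oper Q (set_arity S2) c 0)) bracket_ofZr scale0r at_set_zero.
  rewrite at_set0 // => -[f fl]; apply: no.
  have li : injective m.
    move=> i j e; apply: (@rshift_inj (width A)); apply: (fits_inj fl).
    by rewrite !joinR.
  have lt i : tau (m i) = B i.
    by have := fits_tint fl (rshift _ i); rewrite /= !joinR.
  by have [g gl] := fits_ex li lt; exists [set m i | i : 'I_(width B)], g.
have [S1 [f fl]] := h; have [S2 [g gl]] := h'.
rewrite (bigD1 S1) //= [X in _ + X]big1 ?addr0 => [|T TS]; last first.
  rewrite big1 // => S3 _; rewrite (at_set0 (l := l)).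
    by rewrite -(scale0r (0 : oper Q (set_arity T) c 0)) bracket_ofZl scale0r at_set_zero.
  move=> -[k kl]; case/eqP: TS.
  by rewrite (fits_set kl) (fits_set fl).
rewrite (bigD1 S2) //= [X in _ + X]big1 ?addr0 => [|T TS]; last first.
  rewrite (at_set0 (l := m)).
    by rewrite -(scale0r (0 : oper Q (set_arity T) c 0)) bracket_ofZr scale0r at_set_zero.
  move=> -[k kl]; case/eqP: TS.
  by rewrite (fits_set kl) (fits_set gl).
rewrite (at_setE _ fl) (at_setE _ gl) bracket_of_act at_set_act.
rewrite (_ : _ \o isum f g = (join l m : 'I_(width (A |+| B)) -> I)) //.
by apply: funext; elim/join_ind => i; rewrite /= !(joinL, joinR) ?fl ?gl.
Qed.

Lemma fam_brDl c (u v w : fam c) : fam_br (u + v) w = fam_br u w + fam_br v w.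
Proof. by have := fam_brPl 1 u v w; rewrite !scale1r. Qed.
Lemma fam_br0l c (u : fam c) : fam_br 0 u = 0.
Proof. by apply: (lin0 (f := fun x => fam_br x u)) => *; exact: fam_brPl. Qed.
Lemma fam_brDr c (u v w : fam c) : fam_br u (v + w) = fam_br u v + fam_br u w.
Proof. by rewrite 3!(fam_brC u) fam_brDl opprD. Qed.
Lemma fam_br0r c (u : fam c) : fam_br u 0 = 0.
Proof. by rewrite fam_brC fam_br0l oppr0. Qed.

Lemma fam_jacobi c (u v w : fam c) :
  fam_br (fam_br u v) w + (fam_br (fam_br v w) u + fam_br (fam_br w u) v) = 0.
Proof.
have addJ (a b a' b' a'' b'' : fam c) : a + (a' + a'') = 0 -> b + (b' + b'') = 0 ->
    (a + b) + ((a' + b') + (a'' + b'')) = 0.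
  by move=> ha hb; rewrite (addrACA a') (addrACA a) ha hb addr0.
elim/fam_ind: u => [|u u' hu hu'|A l x].
- by rewrite !(fam_br0l, fam_br0r) !addr0.
- by rewrite !(fam_brDl, fam_brDr); exact: addJ.
elim/fam_ind: v => [|u u' hu hu'|B m y].
- by rewrite !(fam_br0l, fam_br0r) !addr0.
- by rewrite !(fam_brDl, fam_brDr); exact: addJ.
elim/fam_ind: w => [|u u' hu hu'|C n z].
- by rewrite !(fam_br0l, fam_br0r) !addr0.
- by rewrite !(fam_brDl, fam_brDr); exact: addJ.
rewrite !fam_br_labelled.
have := congr1 (@labelled ((A |+| B) |+| C) (join (join l m) n) c)
  (bracket_of_jacobi x y z).
rewrite labelled0 !labelledD !labelled_act => <-.
by congr (_ + (_ + _)); apply: labelled_ext; iso_eq.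
Qed.

Definition fam_ph (u : fam straight) : fam wavy := fun S => phi_of (u S).

Lemma fam_phP t (u v : fam straight) : fam_ph (t *: u + v) = t *: fam_ph u + fam_ph v.
Proof.
by apply: fam_ext => S; rewrite -[RHS]/(t *: phi_of (u S) + phi_of (v S)) -phi_ofZ -phi_ofD.
Qed.
Lemma fam_ph0 : fam_ph 0 = 0. Proof. exact: lin0 fam_phP. Qed.
Lemma fam_phD (u v : fam straight) : fam_ph (u + v) = fam_ph u + fam_ph v.
Proof. by have := fam_phP 1 u v; rewrite !scale1r. Qed.

Lemma fam_ph_labelled A (l : 'I_(width A) -> I) (x : oper Q A straight 0) :
  fam_ph (labelled l x) = labelled l (phi_of x).
Proof.
apply: fam_ext => S; rewrite /fam_ph /labelled.
have [[f fl]|no] := pselect (exists f : iso A (set_arity S), fits l f).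
  by rewrite !(at_setE _ fl) phi_of_act.
by rewrite !at_set0 // -(scale0r (0 : oper Q (set_arity S) straight 0)) phi_ofZ !scale0r.
Qed.

Lemma fam_ph_br (u v : fam straight) : fam_ph (fam_br u v) = fam_br (fam_ph u) (fam_ph v).
Proof.
elim/fam_ind: u => [|u u' hu hu'|A l x]; rewrite ?(fam_br0l, fam_ph0) ?(fam_brDl, fam_phD)
  ?hu ?hu' //.
elim/fam_ind: v => [|u u' hu hu'|B m y]; rewrite ?(fam_br0r, fam_ph0) ?(fam_brDr, fam_phD)
  ?hu ?hu' //.
by rewrite fam_br_labelled !fam_ph_labelled fam_br_labelled phi_of_bracket_of.
Qed.

Definition labelled_carrier : lmodType K := (fam straight * fam wavy)%type.
Definition labelled_pr c (u : labelled_carrier) : labelled_carrier :=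
  match c with straight => (u.1, 0) | wavy => (0, u.2) end.
Definition labelled_br (u v : labelled_carrier) : labelled_carrier :=
  (fam_br u.1 v.1, fam_br u.2 v.2).
Definition labelled_ph (u : labelled_carrier) : labelled_carrier := (0, fam_ph u.1).

Definition labelled_lie_pair : lie_pair K.
Proof.
exists labelled_carrier labelled_pr labelled_br labelled_ph.
- by case=> t x y; rewrite /labelled_pr; congr (_, _); rewrite /= ?scaler0 ?addr0.
- by move=> t x y z; congr (_, _); exact: fam_brPl.
- by move=> t x y; congr (_, _); rewrite /= ?scaler0 ?addr0 //; exact: fam_phP.
- by case=> -[].
- by move=> x y; congr (_, _); exact: fam_brC.
- by move=> x y z; congr (_, _); exact: fam_jacobi.
- by case=> -[x1 x2] [y1 y2]; congr (_, _); rewrite /= ?fam_br0l.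
- by [].
- by [].
- by move=> [x1 x2] [y1 y2]; rewrite /labelled_ph /labelled_br /= fam_br0l fam_ph_br.
Defined.

Definition fam_embed o : fam o -> labelled_lie_pair :=
  match o with straight => fun u => (u, 0) | wavy => fun u => (0, u) end.

(** The generators of this Lie pair: unit operations whose input is named [i]. *)
Definition label i : labelled_lie_pair := fam_embed (labelled (fun=> i) (unit Q (tau i))).

Lemma fam_embed_lin o t (u v : fam o) :
  fam_embed (t *: u + v) = t *: fam_embed u + fam_embed v.
Proof. by case: o u v => u v; congr (_, _); rewrite /= ?scaler0 ?addr0. Qed.

Lemma fam_embed_br o (u v : fam o) :
  br (fam_embed u) (fam_embed v) = fam_embed (fam_br u v).
Proof. by case: o u v => u v; congr (_, _); rewrite /= fam_br0l. Qed.

(** In this Lie pair an operation evaluated at generators is itself, with its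
    inputs named by the labels of the generators. *)
Lemma eval_label A o (x : oper Q A o 0) (l : 'I_(width A) -> I) :
  (forall i, tau (l i) = A i) ->
  eval labelled_lie_pair x (label \o l) = fam_embed (labelled l x).
Proof.
elim: (expressibleP x) l => {A o x}.
- move=> c l lt; rewrite eval_unit.
  have -> : l = fun=> l ord0 by apply: funext => i; rewrite (ord1 i).
  have := lt ord0; rewrite /label /=; set i := l _; move=> ec.
  by clearbody i; subst c; rewrite /fam_embed; case: (tau i).
- move=> A B o f x _ IH l lt; rewrite eval_act labelled_act -IH // => i /=.
  by rewrite lt relab_tint.
- move=> A o l lt; rewrite eval0 labelled0.
  by case: o.
- by move=> A o t x y _ IHx _ IHy l lt; rewrite evalD evalZ labelled_lin fam_embed_lin
  IHx // IHy.
- move=> c A B x y _ IHx _ IHy l lt; rewrite eval_opbr.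
  rewrite (IHx (l \o lshift _)); last by move=> i; rewrite /= lt /= joinL.
  rewrite (IHy (l \o @rshift _ _)); last by move=> i; rewrite /= lt /= joinR.
  rewrite fam_embed_br fam_br_labelled; congr fam_embed; apply: labelled_ext.
  by iso_eq.
- by move=> A x _ IH l lt; rewrite eval_opphi IH // -fam_ph_labelled.
Qed.

End Labelled.

(** The operation is recovered from its value at the generators of the labelled
    Lie pair, with its own inputs as labels. *)
Lemma LP_complete (K : fieldType) A o (x : oper (LP K) A o 0) :
  (forall (L : lie_pair K) v, eval L x v = 0) -> x = 0.
Proof.
move=> h; have := @eval_label K 'I_(width A) A A o x id (fun=> erefl).
rewrite h => /esym e.
have {}e : @labelled K 'I_(width A) A A id o x = 0 by case: o x h e => x h [].
have [f fl] := @fits_ex 'I_(width A) A A id (fun i j e => e) (fun=> erefl).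
have := congr1 (fun u => u [set id i | i : 'I_(width A)]) e.
rewrite /labelled (at_setE _ fl) => /(congr1 (act (iinv f))).
by rewrite actK => ->; rewrite act0.
Qed.

(** * Polarisation *)

Section Polarisation.
Variables (K : fieldType) (L : lie_pair K).

Lemma updD n (F : ('I_n -> L) -> L) : multilinear F -> forall v i x y,
  F (upd v i (x + y)) = F (upd v i x) + F (upd v i y).
Proof. by move=> Fm v i x y; have := Fm v i 1 x y; rewrite !scale1r. Qed.

Lemma upd0 n (F : ('I_n -> L) -> L) : multilinear F -> forall v i,
  F (upd v i 0) = 0.
Proof. by move=> Fm v i; apply: (lin0 (f := fun x => F (upd v i x))) => *; exact: Fm. Qed.

Lemma upd_sum n (F : ('I_n -> L) -> L) : multilinear F ->
  forall v i J (r : seq J) (P : pred J) (G : J -> L),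
  F (upd v i (\sum_(j <- r | P j) G j)) = \sum_(j <- r | P j) F (upd v i (G j)).
Proof.
move=> Fm v i J r P G; elim/big_rec2: _ => [|j x y _ <-]; first exact: upd0.
exact: updD.
Qed.

Lemma multilinear_join m n (F : ('I_(m + n) -> L) -> L) x : multilinear F ->
  multilinear (fun v => F (join x v)).
Proof.
move=> Fm v i t y z.
have e u : join x (upd v i u) = upd (join x v) (rshift m i) u.
  apply: funext; elim/join_ind => j; rewrite /upd ?(joinL, joinR) /=.
    by rewrite eq_lrshift.
  by rewrite !eq_rshift.
by rewrite !e Fm.
Qed.

Lemma multilinear_expand (T : finType) (P : pred T) n (F : ('I_n -> L) -> L)
    (w : 'I_n -> T -> L) : multilinear F ->
  F (fun j => \sum_(i | P i) w j i)
  = \sum_(g : {ffun 'I_n -> T} | [forall j, P (g j)]) F (fun j => w j (g j)).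
Proof.
elim: n F w => [|n IH] F w Fm.
  rewrite (big_pred1 [ffun j => match empty_ord erefl j with end]); last first.
    move=> g; rewrite (_ : [forall j, _] = true); last by apply/forallP => -[].
    by apply/esym/eqP/ffunP => -[].
  by congr F; apply: funext => -[].
pose glue (p : T * {ffun 'I_n -> T}) : {ffun 'I_(1 + n) -> T} :=
  [ffun j => join (fun=> p.1) p.2 j].
pose cut (g : {ffun 'I_(1 + n) -> T}) : T * {ffun 'I_n -> T} :=
  (g (lshift n (ord0 : 'I_1)), [ffun j => g (rshift 1 j)]).
have glueK : cancel glue cut.
  move=> [i g]; congr (_, _); first by rewrite ffunE joinL.
  by apply/ffunP => j; rewrite !ffunE joinR.
have cutK : cancel cut glue.
  move=> g; apply/ffunP => j; rewrite ffunE; elim/(@join_ind 1 n): j => j.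
    by rewrite joinL /= (ord1 j).
  by rewrite joinR ffunE.
rewrite [RHS](reindex glue) /=; last by apply: onW_bij; exists cut.
rewrite (eq_bigl (fun p : T * {ffun 'I_n -> T} => P p.1 && [forall j, P (p.2 j)]));
  last first.
  move=> [i g] /=; apply/forallP/andP => [h|[Pi /forallP Pg]].
    split; first by have := h (lshift n (ord0 : 'I_1)); rewrite ffunE joinL.
    by apply/forallP => j; have := h (rshift 1 j); rewrite ffunE joinR.
  by elim/(@join_ind 1 n) => j; rewrite ffunE ?(joinL, joinR).
rewrite -(pair_big P (fun g : {ffun 'I_n -> T} => [forall j, P (g j)])
   (fun i g => F (fun j => w j (glue (i, g) j)))) /=.
pose w0 : 'I_n -> L := fun j => \sum_(i | P i) w (rshift 1 j) i.
have -> : (fun j => \sum_(i | P i) w j i) =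
    @join 1 n _ (fun=> \sum_(i | P i) w (lshift n (ord0 : 'I_1)) i) w0.
  apply: funext; elim/(@join_ind 1 n) => j; rewrite ?(joinL, joinR) //.
  by rewrite (ord1 j).
rewrite join_upd upd_sum //; apply: eq_bigr => i _.
rewrite -join_upd (IH (fun v => F (@join 1 n _ (fun=> w (lshift n (ord0 : 'I_1)) i) v)));
  last first.
  exact: (multilinear_join (m := 1)).
apply: eq_bigr => g _; congr F; apply: funext; elim/(@join_ind 1 n) => j.
  by rewrite !joinL ffunE joinL (ord1 j).
by rewrite !joinR ffunE joinR.
Qed.

(** Expand $\prod_i(1+f_i)$ with $f_i=0$ on [T] and $f_i=-1$ elsewhere. *)
Lemma sum_signs n (T : {set 'I_n}) :
  \sum_(S : {set 'I_n} | T \subset S) (-1) ^+ #|~: S| = (T == setT)%:R :> K.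
Proof.
pose f (i : 'I_n) : K := if i \in T then 0 else -1.
have : \prod_(i < n) (1 + f i) = \sum_(J : {set 'I_n}) \prod_i (if i \in J then 1 else f i).
  by rewrite bigA_distr; apply: eq_bigl => J; rewrite inE.
rewrite /f.
have -> : \prod_(i < n) (1 + (if i \in T then 0 else -1 : K)) = (T == setT)%:R.
  case: eqP => [->|/eqP nT]; first by rewrite big1 // => i _; rewrite inE addr0.
  have [i iT] : exists i, i \notin T.
    by apply/existsP; apply: contraR nT; rewrite negb_exists => /forallP h;
      apply/eqP/setP => i; rewrite inE; have := h i; rewrite negbK.
  by rewrite (bigD1 i) //= (negPf iT) subrr mul0r.
move=> ->; rewrite [LHS]big_mkcond /=; apply: eq_bigr => S _.
case: (boolP (T \subset S)) => [TS|/subsetPn [i iT iS]]; last first.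
  by rewrite (bigD1 i) //= (negPf iS) iT mul0r.
rewrite (bigID (mem S)) /= big1 ?mul1r => [|i ->] //.
rewrite (eq_bigr (fun=> -1 : K)) => [|i iS]; last first.
  by rewrite (negPf iS); case: ifP => // iT; rewrite (subsetP TS) in iS.
rewrite (eq_bigl (mem (~: S))) => [|i]; last by rewrite /= inE.
by rewrite prodr_const.
Qed.

(** Inclusion-exclusion: in $\sum_S(-1)^{|S^c|}F(\sum_{i\in S}v_i,\dots,\sum_{i\in S}v_i)$
    only the surjective index functions survive, and those are the permutations. *)
Lemma polarisation n (F : ('I_n -> L) -> L) : multilinear F ->
  (forall X, F (fun=> X) = 0) ->
  forall v, \sum_(s : 'S_n) F (v \o s) = 0.
Proof.
move=> Fm F0 v.
have : \sum_(S : {set 'I_n}) (-1) ^+ #|~: S| *: F (fun=> \sum_(i in S) v i) = 0.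
  by rewrite big1 // => S _; rewrite F0 scaler0.
under eq_bigr => S _.
  rewrite (multilinear_expand (mem S) (fun=> v)) // big_mkcond scaler_sumr /=.
  over.
rewrite exchange_big /=.
under eq_bigr => g _.
  under eq_bigr => S _.
    rewrite (_ : [forall j, g j \in S] = ([set g j | j : 'I_n] \subset S)); last first.
      apply/forallP/subsetP => [h i /imsetP [j _ ->] //|h j].
      exact/h/imset_f.
    rewrite (_ : _ *: _ = (if [set g j | j : 'I_n] \subset S then (-1) ^+ #|~: S| else 0)
       *: F (fun j => v (g j))); last by case: ifP; rewrite ?scaler0 ?scale0r.
    over.
  rewrite -scaler_suml -big_mkcond sum_signs.
  over.
(* Index functions that are not injective miss a value, so their signs cancel. *)
move=> e; rewrite -[RHS]e (bigID (fun g : {ffun 'I_n -> 'I_n} => injectiveb g)) /=.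
rewrite [X in _ = _ + X]big1 ?addr0 => [|g gi]; last first.
  case: eqP => [gT|]; last by rewrite scale0r.
  have /imset_injP gI : #|[set g j | j : 'I_n]| == #|'I_n| by rewrite gT cardsT.
  by case/negP: gi; apply/injectiveP => i j; exact: gI.
rewrite [RHS](reindex (@pval _)) /=; last first.
  exists (insubd (1%g : 'S_n)) => /= g gi; first by apply: val_inj; exact: insubdK.
  by rewrite insubdK.
apply: eq_big => [s|s _]; first by rewrite (valP s).
rewrite (_ : [set _ | _ in _] == setT) ?scale1r.
  by congr F; apply: funext => j; rewrite pvalE.
rewrite eqEcard subsetT cardsT card_imset ?card_ord ?leqnn // => i j.
by rewrite !pvalE; exact: perm_inj.
Qed.

End Polarisation.

(** * An identity between Bernoulli numbers *)

Section Series.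
Variables (R : idomainType) (N : nat).
Implicit Types p q r : {poly R}.

(** Equality modulo $t^N$: power series are handled through their truncations. *)
Definition eq_mod_Xn p q := exists r, p = q + 'X^N * r.

Lemma eq_mod_XnP p q : (forall i, (i < N)%N -> p`_i = q`_i) -> eq_mod_Xn p q.
Proof.
move=> h; exists (drop_poly N (p - q)); rewrite mulrC.
have -> : drop_poly N (p - q) * 'X^N = p - q.
  rewrite -[RHS](poly_take_drop N) (_ : take_poly N (p - q) = 0) ?add0r //.
  apply/polyP => i; rewrite coef_take_poly coef0 coefB; case: ltnP => // iN.
  by rewrite h ?subrr.
by rewrite addrC subrK.
Qed.

(** A series with nonzero constant term is not a zero divisor, also after
    truncation. *)
Lemma series_cancel p q : q`_0 != 0 ->
  (forall i, (i < N)%N -> (q * p)`_i = 0) -> forall i, (i < N)%N -> p`_i = 0.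
Proof.
move=> q0 h; elim/ltn_ind => i IH iN.
have := h i iN; rewrite coefM big_ord_recl subn0 big1 ?addr0.
  by move/eqP; rewrite mulf_eq0 (negPf q0) => /eqP.
move=> j _; rewrite IH ?mulr0 //= /bump; first by have := ltn_ord j; lia.
by have := ltn_ord j; lia.
Qed.

End Series.

(** The functional equation of $b(z)=z/(e^z-1)$ in abstract form: [bu], [eu]
    stand for $b(ut)$, $e^{ut}-1$, likewise for $v$ and $w=u+v$, [X] for the
    variable $t$ and [XN] for $t^N$, and the error terms of the truncations are
    carried along explicitly.  Multiplication by $(e^{ut}-1)(e^{vt}-1)$ cancels the
    denominators. *)
Lemma todd_identity_mod (R : comRingType) (X XN U V bu bv bw eu ev ew ru rv rw rd : R) :
  bu * eu = U * X + XN * ru -> bv * ev = V * X + XN * rv ->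
  bw * ew = (U + V) * X + XN * rw -> ew = eu + ev + eu * ev + XN * rd ->
  eu * ev * (U * X * bv * (bw - bu) + V * X * bu * (bw - bv) + U * V * X ^+ 2 * bw)
  = XN * (U * X * rv * (eu * bw - U * X - XN * ru) - U * V * X ^+ 2 * ru
        + V * X * ru * (ev * bw - V * X - XN * rv) - U * V * X ^+ 2 * rv
        + U * V * X ^+ 2 * (rw - rd * bw)).
Proof.
move=> hu hv hw hd.
have h : eu * ev * bw = (U + V) * X + XN * (rw - rd * bw) - eu * bw - ev * bw.
  have -> : (U + V) * X = bw * ew - XN * rw by rewrite hw addrK.
  by rewrite hd; ring.
transitivity (U * X * (bv * ev) * (eu * bw - bu * eu)
   + V * X * (bu * eu) * (ev * bw - bv * ev) + U * V * X ^+ 2 * (eu * ev * bw)).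
  by ring.
by rewrite hu hv h; ring.
Qed.

Section Bernoulli.
Variables (K : fieldType) (charK : [pchar K] =i pred0).
Variable b : nat -> K.
(** Coefficients of $e^z-1$. *)
Definition expm1_coef j : K := if j == 0%N then 0 else j`!%:R^-1.
Hypothesis hb : forall n, \sum_(k < n.+1) b k * expm1_coef (n - k)%N = (n == 1%N)%:R.
Variables (R : idomainType) (c : {rmorphism K -> R}).

Lemma fact_unit n : n`!%:R != 0 :> K.
Proof. by rewrite ((pcharf0P K).1 charK) -lt0n fact_gt0. Qed.

Section Trunc.
Variable N : nat.
(** $b(at)$ modulo $t^N$. *)
Definition todd_poly a : {poly R} := \poly_(k < N) (c (b k) * a ^+ k).
(** $e^{at}-1$ modulo $t^N$. *)
Definition expm1_poly a : {poly R} := \poly_(k < N) (c (expm1_coef k) * a ^+ k).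

Lemma todd_polyP a : eq_mod_Xn N (todd_poly a * expm1_poly a) (a *: 'X).
Proof.
apply: eq_mod_XnP => i iN; rewrite coefM coefZ coefX.
rewrite (eq_bigr (fun j : 'I_i.+1 => c (b j * expm1_coef (i - j)%N) * a ^+ i)) => [|j _].
  rewrite -mulr_suml -rmorph_sum hb /=; case: eqP => [->|_].
    by rewrite rmorph1 mul1r mulr1.
  by rewrite rmorph0 mul0r mulr0.
have ji : (j <= i)%N by rewrite -ltnS.
rewrite !coef_poly (leq_ltn_trans ji iN) (leq_ltn_trans (leq_subr j i) iN).
by rewrite mulrACA -exprD rmorphM subnKC.
Qed.

Lemma expm1_polyD u v :
  eq_mod_Xn N (expm1_poly (u + v))
    (expm1_poly u + expm1_poly v + expm1_poly u * expm1_poly v).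
Proof.
have e1 a : (0 < N)%N -> 1 + expm1_poly a = \poly_(k < N) (c k`!%:R^-1 * a ^+ k).
  move=> N0; apply/polyP => i; rewrite coefD coef1 !coef_poly /expm1_coef.
  by case: i => [|i]; rewrite ?N0 ?rmorph0 ?mul0r ?addr0 ?invr1 ?rmorph1 ?mul1r ?add0r.
apply: eq_mod_XnP => i iN; have N0 : (0 < N)%N by exact: leq_ltn_trans iN.
suff : (1 + expm1_poly (u + v))`_i = ((1 + expm1_poly u) * (1 + expm1_poly v))`_i.
  have -> : (1 + expm1_poly u) * (1 + expm1_poly v) = 1 + (expm1_poly u + expm1_poly v
    + expm1_poly u * expm1_poly v) by ring.
  by rewrite !(coefD 1) => /addrI.
rewrite !e1 // coefM coef_poly iN [u + v]addrC exprDn mulr_sumr.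
apply: eq_bigr => j _; have ji : (j <= i)%N by rewrite -ltnS.
rewrite !coef_poly (leq_ltn_trans ji iN) (leq_ltn_trans (leq_subr j i) iN).
have key : i`!%:R^-1 * 'C(i, j)%:R = j`!%:R^-1 * (i - j)`!%:R^-1 :> K.
  apply: (mulfI (fact_unit i)); rewrite mulrA divff ?fact_unit // mul1r.
  rewrite -(bin_fact ji) !natrM.
  by field; rewrite !fact_unit.
rewrite -[_ *+ 'C(i, j)]mulr_natl -(rmorph_nat c) !mulrA -rmorphM key rmorphM; ring.
Qed.

End Trunc.

(** The coefficient of $t^{n+2}$ in
    $ut\,b(vt)(b(wt)-b(ut))+vt\,b(ut)(b(wt)-b(vt))+uv\,t^2b(wt)=0$, divided by
    $uv$: the quotients $(w^{k+1}-u^{k+1})/(w-u)$ with $w-u=v$ produce the sums over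
    $j$. *)
Lemma bernoulli_identity u v n : u != 0 -> v != 0 ->
  c (b n) * (u + v) ^+ n + \sum_(k < n.+1) c (b k.+1 * b (n - k)%N) *
    \sum_(j < k.+1) (u + v) ^+ (k - j) * (u ^+ j * v ^+ (n - k) + u ^+ (n - k) * v ^+ j)
  = 0.
Proof.
move=> u0 v0; pose N := n.+3.+2; set w := u + v.
pose Z : {poly R} := u *: 'X * todd_poly N v * (todd_poly N w - todd_poly N u)
   + v *: 'X * todd_poly N u * (todd_poly N w - todd_poly N v) + (u * v) *: 'X^2 *
     todd_poly N w.
have Z0 i : (i < n.+3)%N -> Z`_i = 0.
  have [ru eu] := todd_polyP N u; have [rv ev] := todd_polyP N v.
  have [rw ew] := todd_polyP N w; have [rd ed] := expm1_polyD N u v.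
  pose eta a : {poly R} := \poly_(k < N.-1) (c (expm1_coef k.+1) * a ^+ k.+1).
  have etaE a : expm1_poly N a = 'X * eta a.
    apply/polyP => -[|k]; rewrite coefXM !coef_poly //=.
    by rewrite /expm1_coef /= rmorph0 mul0r.
  have eta0 a : a != 0 -> (eta a)`_0 != 0.
    by rewrite coef_poly /expm1_coef (_ : 1`!%:R = 1 :> K) // invr1 rmorph1 mul1r expr1.
  have [r er] : exists r, expm1_poly N u * expm1_poly N v * Z = 'X^N * r.
    move: eu ev ew; rewrite -!mul_polyC polyCD => eu ev ew.
    eexists; rewrite /Z -!mul_polyC polyCM.
    exact: (todd_identity_mod eu ev ew ed).
  apply: (@series_cancel _ n.+3 _ (eta v)); first exact: eta0.
  apply: (@series_cancel _ n.+3 _ (eta u)); first exact: eta0.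
  (* One factor X is lost to each of the two series without constant term, so
     two of the n + 5 known coefficients are given up. *)
  have -> : eta u * (eta v * Z) = 'X^(n.+3) * r.
    apply: (@mulfI _ 'X^2); first by rewrite -size_poly_eq0 size_polyXn.
    by rewrite [in RHS]mulrA -exprD -er !etaE; ring.
  by move=> j jn; rewrite coefXnM jn.
have diffc a a' j : (j < N)%N ->
    (todd_poly N a - todd_poly N a')`_j = c (b j) * (a ^+ j - a' ^+ j).
  by move=> jN; rewrite coefB !coef_poly jN mulrBr.
have half a a' : (a *: 'X * todd_poly N a' * (todd_poly N w - todd_poly N a))`_(n.+2)
    = a * \sum_(k < n.+1) c (b k.+1 * b (n - k)%N)
        * ((w ^+ k.+1 - a ^+ k.+1) * a' ^+ (n - k)).
  rewrite -!scalerAl coefZ -mulrA coefXM /= coefMr big_ord_recl.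
  rewrite diffc // !expr0 subrr !mulr0 add0r; congr (_ * _); apply: eq_bigr => k _.
  have kn : (k <= n)%N by rewrite -ltnS.
  rewrite /= /bump leq0n add1n diffc; last by rewrite /N; lia.
  rewrite subSS coef_poly (_ : (n - k < N)%N); last by rewrite /N; lia.
  by rewrite rmorphM; ring.
have : Z`_(n.+2) = 0 by exact: Z0.
rewrite !coefD !half -scalerAl coefZ coefXnM /= subn2 /= coef_poly (_ : (n < N)%N);
  last by rewrite /N; lia.
move=> e; apply: (mulfI (mulf_neq0 u0 v0)); rewrite mulr0 -[RHS]e.
rewrite mulrDr [RHS]addrC !mulr_sumr -big_split /=; congr (_ + _).
apply: eq_bigr => k _; rewrite !subrXX /=.
have -> : w - u = v by rewrite /w addrC addKr.
have -> : w - v = u by rewrite /w addrK.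
under eq_bigr => j _ do rewrite mulrDr.
rewrite big_split /=.
set Su := \sum_(i < k.+1) w ^+ (k - i) * u ^+ i.
set Sv := \sum_(i < k.+1) w ^+ (k - i) * v ^+ i.
have -> : \sum_(i < k.+1) w ^+ (k - i) * (u ^+ i * v ^+ (n - k)) = Su * v ^+ (n - k).
  by rewrite mulr_suml; apply: eq_bigr => j _; rewrite mulrA.
have -> : \sum_(i < k.+1) w ^+ (k - i) * (u ^+ (n - k) * v ^+ i) = Sv * u ^+ (n - k).
  by rewrite mulr_suml; apply: eq_bigr => j _; ring.
by ring.
Qed.

End Bernoulli.

Section Lie.
Variables (K : fieldType) (charK : [pchar K] =i pred0) (L : lie_pair K).
Variable b : nat -> K.
Hypothesis hb : forall n, \sum_(k < n.+1) b k * expm1_coef K (n - k)%N = (n == 1%N)%:R.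
Variable H : L.
Definition adr (x : L) := br x H.

Lemma adr_br x y : adr (br x y) = br (adr x) y + br x (adr y).
Proof.
have /eqP := jacobi x y H; rewrite addr_eq0 /adr => /eqP ->.
by rewrite (brC (br y H) x) (brC H x) brNl opprD !opprK addrC.
Qed.

Lemma adrD x y : adr (x + y) = adr x + adr y. Proof. exact: brDl. Qed.

Lemma adr_iterD k x y : iter k adr (x + y) = iter k adr x + iter k adr y.
Proof. by elim: k => //= k ->; rewrite adrD. Qed.

Lemma adr_iterN k x : iter k adr (- x) = - iter k adr x.
Proof. by elim: k => //= k ->; exact: brNl. Qed.

Section AdBracket.
Variables (x y : L) (n : nat).
Let const2 (k : K) : {poly {poly K}} := k%:P%:P.
(** Reads $u^jv^i$ as $[T^jx,T^iy]$ for $i,j\le n$, where $T$ is [adr]; the outer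
    variable of the polynomial is $v$, the inner one $u$. *)
Definition ad_bracket (P : {poly {poly K}}) : L :=
  \sum_(i < n.+1) \sum_(j < n.+1) P`_i`_j *: br (iter j adr x) (iter i adr y).

Lemma ad_bracketD P Q : ad_bracket (P + Q) = ad_bracket P + ad_bracket Q.
Proof.
rewrite -big_split; apply: eq_bigr => i _; rewrite -big_split; apply: eq_bigr => j _.
by rewrite !coefD scalerDl.
Qed.
Lemma ad_bracketZ t P : ad_bracket (const2 t * P) = t *: ad_bracket P.
Proof.
rewrite scaler_sumr; apply: eq_bigr => i _; rewrite scaler_sumr.
by apply: eq_bigr => j _; rewrite !coefCM scalerA.
Qed.
Lemma ad_bracket0 : ad_bracket 0 = 0.
Proof. by rewrite /ad_bracket big1 // => i _; rewrite big1 // => j _; rewrite !coef0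
  scale0r. Qed.
Lemma ad_bracket_sum J (r : seq J) (F : J -> {poly {poly K}}) :
  ad_bracket (\sum_(i <- r) F i) = \sum_(i <- r) ad_bracket (F i).
Proof. by elim/big_rec2: _ => [|i X Y _ <-]; rewrite ?ad_bracket0 ?ad_bracketD. Qed.

Definition varU : {poly {poly K}} := 'X%:P.
Definition varV : {poly {poly K}} := 'X.

Lemma ad_bracket_monomial i j : (i <= n)%N -> (j <= n)%N ->
  ad_bracket (varU ^+ j * varV ^+ i) = br (iter j adr x) (iter i adr y).
Proof.
move=> ni nj; rewrite /ad_bracket /varU /varV -rmorphXn /=.
have ii : (i < n.+1)%N by []. have jj : (j < n.+1)%N by [].
rewrite (bigD1 (Ordinal ii)) //= [X in _ + X]big1 ?addr0 => [|k ki]; last first.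
  rewrite big1 // => l _; rewrite coefCM coefXn.
  by rewrite (negPf (_ : (k : nat) != i)) ?mulr0 ?coef0 ?scale0r.
rewrite (bigD1 (Ordinal jj)) //= [X in _ + X]big1 ?addr0 => [|k ki]; last first.
  rewrite coefCM coefXn eqxx mulr1 coefXn.
  by rewrite (negPf (_ : (k : nat) != j)) ?scale0r.
by rewrite coefCM coefXn eqxx mulr1 coefXn eqxx scale1r.
Qed.

(** Multiplication by $u+v$ corresponds to $T$, by the Leibniz rule [adr_br]. *)
Lemma ad_bracket_derivation a i j : (a + i + j <= n)%N ->
  ad_bracket ((varU + varV) ^+ a * (varU ^+ j * varV ^+ i)) =
  iter a adr (br (iter j adr x) (iter i adr y)).
Proof.
elim: a i j => [|a IH] i j le.
  by rewrite mul1r ad_bracket_monomial //; lia.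
rewrite exprSr -mulrA mulrDl mulrDr ad_bracketD.
rewrite (_ : varU * (varU ^+ j * varV ^+ i) = varU ^+ j.+1 * varV ^+ i); last by rewrite
  mulrA -exprS.
rewrite (_ : varV * (varU ^+ j * varV ^+ i) = varU ^+ j * varV ^+ i.+1); last by rewrite
  mulrCA -exprS.
rewrite !IH; try lia.
by rewrite [RHS]iterSr adr_br adr_iterD.
Qed.

Lemma lie_bernoulli :
  b n *: iter n adr (br x y) + \sum_(k < n.+1) (b k.+1 * b (n - k)%N) *:
    \sum_(j < k.+1) (iter (k - j) adr (br (iter j adr x) (iter (n - k) adr y))
      + iter (k - j) adr (br (iter (n - k) adr x) (iter j adr y))) = 0.
Proof.
have := @bernoulli_identity K charK b hb {poly {poly K}} (polyC \o polyC) varU varV n.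
rewrite /varU /varV polyC_eq0 !polyX_eq0 => /(_ isT isT) /(congr1 ad_bracket).
rewrite ad_bracket0 ad_bracketD => e; rewrite -[RHS]e; congr (_ + _).
  rewrite ad_bracketZ -/varU -/varV; congr (_ *: _).
  by have := @ad_bracket_derivation n 0 0; rewrite !addn0 leqnn !expr0 !mulr1 => ->.
rewrite ad_bracket_sum; apply: eq_bigr => k _; rewrite ad_bracketZ ad_bracket_sum;
  congr (_ *: _).
apply: eq_bigr => j _; have kn := ltn_ord k; have jk := ltn_ord j.
rewrite mulrDr ad_bracketD -/varU -/varV !ad_bracket_derivation //; lia.
Qed.
End AdBracket.
End Lie.

(** * Evaluating the differential of the operations with two straight inputs *)

Lemma split_permE n (J : {set 'I_n}) x0 i :
  split_perm J i = nth x0 (enum J ++ enum (~: J)) i.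
Proof.
rewrite permE; set k := cast_ord _ i; rewrite -[X in nth _ _ X]/(nat_of_ord k).
elim/join_ind: k => j; rewrite /unshuffle_fun ?(joinL, joinR) nth_cat -cardE /=.
  by rewrite ltn_ord; exact: enum_val_nth.
by rewrite ltnNge leq_addr /= addKn; exact: enum_val_nth.
Qed.

Section Differential.
Variables (K : fieldType) (L : lie_pair K) (F : operad_morphism (HS K) (LP K)).
Hypothesis F2 : morph F (ell K 2) = bracket K straight.

Definition ell_val m (w : 'I_m -> L) := eval L (morph F (ell K m)) w.
Definition eff_val m n (w : 'I_(m + n) -> L) := eval L (morph F (eff K m n)) w.

Lemma ell_val2 m (w : 'I_m -> L) (i0 i1 : 'I_m) :
  m = 2%N -> i0 = 0%N :> nat -> i1 = 1%N :> nat ->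
  ell_val w = br (pr straight (w i0)) (pr straight (w i1)).
Proof.
move=> e; subst m => e0 e1; rewrite /ell_val F2.
have -> : i0 = ord2_0 by exact: val_inj.
have -> : i1 = ord2_1 by exact: val_inj.
exact: (@eval_bracket K L straight w).
Qed.

Definition eff1_val n (x : L) (h : 'I_n -> L) := @eff_val 1 n (join (fun=> x) h).

Lemma eff_val1 m n (w : 'I_(m + n) -> L) (i0 : 'I_m) : m = 1%N ->
  eff_val w = eff1_val (w (lshift n i0)) (w \o @rshift m n).
Proof.
move=> e; subst m; congr eff_val; apply: funext; elim/join_ind => j;
  rewrite ?(joinL, joinR) //.
by rewrite (ord1 j) (ord1 i0).
Qed.

Lemma eval_ell_ell m (J : {set 'I_m}) v :
  eval L (morph F (ell_ell K J)) v =
  @ell_val #|~: J|.+1 (@join 1 #|~: J| _ (fun=> @ell_val #|J| (fun i => v (enum_val i)))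
    (fun j => v (enum_val j))).
Proof.
rewrite /ell_ell morph_act eval_act morph_comp eval_comp morph_act eval_act /ell_val.
congr (eval _ _ _); apply: funext; elim/(@join_ind 1) => j; rewrite /= ?(joinL, joinR) /=.
  congr (eval _ _ _); apply: funext => i /=.
  by rewrite /unshuffle_fun joinL.
by rewrite /unshuffle_fun joinR.
Qed.

Lemma eval_eff_ell m (J : {set 'I_m}) n v :
  eval L (morph F (eff_ell K J n)) v =
  @eff_val #|~: J|.+1 n (join
    (@join 1 #|~: J| _ (fun=> @ell_val #|J| (fun i => v (lshift n (enum_val i))))
    (fun j => v (lshift n (enum_val j)))) (fun k => v (rshift m k))).
Proof.
rewrite /eff_ell morph_act eval_act morph_comp eval_comp morph_act eval_act /eff_val
  /ell_val.
congr (eval _ _ _); apply: funext.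
elim/(@join_ind #|~: J|.+1 n) => j.
  elim/(@join_ind 1): j => j; do 6 rewrite /= ?(joinL, joinR).
    congr (eval _ _ _); apply: funext => i; do 6 rewrite /= ?(joinL, joinR).
    by rewrite /unshuffle_fun joinL.
  by rewrite /unshuffle_fun joinR.
by do 6 rewrite /= ?(joinL, joinR).
Qed.

Lemma eval_eff_eff m (J : {set 'I_m}) n (I : {set 'I_n}) v :
  eval L (morph F (eff_eff K J I)) v =
  @eff_val #|J| #|I|.+1 (join (fun i => v (lshift n (enum_val i)))
    (@join 1 #|I| _ (fun=> @eff_val #|~: J| #|~: I|
         (join (fun i => v (lshift n (enum_val i))) (fun i => v (rshift m (enum_val i)))))
      (fun i => v (rshift m (enum_val i))))).
Proof.
rewrite /eff_eff morph_act eval_act morph_comp eval_comp morph_act eval_act /eff_val.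
congr (eval _ _ _); apply: funext.
elim/(@join_ind #|J| #|I|.+1) => j.
  do 8 rewrite /= ?(joinL, joinR).
  by rewrite /unshuffle_fun ?(joinL, joinR).
elim/(@join_ind 1): j => j; do 8 rewrite /= ?(joinL, joinR).
  congr (eval _ _ _); apply: funext; elim/join_ind => i; do 8 rewrite /= ?(joinL, joinR).
    by rewrite /unshuffle_fun ?(joinL, joinR).
  by rewrite /unshuffle_fun ?(joinL, joinR).
by rewrite /unshuffle_fun ?(joinL, joinR).
Qed.

Definition eff1_diag k x H := @eff1_val k x (fun=> H).
Definition eff1_slot k x z H := @eff1_val k.+1 x (@join 1 k _ (fun=> z) (fun=> H)).

Lemma setC_ord2_0 : ~: [set ord2_0] = [set ord2_1].
Proof. by apply/setP => i; rewrite !inE; elim/ord2P: i. Qed.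
Lemma setC_ord2_1 : ~: [set ord2_1] = [set ord2_0].
Proof. by apply/setP => i; rewrite !inE; elim/ord2P: i. Qed.

Lemma enum_valE (T : finType) (A : {set T}) (s : seq T) (i : 'I_#|A|) x0 :
  enum A = s -> enum_val i = nth x0 s i.
Proof. by move=> <-; exact: enum_val_nth. Qed.
Arguments enum_valE {T A s i} x0 _.

Lemma enum_ord2 : enum 'I_2 = [:: ord2_0; ord2_1].
Proof.
by apply: (inj_map val_inj); rewrite val_enum_ord.
Qed.

Lemma enum_setT2 : enum [set: 'I_2] = [:: ord2_0; ord2_1].
Proof. by rewrite enum_setT -enumT enum_ord2. Qed.

Lemma split_perm_setT n : split_perm (setT : {set 'I_n}) = 1%g.
Proof.
apply/permP => i; rewrite (split_permE _ i) perm1 setCT enum_set0 cats0 enum_setT.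
by rewrite -enumT nth_ord_enum.
Qed.

Lemma split_perm_ord2_0 : split_perm [set ord2_0] = 1%g.
Proof.
apply/permP => i; rewrite (split_permE _ i) perm1 setC_ord2_0 !enum_set1.
by elim/ord2P: i.
Qed.

Lemma split_perm_ord2_1 : split_perm [set ord2_1] = tperm ord2_0 ord2_1.
Proof.
apply/permP => i; rewrite (split_permE _ i) setC_ord2_1 !enum_set1.
by elim/ord2P: i; rewrite ?tpermL ?tpermR.
Qed.

Lemma sum_by_card n (G : nat -> L) :
  \sum_(I : {set 'I_n}) G #|I| = \sum_(k < n.+1) G k *+ 'C(n, k).
Proof.
rewrite (partition_big (fun I : {set 'I_n} => inord #|I| : 'I_n.+1) predT) //=.
apply: eq_bigr => k _.
rewrite (eq_bigl (fun I : {set 'I_n} => #|I| == k)); last first.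
  move=> I; rewrite -val_eqE /= inordK // ltnS.
  by rewrite -[X in (_ <= X)%N]card_ord max_card.
rewrite (eq_bigr (fun=> G k)) => [|I /eqP -> //].
rewrite sumr_const; congr (_ *+ _).
have <- : #|[set I : {set 'I_n} | #|I| == k]| = 'C(n, k) by rewrite card_draws card_ord.
by apply: eq_card => I; rewrite !inE.
Qed.

Variables (delta : differential (HS K)) (hdelta : HS_differential delta).

Lemma eval_eff_eff1 n (I : {set 'I_n}) (i j : 'I_2) x y H v :
  ~: [set i] = [set j] -> v (lshift n i) = x -> v (lshift n j) = y ->
  (forall k, v (rshift 2 k) = H) ->
  eval L (morph F (eff_eff K [set i] I)) v = eff1_slot #|I| x (eff1_diag (n - #|I|) y H) H.
Proof.
move=> ij vi vj vH; rewrite eval_eff_eff.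
have c1 : #|[set i]| = 1%N by rewrite cards1.
have c2 : #|~: [set i]| = 1%N by rewrite ij cards1.
have [p1 p2] : (0 < #|[set i]|)%N /\ (0 < #|~: [set i]|)%N by rewrite c1 c2.
have enumC : enum (~: [set i]) = [:: j] by rewrite ij enum_set1.
rewrite (eff_val1 _ (Ordinal p1) c1) (eff_val1 _ (Ordinal p2) c2) !joinL.
rewrite (enum_valE i (enum_set1 i)) (enum_valE j enumC) /= vi vj.
have -> : (n - #|I|)%N = #|~: I| by have := card_setU_C I; lia.
rewrite /eff1_slot /eff1_diag; congr eff1_val; apply: funext; elim/(@join_ind 1) => k;
  rewrite /= joinR ?(joinL, joinR) //.
by congr eff1_val; apply: funext => l; rewrite /= joinR.
Qed.

(** Only the full set contributes to the first sum of the differential and only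
    the two singletons to the second; the singletons differ by a transposition,
    whence the opposite signs.  With all wavy arguments equal to [H] the terms
    depend on $I_1$ through its size. *)
Lemma eval_diff_eff2 n x y H :
  eval L (morph F (diff delta (eff K 2 n)))
    (join (fun i : 'I_2 => if i == ord2_0 then x else y) (fun=> H)) =
  eff1_diag n (br (pr straight x) (pr straight y)) H
  + \sum_(k < n.+1) (eff1_slot k x (eff1_diag (n - k) y H) H
                     - eff1_slot k y (eff1_diag (n - k) x H) H) *+ 'C(n, k).
Proof.
set v := join _ _.
rewrite (hdelta.2 2%N n isT) morphD !morph_sum evalD !eval_sum; congr (_ + _).
  rewrite (big_pred1 setT) => [|J]; last first.
    apply/idP/eqP => [J2|->]; last by rewrite cardsT card_ord.
    by apply/eqP; rewrite eqEcard subsetT cardsT card_ord.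
  rewrite morphZ evalZ split_perm_setT odd_perm1 setCT cards0 scale1r eval_eff_ell.
  have e1 : #|~: [set: 'I_2]|.+1 = 1%N by rewrite setCT cards0.
  have e2 : #|[set: 'I_2]| = 2%N by rewrite cardsT card_ord.
  have [p0 p1] : (0 < #|[set: 'I_2]|)%N /\ (1 < #|[set: 'I_2]|)%N by rewrite e2.
  rewrite (eff_val1 _ (lshift _ (ord0 : 'I_1)) e1) /eff1_diag joinL joinL.
  rewrite (ell_val2 _ (i0 := Ordinal p0) (i1 := Ordinal p1) e2 erefl erefl).
  rewrite !(enum_valE ord2_0 enum_setT2) /= /v !joinL /=.
  by congr eff1_val; apply: funext => k; rewrite /= !joinR.
rewrite -(sum_by_card n (fun k => eff1_slot k x (eff1_diag (n - k) y H) H - eff1_slot k y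
  (eff1_diag (n - k) x H) H)).
have in01 : [set ord2_0] != [set ord2_1] by apply/eqP => /setP /(_ ord2_0); rewrite !inE.
rewrite (bigD1 [set ord2_0]) /=; last by rewrite cards1 setC_ord2_0 cards1.
rewrite (bigD1 [set ord2_1]) /=; last by rewrite cards1 setC_ord2_1 cards1 eq_sym in01.
rewrite [X in _ + (_ + X)]big1 ?addr0; last first.
  move=> J /andP [/andP [/andP [J0 J0'] Ja] Jb]; exfalso.
  case: (boolP (ord2_0 \in J)) => h0; case: (boolP (ord2_1 \in J)) => h1.
  - case/negP: (lt0n_neq0 J0'); rewrite cards_eq0; apply/eqP/setP.
    by elim/ord2P; rewrite !inE ?h0 ?h1.
  - by case/negP: Ja; apply/eqP/setP; elim/ord2P; rewrite inE ?h0 ?(negPf h1).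
  - by case/negP: Jb; apply/eqP/setP; elim/ord2P; rewrite inE ?h1 ?(negPf h0).
  - case/negP: (lt0n_neq0 J0); rewrite cards_eq0; apply/eqP/setP.
    by elim/ord2P; rewrite inE ?(negPf h0) ?(negPf h1).
rewrite !morph_sum !eval_sum -big_split; apply: eq_bigr => I _ /=.
rewrite !morphZ !evalZ split_perm_ord2_0 split_perm_ord2_1 odd_perm1 odd_tperm.
rewrite setC_ord2_0 setC_ord2_1 !cards1 /= -signr_odd scale1r.
rewrite (eval_eff_eff1 I (x := x) (y := y) (H := H) setC_ord2_0); first last.
- by move=> k; rewrite /v joinR.
- by rewrite /v joinL.
- by rewrite /v joinL.
rewrite (eval_eff_eff1 I (x := y) (y := x) (H := H) setC_ord2_1); first last.
- by move=> k; rewrite /v joinR.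
- by rewrite /v joinL.
- by rewrite /v joinL.
by rewrite -signr_odd scaleN1r.
Qed.

End Differential.

(** * Evaluating the differential of the ternary bracket *)

Section Ell3.
Definition ord3_0 : 'I_3 := @Ordinal 3 0 isT.
Definition ord3_1 : 'I_3 := @Ordinal 3 1 isT.
Definition ord3_2 : 'I_3 := @Ordinal 3 2 isT.

Lemma ord3P (P : 'I_3 -> Prop) : P ord3_0 -> P ord3_1 -> P ord3_2 -> forall i, P i.
Proof.
move=> p0 p1 p2 [[|[|[|//]]] lt3].
- by have -> : Ordinal lt3 = ord3_0 by exact: val_inj.
- by have -> : Ordinal lt3 = ord3_1 by exact: val_inj.
- by have -> : Ordinal lt3 = ord3_2 by exact: val_inj.
Qed.

Lemma enum_set_filter (T : finType) (A : {set T}) : enum A = [seq i <- enum T | i \in A].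
Proof. by rewrite enumT. Qed.

Lemma enum_ord3 : enum 'I_3 = [:: ord3_0; ord3_1; ord3_2].
Proof. by apply: (inj_map val_inj); rewrite val_enum_ord. Qed.

Lemma enum_setC_ord3_0 : enum (~: [set ord3_0]) = [:: ord3_1; ord3_2].
Proof. by rewrite enum_set_filter enum_ord3 /= !inE. Qed.
Lemma enum_setC_ord3_1 : enum (~: [set ord3_1]) = [:: ord3_0; ord3_2].
Proof. by rewrite enum_set_filter enum_ord3 /= !inE. Qed.
Lemma enum_setC_ord3_2 : enum (~: [set ord3_2]) = [:: ord3_0; ord3_1].
Proof. by rewrite enum_set_filter enum_ord3 /= !inE. Qed.

Lemma split_perm_setC_ord3_0 : split_perm (~: [set ord3_0]) =
  (tperm ord3_0 ord3_1 * tperm ord3_0 ord3_2)%g.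
Proof.
apply/permP => i; rewrite (split_permE _ i) setCK enum_set1 enum_setC_ord3_0 permM.
by elim/ord3P: i; rewrite !permE.
Qed.
Lemma split_perm_setC_ord3_1 : split_perm (~: [set ord3_1]) = tperm ord3_1 ord3_2.
Proof.
apply/permP => i; rewrite (split_permE _ i) setCK enum_set1 enum_setC_ord3_1.
by elim/ord3P: i; rewrite !permE.
Qed.
Lemma split_perm_setC_ord3_2 : split_perm (~: [set ord3_2]) = 1%g.
Proof.
apply/permP => i; rewrite (split_permE _ i) setCK enum_set1 enum_setC_ord3_2.
by elim/ord3P: i; rewrite !permE.
Qed.

Variables (K : fieldType) (L : lie_pair K) (F : operad_morphism (HS K) (LP K)).
Hypothesis F2 : morph F (ell K 2) = bracket K straight.
Variables (delta : differential (HS K)) (hdelta : HS_differential delta).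

Lemma eval_ell_ell2 (i a b : 'I_3) v : enum (~: [set i]) = [:: a; b] ->
  eval L (morph F (ell_ell K (~: [set i]))) v =
  br (br (pr straight (v a)) (pr straight (v b))) (pr straight (v i)).
Proof.
move=> eC; rewrite eval_ell_ell.
have c1 : #|~: [set i]| = 2%N by rewrite cardE eC.
have c2 : #|~: ~: [set i]|.+1 = 2%N by rewrite setCK cards1.
have p : (0 < #|~: ~: [set i]|)%N by rewrite -ltnS c2.
have [p0 p1] : (0 < #|~: [set i]|)%N /\ (1 < #|~: [set i]|)%N by rewrite c1.
rewrite (ell_val2 F2 _ (i0 := lshift _ (ord0 : 'I_1)) (i1 := rshift 1 (Ordinal p)) c2) //.
rewrite joinL joinR (ell_val2 F2 _ (i0 := Ordinal p0) (i1 := Ordinal p1) c1) //.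
have eCC : enum (~: ~: [set i]) = [:: i] by rewrite setCK enum_set1.
by rewrite !(enum_valE _ a eC) (enum_valE _ i eCC) /= pr_br.
Qed.

(** The three two-element subsets give the three terms of the Jacobi identity,
    the signs of the unshuffles matching the cyclic rotations up to skew symmetry. *)
Lemma eval_diff_ell3 v : eval L (morph F (diff delta (ell K 3))) v = 0.
Proof.
rewrite (hdelta.1 3%N isT) morph_sum eval_sum.
have cC i : #|~: [set i : 'I_3]| = 2%N by rewrite cardsC1 card_ord.
have neq i j : i != j -> ~: [set i : 'I_3] != ~: [set j].
  by apply: contra_neq => /(congr1 (fun S => ~: S)); rewrite !setCK => /set1_inj.
rewrite (bigD1 (~: [set ord3_0])) /=; last by rewrite setCK cards1 cC.
rewrite (bigD1 (~: [set ord3_1])) /=; last by rewrite setCK cards1 cC neq.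
rewrite (bigD1 (~: [set ord3_2])) /=; last by rewrite setCK cards1 cC !neq.
rewrite big1 ?addr0; last first.
  move=> J /andP [/andP [/andP [/andP [J2 J1] n0] n1] n2]; exfalso.
  have /eqP/cards1P [i Ji] : #|~: J| = 1%N by move: J2 J1; have := cardsC J;
    rewrite card_ord; case: #|J| => [|[|[|[|?]]]]; case: #|~: J| => [|[|?]].
  have {}Ji : J = ~: [set i] by rewrite -Ji setCK.
  by move: n0 n1 n2; rewrite Ji; elim/ord3P: i {Ji}; rewrite eqxx.
rewrite !morphZ !evalZ (eval_ell_ell2 _ enum_setC_ord3_0)
  (eval_ell_ell2 _ enum_setC_ord3_1) (eval_ell_ell2 _ enum_setC_ord3_2).
rewrite !setCK !cards1 split_perm_setC_ord3_0 split_perm_setC_ord3_1 split_perm_setC_ord3_2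
  odd_permM !odd_tperm odd_perm1 /=.
rewrite !exprD expr0 expr1 !mulr1 mulN1r opprK !mul1r scale1r scaleN1r.
set x := pr _ (v ord3_0); set y := pr _ (v ord3_1); set z := pr _ (v ord3_2).
have := jacobi x y z; rewrite (brC z x) brNl => <-.
by rewrite scale1r addrA addrC.
Qed.
End Ell3.

(** * The morphism defined by the Bernoulli numbers *)

Section Sym.
Variables (K : fieldType) (charK : [pchar K] =i pred0) (L : lie_pair K).

Lemma polarisation_sym n (F : ('I_n -> L) -> L) : multilinear F ->
  (forall s : 'S_n, forall v, F (v \o s) = F v) ->
  (forall X, F (fun=> X) = 0) -> forall v, F v = 0.
Proof.
move=> Fm Fs F0 v; have := polarisation Fm F0 v.
under eq_bigr => s _ do rewrite Fs.
rewrite sumr_const card_Sn -scaler_nat => /eqP; rewrite scaler_eq0.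
by rewrite (negPf (fact_unit charK n)) => /eqP.
Qed.

Lemma eff_perm k n (t : 'S_n) :
  act (isum (iid _) (iperm wavy t)) (eff K k.+1 n) = eff K k.+1 n.
Proof.
have := pgen_model (@eff_sym K k n 1%g t).
rewrite -[interp _ (TAct _ _)]/(act (isum (iperm straight 1%g) (iperm wavy t))
  (eff K k.+1 n)).
rewrite -[interp _ (TScale _ _)]/((-1) ^+ odd_perm 1%g *: eff K k.+1 n).
rewrite odd_perm1 scale1r => e; rewrite -[RHS]e; apply: act_ext.
by iso_eq; rewrite perm1.
Qed.

Variables (delta : differential (HS K)) (F : operad_morphism (HS K) (LP K)).

Lemma join_perm m n (a : 'I_m -> L) (h : 'I_n -> L) (t : 'S_n) :
  join a (h \o t) = join a h \o isum (iid (mono straight m)) (iperm wavy t).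
Proof. by apply: funext; elim/join_ind => i; rewrite /= ?(joinL, joinR) /=
  ?(joinL, joinR). Qed.

Lemma eval_eff_perm k n (t : 'S_n) (a : 'I_k.+1 -> L) h :
  eval L (morph F (eff K k.+1 n)) (join a (h \o t)) =
  eval L (morph F (eff K k.+1 n)) (join a h).
Proof. by rewrite join_perm -eval_act -morph_act eff_perm. Qed.

Lemma eval_diff_eff_perm k n (t : 'S_n) (a : 'I_k.+1 -> L) h :
  eval L (morph F (diff delta (eff K k.+1 n))) (join a (h \o t)) =
  eval L (morph F (diff delta (eff K k.+1 n))) (join a h).
Proof. by rewrite join_perm -eval_act -morph_act -diff_act eff_perm. Qed.
End Sym.

Section JB.
Variables (K : fieldType) (charK : [pchar K] =i pred0) (B : nat -> K).

Definition JB_valuation : valuation HS_signature (LP K) := fun g =>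
  match g with
  | Ell 0 => bracket K straight
  | Ell _.+1 => 0
  | Eff 0 n => (B n / n`!%:R) *: \sum_(s : 'S_n) phi_nest_perm K s
  | Eff _.+1 _ => 0
  end.

(** A permutation of the wavy inputs only reindexes the sum over $\mathbb S_n$. *)
Lemma JB_model : model (HS_relations (K:=K)) JB_valuation.
Proof.
move=> A o n x y [[|k] s|[|k] n' s t].
- exact: (pgen_model (@br_skew K straight s)).
- rewrite -[LHS]/(act (iperm straight s) 0) act0.
  by rewrite -[RHS]/(_ *: 0) scaler0.
- rewrite -[LHS]/(act (isum (iperm straight s) (iperm wavy t))
  ((B n' / n'`!%:R) *: \sum_(s : 'S_n') phi_nest_perm K s)).
  rewrite -[RHS]/((-1) ^+ odd_perm s *: ((B n' / n'`!%:R) *: \sum_(s : 'S_n')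
    phi_nest_perm K s)).
  have -> : s = 1%g by apply/permP => i; rewrite !ord1.
  rewrite odd_perm1 scale1r actZ act_sum; congr (_ *: _).
  rewrite [RHS](reindex_inj (mulIg t)); apply: eq_bigr => u _.
  rewrite /phi_nest_perm act_icomp; apply: act_ext.
  by iso_eq; rewrite ?perm1 ?permM.
- rewrite -[LHS]/(act (isum (iperm straight s) (iperm wavy t)) 0) act0.
  by rewrite -[RHS]/(_ *: 0) scaler0.
Qed.

Definition JB_morphism : operad_morphism (HS K) (LP K) := lift JB_model.

Lemma JB_ell2 : morph JB_morphism (ell K 2) = bracket K straight.
Proof. exact: (lift_gen JB_model (Ell 0)). Qed.
Lemma JB_eff1 n : morph JB_morphism (eff K 1 n) = (B n / n`!%:R) *: \sum_(s : 'S_n)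
  phi_nest_perm K s.
Proof. exact: (lift_gen JB_model (Eff 0 n)). Qed.

Section Nest.
Variable L : lie_pair K.

Fixpoint iter_br n (z : L) (f : nat -> L) : L :=
  if n is n'.+1 then br (iter_br n' z f) (f n') else z.

Lemma eval_phi_nest n x (f : nat -> L) : (forall k, pr wavy (f k) = f k) ->
  eval L (phi_nest K n) (join (fun=> x) (fun j : 'I_n => f j)) = iter_br n (ph x) f.
Proof.
move=> fw; elim: n => [|n IH].
  rewrite eval_phi.
  have -> : (ord0 : 'I_(1 + 0)) = lshift 0 (ord0 : 'I_1) by exact: val_inj.
  by rewrite joinL.
rewrite -[phi_nest K n.+1]/(act (isum (iid (mono straight 1))
  (icast wavy (addn1 n) \oi imerge wavy n 1)
           \oi iassoc _ _ _)
        (comp (addr0 0) (act (isplit wavy 1 1) (bracket K wavy)) (phi_nest K n))).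
rewrite eval_act eval_comp eval_act eval_bracket /ord2_0 /ord2_1 [X in br (pr _ X) _]joinL.
rewrite eval_pr [X in br _ (pr _ X)]joinR /= -[f n]fw; congr (br _ (pr _ _)).
  rewrite -IH; congr (eval _ _ _); apply: funext.
  by elim/join_ind => j; do 4 rewrite /= ?(joinL, joinR).
by do 4 rewrite /= ?(joinL, joinR); rewrite addn0.
Qed.

Lemma iter_br_const n z H : iter_br n z (fun=> H) = iter n (adr H) z.
Proof. by elim: n => //= n ->. Qed.

(** Brackets with [H] before and after the one bracket with [z0]. *)
Lemma iter_br_one n p z H z0 : (p < n)%N ->
  iter_br n z (fun j => if j == p then z0 else H)
  = iter (n.-1 - p) (adr H) (br (iter p (adr H) z) z0).
Proof.
elim: n => // n IH; rewrite ltnS leq_eqVlt => /orP [/eqP ->|pn] /=.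
  rewrite eqxx subnn /=; congr (br _ _).
  have : forall m, (m <= n)%N -> iter_br m z (fun j => if j == n then z0 else H) =
    iter m (adr H) z.
    elim=> //= m IHm mn; rewrite IHm ?(ltnW mn) //.
    by have -> : (m == n) = false by apply/negbTE; rewrite neq_ltn mn.
  exact.
have -> : (n == p) = false by apply/negbTE; rewrite neq_ltn pn orbT.
rewrite IH //.
by have -> : (n - p)%N = (n.-1 - p).+1 by lia.
Qed.

Definition bernoulli_coef k : K := B k / k`!%:R.

Lemma eff1_diag_JB k (x H : L) : pr wavy H = H ->
  eff1_diag JB_morphism k x H = (bernoulli_coef k * k`!%:R) *: iter k (adr H) (ph x).
Proof.
move=> Hw; rewrite /eff1_diag /eff1_val /eff_val JB_eff1 evalZ eval_sum -scalerA;
  congr (_ *: _).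
rewrite (eq_bigr (fun=> iter k (adr H) (ph x))) => [|s _].
  by rewrite sumr_const card_Sn scaler_nat.
rewrite /phi_nest_perm eval_act -iter_br_const -(eval_phi_nest k x (f := fun=> H)) //.
congr (eval _ _ _); apply: funext; elim/join_ind => j; rewrite /= !(joinL, joinR) //.
Qed.

(** Each position is taken by the first input in $k!$ of the permutations of
    $k+1$ inputs. *)
Lemma sum_perm_inv k (G : nat -> L) :
  \sum_(s : 'S_k.+1) G ((s^-1)%g ord0) = \sum_(j < k.+1) G j *+ k`!.
Proof.
rewrite (partition_big (fun s : 'S_k.+1 => (s^-1)%g ord0) predT) //=.
apply: eq_bigr => j _; rewrite (eq_bigr (fun=> G j)) => [|s /eqP -> //].
rewrite sumr_const; congr (_ *+ _).
pose N i := #|[pred s : 'S_k.+1 | (s^-1)%g ord0 == i]|.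
have Ne i : N i = N j.
  rewrite /N -!sum1_card (reindex_inj (mulgI (tperm i j))) /=.
  by apply: eq_bigl => s; rewrite !inE invMg tpermV permM
    (can2_eq (tpermK _ _) (tpermK _ _)) tpermL.
have : (\sum_(i < k.+1) N i = k.+1`!)%N.
  rewrite -card_Sn -sum1_card [RHS](partition_big (fun s : 'S_k.+1 => (s^-1)%g ord0)
    predT) //=.
  by apply: eq_bigr => i _; rewrite /N -sum1_card.
rewrite (eq_bigr (fun=> N j)) => [|i _]; last exact: Ne.
rewrite sum_nat_const card_ord factS => /eqP; rewrite eqn_pmul2l // => /eqP <-.
by apply: eq_card => s; rewrite inE.
Qed.

(** The argument [z] occurs at each of the $k+1$ positions of the nested bracket
    in $k!$ of the permutations. *)
Lemma eff1_slot_JB k (x z H : L) : pr wavy H = H -> pr wavy z = z ->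
  eff1_slot JB_morphism k x z H = (bernoulli_coef k.+1 * k`!%:R) *:
     \sum_(j < k.+1) iter (k - j) (adr H) (br (iter j (adr H) (ph x)) z).
Proof.
move=> Hw zw; rewrite /eff1_slot /eff1_val /eff_val JB_eff1 evalZ eval_sum -scalerA;
  congr (_ *: _).
rewrite scaler_sumr.
under [RHS]eq_bigr => j _ do rewrite scaler_nat.
rewrite -(sum_perm_inv k (fun j => iter (k - j) (adr H) (br (iter j (adr H) (ph x)) z))).
apply: eq_bigr => s _; rewrite /phi_nest_perm eval_act.
have pk : ((s^-1)%g ord0 < k.+1)%N by exact: ltn_ord.
transitivity (iter_br k.+1 (ph x) (fun j => if j == (s^-1)%g ord0 then z else H));
  last exact: iter_br_one.
rewrite -eval_phi_nest; last by move=> i; case: ifP.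
congr (eval _ _ _); apply: funext; elim/join_ind => j; rewrite /= !(joinL, joinR) //=.
have -> : (j == (s^-1)%g ord0 :> nat) = (s j == ord0).
  rewrite -[LHS]/(val j == val ((s^-1)%g ord0)) val_eqE.
  by rewrite -(inj_eq (@perm_inj _ s) j) permKV.
elim/(@join_ind 1 k): (s j) => l; rewrite ?(joinL, joinR).
  by rewrite (ord1 l).
by [].
Qed.
End Nest.
End JB.

(** * Compatibility with the differentials *)

Lemma adr_iterZ (K : fieldType) (L : lie_pair K) (H : L) k t x :
  iter k (adr H) (t *: x) = t *: iter k (adr H) x.
Proof. by elim: k => //= k ->; exact: brZl. Qed.

Section Solutions.
Variables (K : fieldType) (charK : [pchar K] =i pred0) (B : nat -> K).
Hypothesis hB : bernoulli B.
Variables (delta : differential (HS K)) (hdelta : HS_differential delta).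

Lemma bernoulli_coefP n :
  \sum_(k < n.+1) bernoulli_coef B k * expm1_coef K (n - k)%N = (n == 1%N)%:R.
Proof. exact: hB. Qed.

Lemma bernoulli0 : B 0%N = 1.
Proof.
have := hB 1%N; rewrite 2!big_ord_recl big_ord0 /= mulr0 !addr0.
by rewrite !invr1 !mulr1.
Qed.

(** The equation is $n!$ times [lie_bernoulli] at $\phi(x)$ and $\phi(y)$; the
    binomial coefficient turns $k!\,(n-k)!$ into $n!$. *)
Lemma JB_diff_const (L : lie_pair K) n (x y H : L) :
  pr straight x = x -> pr straight y = y -> pr wavy H = H ->
  eval L (morph (JB_morphism B) (diff delta (eff K 2 n)))
    (join (fun i : 'I_2 => if i == ord2_0 then x else y) (fun=> H)) = 0.
Proof.
move=> xs ys Hw; rewrite (eval_diff_eff2 (JB_ell2 B) hdelta) xs ys.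
have e := lie_bernoulli charK bernoulli_coefP H (ph x) (ph y) n.
transitivity (n`!%:R *: (0 : L)); last exact: scaler0.
rewrite -[X in _ = _ *: X]e scalerDr scaler_sumr {e}.
congr (_ + _).
  by rewrite eff1_diag_JB // -[in ph (br _ _)]xs -[in ph (br _ y)]ys ph_br scalerA mulrC.
apply: eq_bigr => k _; have kn : (k <= n)%N by rewrite -ltnS.
have gw z : pr wavy (eff1_diag (JB_morphism B) (n - k) z H) = eff1_diag (JB_morphism B)
  (n - k) z H by exact: eval_pr.
rewrite !eff1_slot_JB // !eff1_diag_JB // -scaler_nat -scalerBr -sumrB !scalerA scaler_sumr.
rewrite [RHS]scaler_sumr; apply: eq_bigr => j _.
rewrite (brC (iter j _ (ph y))) !brZr !brZl adr_iterN !adr_iterZ opprK -scalerDr scalerA.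
congr (_ *: _); rewrite -(bin_fact kn) !natrM; ring.
Qed.

Lemma JB_diff_eff2 n : morph (JB_morphism B) (diff delta (eff K 2 n)) = 0.
Proof.
apply: (@LP_complete K (mixed 2 n) wavy) => L v.
set D := morph _ _.
have -> : v = join (v \o lshift n) (v \o @rshift 2 n).
  by apply: funext; elim/join_ind => i; rewrite ?(joinL, joinR).
set a := v \o lshift n.
apply: (polarisation_sym charK (F := fun h => eval L D (join a h))).
- by apply: (@multilinear_join _ _ _ _ (eval L D)); exact: (endo_multi (eval L D)).
- by move=> s h; exact: eval_diff_eff_perm.
move=> H; rewrite -eval_prA.
rewrite -(JB_diff_const n (pr_pr straight (a ord2_0)) (pr_pr straight (a ord2_1))
  (pr_pr wavy H)).
congr (eval _ _ _); apply: funext; elim/join_ind => i; rewrite /= ?(joinL, joinR) /=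
  ?(joinL, joinR) //.
by move: i; elim/ord2P.
Qed.

(** $F\circ\delta$ is a derivation along $F$, so it vanishes once it does on
    generators. *)
Lemma dg_of_gens (F : operad_morphism (HS K) (LP K)) :
  (forall g, morph F (diff delta (pgen (HS_relations (K:=K)) g)) = 0) ->
  forall A o n (x : oper (HS K) A o n), morph F (diff delta x) = 0.
Proof.
move=> Fg A o n x.
have [t ->] : exists t, x = interp (pgen (HS_relations (K:=K))) t.
  by exists (generic_quotient.repr x); rewrite interp_pgen -{1}[x]generic_quotient.reprK.
have d0 A' o' n' : diff delta (0 : oper (HS K) A' o' n') = 0 :=
  lin0 (@diffP _ _ delta A' o' n').
elim: t => {A o n x}.
- exact: Fg.
- by move=> c; rewrite diff_unit morph0.
- move=> A C o n f x IH.
  by rewrite -[interp _ _]/(act f (interp (pgen _) x)) diff_act morph_act IH act0.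
- move=> c A C o m n k e a IHa b IHb.
  rewrite -[interp _ _]/(comp e (interp (pgen _) a) (interp (pgen _) b)).
  have el : m + 1 + n = k + 1 by rewrite -e addrAC.
  have er : m + (n + 1) = k + 1 by rewrite -e addrA.
  rewrite (diff_comp delta e el er) morphD morphZ (morph_comp F el) (morph_comp F er)
    IHa IHb.
  by rewrite comp0l comp0r scaler0 addr0.
- by move=> A o n; rewrite -[interp _ _]/0 d0 morph0.
- move=> A o n x IHx y IHy.
  rewrite -[interp _ _]/(interp (pgen _) x + interp (pgen _) y).
  by have := diffP delta 1 (interp (pgen (HS_relations (K:=K))) x)
    (interp (pgen (HS_relations (K:=K))) y);
    rewrite !scale1r => ->; rewrite morphD IHx IHy addr0.
- move=> A o n t x IHx.
  rewrite -[interp _ _]/(t *: interp (pgen _) x).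
  have := diffP delta t (interp (pgen (HS_relations (K:=K))) x) 0.
  by rewrite d0 !addr0 => ->; rewrite morphZ IHx scaler0.
Qed.

Lemma JB_dg A o n (x : oper (HS K) A o n) : morph (JB_morphism B) (diff delta x) = 0.
Proof.
apply: dg_of_gens => -[k|k m].
- case: (eqVneq k 1%N) => [->|k1].
    apply: (@LP_complete K (mono straight 3) straight) => L v.
    exact: (eval_diff_ell3 (JB_ell2 B) hdelta).
  by apply: LP_deg => /=; apply/eqP; move/eqP: k1; lia.
- case: (eqVneq k 1%N) => [->|k1]; first exact: JB_diff_eff2.
  by apply: LP_deg => /=; apply/eqP; move/eqP: k1; lia.
Qed.

(** * Uniqueness *)

Definition double_pair (L : lie_pair K) : lie_pair K.
Proof.
exists (carrier L) (fun _ x => x) (@br K L) (fun x => x) => //.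
- exact: brPl.
- exact: brC.
- exact: jacobi.
Defined.

(** The map of Lie pairs $(\mathfrak g,\mathfrak h,\phi)\to(L,L,\mathrm{id})$ that
    is $\phi$ on $\mathfrak g$ and the inclusion on $\mathfrak h$. *)
Definition to_double (L : lie_pair K) c (x : L) : double_pair L :=
  match c with straight => ph x | wavy => pr wavy x end.

(** Operations are natural in the Lie pair. *)
Lemma eval_double (L : lie_pair K) A o (x : oper (LP K) A o 0) (v : 'I_(width A) -> L) :
  eval (double_pair L) x (fun i => to_double (A i) (v i)) = to_double o (eval L x v).
Proof.
elim: (expressibleP x) v => {A o x}.
- by move=> c v; rewrite !eval_unit /=; case: (c) => /=; rewrite ?ph_pr ?pr_pr.
- move=> A C o f x _ IH v; rewrite !eval_act -IH; congr (eval _ _ _).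
  by apply: funext => i /=; rewrite relab_tint.
- move=> A o v; rewrite !eval0; case: (o) => /=; by rewrite ?ph0 ?pr0.
- move=> A o t x y _ IHx _ IHy v; rewrite !evalD !evalZ IHx IHy.
  by case: (o) (eval L x v) (eval L y v) => X Y /=; rewrite ?phP ?prP.
- move=> c A C x y _ IHx _ IHy v; rewrite !eval_opbr.
  have -> : (fun i => to_double ((A |+| C) i) (v i)) \o lshift (width C) =
     (fun i => to_double (A i) ((v \o lshift _) i)) by apply: funext => i; rewrite /= joinL.
  have -> : (fun i => to_double ((A |+| C) i) (v i)) \o @rshift (width A) (width C) =
     (fun i => to_double (C i) ((v \o @rshift _ _) i)) by apply: funext => i;
       rewrite /= joinR.
  rewrite IHx IHy -[in RHS]eval_pr -[eval L y _]eval_pr.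
  move: (eval L x _) (eval L y _) => X Y; by case: (c) => /=; rewrite ?ph_br ?ph_pr ?pr_pr
    ?pr_br.
- by move=> A x _ IH v; rewrite !eval_opphi IH /= pr_ph.
Qed.

(** With all arguments equal to [X] the values are multiples of [X], and any
    bracket of multiples of [X] is zero. *)
Lemma eval_double_const (L : lie_pair K) A o (x : oper (LP K) A o 0) (X : L) :
  exists2 c, eval (double_pair L) x (fun=> X) = c *: (X : double_pair L) & width A != 1%N
    -> c = 0.
Proof.
elim: (expressibleP x) => {A o x}.
- by move=> c; exists 1; rewrite ?eval_unit ?scale1r.
- move=> A C o f x _ [c xc c0]; exists c; first by rewrite eval_act.
  by have := bij_eq_card (relab_bij f); rewrite !card_ord => <-.
- by move=> A o; exists 0; rewrite ?eval0 ?scale0r.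
- move=> A o t x y _ [c xc c0] _ [d yd d0]; exists (t * c + d).
    by rewrite evalD evalZ xc yd scalerA scalerDl.
  by move=> A1; rewrite c0 ?d0 // mulr0 addr0.
- move=> o A C x y _ [c xc c0] _ [d yd d0]; exists 0 => //.
  rewrite eval_opbr [eval _ x _]xc [eval _ y _]yd scale0r brZl brZr.
  have : br X X = - br X X by exact: brC.
  move/eqP; rewrite -addr_eq0 -mulr2n -scaler_nat scaler_eq0.
  rewrite ((pcharf0P K).1 charK) /= => /eqP XX.
  by rewrite (XX : br (X : double_pair L) X = 0) !scaler0.
- by move=> A x _ [c xc c0]; exists c; rewrite ?eval_opphi.
Qed.

(** In the equation for $f_{2,n}$ all terms but those with $k=n$ involve only the
    $f_{1,k}$ with $k\le n$, on which [F] and [G] agree. *)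
Lemma eff_agree (F G : operad_morphism (HS K) (LP K)) n :
  morph F (ell K 2) = bracket K straight -> morph G (ell K 2) = bracket K straight ->
  morph F (diff delta (eff K 2 n)) = 0 -> morph G (diff delta (eff K 2 n)) = 0 ->
  morph F (eff K 1 0) = phi K ->
  (forall k, (k <= n)%N -> morph F (eff K 1 k) = morph G (eff K 1 k)) ->
  morph F (eff K 1 n.+1) = morph G (eff K 1 n.+1).
Proof.
move=> F2 G2 Fd Gd F0 FG; apply/eqP; rewrite -subr_eq0; apply/eqP.
set D : oper (LP K) (mixed 1 n.+1) wavy 0 := _ - _.
apply: LP_complete => L v.
(* The output of D is wavy, where the map to the doubled pair is the inclusion. *)
suff E0 w : eval (double_pair L) D w = 0.
  by have := eval_double D v; rewrite E0 /= eval_pr.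
have Dsym (t : 'S_n.+1) a h : eval (double_pair L) D (join a (h \o t)) =
  eval (double_pair L) D (join a h).
  by rewrite /D !evalD !evalN !eval_eff_perm.
(* At least two inputs, all equal: brackets of an element with itself. *)
have DC (X : double_pair L) : eval (double_pair L) D (fun=> X) = 0.
  by have [c -> ->] := eval_double_const D X; rewrite ?scale0r.
(* Subtracting the two equations leaves the terms with k = n, where the
   inner operation is phi, the identity in the doubled pair. *)
have swap x y H : eval (double_pair L) D
  (@join 1 n.+1 _ (fun=> x) (@join 1 n _ (fun=> y) (fun=> H)))
   = eval (double_pair L) D (@join 1 n.+1 _ (fun=> y) (@join 1 n _ (fun=> x) (fun=> H))).
  have gcE k z : (k <= n)%N -> eff1_diag (L := double_pair L) F k z H = eff1_diag G k z H.
    by move=> kn; rewrite /eff1_diag /eff1_val /eff_val FG.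
  have gzE k u z : (k < n)%N -> eff1_slot (L := double_pair L) F k u z H = eff1_slot G
    k u z H.
    by move=> kn; rewrite /eff1_slot /eff1_val /eff_val FG.
  have gc0 z : eff1_diag (L := double_pair L) G 0 z H = z.
    rewrite /eff1_diag /eff1_val /eff_val -FG // F0 eval_phi.
    have -> : (ord0 : 'I_(1 + 0)) = lshift 0 (ord0 : 'I_1) by exact: val_inj.
    by rewrite joinL.
  have := eval_diff_eff2 (L := double_pair L) F2 hdelta n x y H.
  have := eval_diff_eff2 (L := double_pair L) G2 hdelta n x y H.
  rewrite Fd Gd !eval0 !big_ord_recr /= subnn binn !mulr1n.
  rewrite (gcE n) // !(gcE 0%N) // !gc0.
  rewrite [in X in _ -> X](eq_bigr (fun k : 'I_n =>
     (eff1_slot G k x (eff1_diag G (n - k) y H) H - eff1_slot G k y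
       (eff1_diag G (n - k) x H) H) *+ 'C(n, k))); last first.
    by move=> k _; rewrite !gzE // !gcE ?leq_subr.
  move=> h1 h2; have /addrI/addrI := etrans (esym h1) h2; rewrite /D !evalD !evalN.
  rewrite -!/(eff1_slot (L := double_pair L) F n _ _ H) -!/(eff1_slot (L := double_pair L)
    G n _ _ H) => e.
  have key (p q r t : L) : r - t = p - q -> p - r = q - t.
    by move=> /eqP; rewrite subr_eq => /eqP ->; rewrite !opprD opprK addrA addrA
      subrr add0r.
  exact: key e.
(* The n + 2 arguments of D, one of them x and the others H, give the same
   value wherever x stands: for a wavy x, move it to the first wavy input and
   swap it with the straight one.  So polarisation is a multiplication by (n+2)!. *)
have Dx x H : eval (double_pair L) D (@join 1 n.+1 _ (fun=> x) (fun=> H)) = 0.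
  pose v0 : 'I_(1 + n.+1) -> double_pair L := @join 1 n.+1 _ (fun=> x) (fun=> H).
  have := polarisation (endo_multi (eval (double_pair L) D)) DC v0.
  rewrite (eq_bigr (fun=> eval (double_pair L) D v0)) => [|s _].
    rewrite sumr_const card_Sn -scaler_nat => /eqP; rewrite scaler_eq0.
    by rewrite (negPf (fact_unit charK _)) => /eqP.
  have -> : v0 \o s = fun j => if j == (s^-1)%g (lshift _ (ord0 : 'I_1)) then x else H.
    apply: funext => j /=; rewrite -(inj_eq (@perm_inj _ s)) permKV /v0.
    elim/(@join_ind 1 n.+1): (s j) => i; rewrite ?(joinL, joinR).
      by rewrite (ord1 i) eqxx.
    by rewrite eq_rlshift.
  elim/(@join_ind 1 n.+1): ((s^-1)%g _) => p.
    congr (eval _ _ _); apply: funext; rewrite /v0; elim/(@join_ind 1 n.+1) => j;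
      rewrite ?(joinL, joinR).
      by rewrite (ord1 p) (ord1 j) eqxx.
    by rewrite eq_rlshift.
  have -> : v0 = @join 1 n.+1 _ (fun=> x) (@join 1 n _ (fun=> H) (fun=> H)).
    apply: funext; rewrite /v0; elim/(@join_ind 1 n.+1) => j; rewrite ?(joinL, joinR) //.
    by elim/(@join_ind 1 n): j => j; rewrite ?(joinL, joinR).
  rewrite swap -(Dsym (tperm p ord0)); congr (eval _ _ _); apply: funext.
  elim/(@join_ind 1 n.+1) => j; rewrite ?(joinL, joinR) /=.
    by rewrite eq_lrshift.
  rewrite eq_rshift; have -> : (j == p) = (tperm p ord0 j == ord0).
    by rewrite -{2}(tpermL p ord0) (inj_eq perm_inj).
  elim/(@join_ind 1 n): (tperm _ _ _) => i; rewrite ?(joinL, joinR) //.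
  by rewrite (ord1 i).
have -> : w = @join 1 n.+1 _ (fun=> w (lshift _ (ord0 : 'I_1))) (w \o @rshift 1 n.+1).
  by apply: funext; elim/(@join_ind 1 n.+1) => i; rewrite ?(joinL, joinR) // (ord1 i).
apply: (polarisation_sym charK (F := fun h => eval (double_pair L) D (join _ h))).
- by apply: (@multilinear_join _ _ _ _ (eval (double_pair L) D));
  exact: (endo_multi (eval (double_pair L) D)).
- by move=> s h; exact: Dsym.
- by move=> H; exact: Dx.
Qed.
End Solutions.

Theorem theorem4p1p1 (K : fieldType) (charK : [pchar K] =i pred0)
  (B : nat -> K) (hB : bernoulli B)
  (delta : differential (HS K)) (hdelta : HS_differential delta) :
  let HSinfty := DgOperad delta in
  let LPzero := DgOperad (zero_diff (LP K)) in
  exists JB : dg_morphism HSinfty LPzero,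
    [/\ morph JB (eff K 1 0) = phi K /\ morph JB (ell K 2) = bracket K straight,
        forall F : dg_morphism HSinfty LPzero,
          morph F (eff K 1 0) = phi K -> morph F (ell K 2) = bracket K straight ->
          forall A o n (x : oper (HS K) A o n), morph F x = morph JB x,
        forall m, (2 <= m)%N -> m != 2%N -> morph JB (ell K m) = 0,
        forall n, morph JB (eff K 1 n)
          = (B n / n`!%:R) *: \sum_(s : 'S_n) phi_nest_perm K s
      & forall m n, (1 <= m)%N -> m != 1%N -> morph JB (eff K m n) = 0].
Proof.
move=> HSinfty LPzero.
have JBd A o n (x : oper HSinfty A o n) :
    morph (JB_morphism B) (diff (dg_diff HSinfty) x)
    = diff (dg_diff LPzero) (morph (JB_morphism B) x).
  exact: JB_dg.
have JB0 : morph (JB_morphism B) (eff K 1 0) = phi K.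
  rewrite JB_eff1 (bernoulli0 hB) fact0 divr1 scale1r.
  rewrite (big_pred1 1%g) => [|s]; last by apply/esym/eqP/permP => -[].
  apply: act_id; elim/join_ind => i; last by case: i.
  by rewrite /= joinL.
exists (@DgMorphism K HSinfty LPzero (JB_morphism B) JBd); split.
- by split; [exact: JB0 | exact: JB_ell2].
- move=> F F0 F2; apply: lift_unique.
  have Fd n : morph F (diff delta (eff K 2 n)) = 0 by exact: (dg_morph_diff F).
  have Feff n : morph F (eff K 1 n) = morph (JB_morphism B) (eff K 1 n).
    elim/ltn_ind: n => -[|n] IH; first by rewrite F0 JB0.
    apply: (eff_agree charK hdelta F2 (JB_ell2 B) (Fd n) (JB_diff_eff2 charK hB hdelta n)
      F0).
    by move=> k kn; exact: IH.
  case=> [[|k]|[|k] n].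
  + exact: F2.
  + by apply: LP_deg => /=; apply/eqP; lia.
  + by rewrite -[LHS]/(morph F (eff K 1 n)) Feff JB_eff1.
  + by apply: LP_deg => /=; apply/eqP; lia.
- by move=> m m2 mn2; apply: LP_deg; apply/eqP; move/eqP: mn2; lia.
- exact: JB_eff1.
- by move=> m n m1 mn1; apply: LP_deg; apply/eqP; move/eqP: mn1; lia.
Qed.
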